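(* If $K$ is a knot such that $\operatorname{MRI}(K)<\operatorname{Reg}(K)$, then $\operatorname{MRI}(K)\geq 4$ and $\operatorname{Reg}(K)\geq 5$.
   Context: For a knot diagram $D$, a region is a connected component of the complement in $S^2$ of the underlying projection of $D$ (crossing information forgotten). A region crossing change at a region $R$ changes every crossing in the boundary of $R$; $c(R)$ denotes the number of crossings in the boundary of $R$. A set of unknotting regions of $D$ is a set of regions such that performing region crossing changes at all of them yields a diagram of the unknot. $\operatorname{MRI}(D)$ is the minimum of $\sum_{j=1}^k c(R_{i_j})$ over all sets of unknotting regions $\{R_{i_1},\dots,R_{i_k}\}$ of $D$ (a crossing counted once for each region of the set containing it in its boundary), and $\operatorname{MRI}(K)$ is the minimum of $\operatorname{MRI}(D)$ over all diagrams $D$ of $K$. An unknotting region of $D$ is a single region $R$ such that the region crossing change at $R$ yields a diagram of the unknot. The region index $\operatorname{Reg}(D)$ is the minimum of $c(R)$ over all unknotting regions $R$ of $D$, and $\operatorname{Reg}(D)=\infty$ if $D$ has no unknotting region; $\operatorname{Reg}(K)$ is the minimum of $\operatorname{Reg}(D)$ over all diagrams $D$ of $K$. *)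

(* Defs.v *)
From HB Require Import structures.
From mathcomp Require Import all_boot all_order all_algebra.
From mathcomp Require Import all_classical all_reals all_analysis.
From mathcomp Require Import Rstruct Rstruct_topology.
From Stdlib Require Import Relations.Relation_Operators.
From Stdlib Require List.

Set Implicit Arguments.
Unset Strict Implicit.
Unset Printing Implicit Defensive.

Import Order.TTheory GRing.Theory Num.Theory.
Import numFieldNormedType.Exports.
Local Open Scope classical_set_scope.
Local Open Scope ring_scope.

Section Knots.
Variable R : realType.

Definition pt3 := (R * R * R)%type.
Definition pt2 := (R * R)%type.

Definition proj (p : pt3) : pt2 := (p.1.1, p.1.2).
Definition height (p : pt3) : R := p.2.

Definition lerp (a b : pt3) (t : R) : pt3 :=
  (a.1.1 + t * (b.1.1 - a.1.1), a.1.2 + t * (b.1.2 - a.1.2), a.2 + t * (b.2 - a.2)).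

Definition seg (a b : pt3) : set pt3 :=
  [set p | exists t : R, 0 <= t <= 1 /\ p = lerp a b t].

Definition tri (a b c : pt3) : set pt3 :=
  [set p | exists s t u : R, [/\ 0 <= s, 0 <= t, 0 <= u, s + t + u = 1 &
     p = (s * a.1.1 + t * b.1.1 + u * c.1.1,
          s * a.1.2 + t * b.1.2 + u * c.1.2,
          s * a.2 + t * b.2 + u * c.2)]].

(* A closed polygon is given by its cyclic list of vertices. *)
Definition vtx (P : seq pt3) (i : nat) : pt3 := nth (0, 0, 0) P (i %% size P).
Definition edge (P : seq pt3) (i : nat) : set pt3 := seg (vtx P i) (vtx P i.+1).

Definition kimg (P : seq pt3) : set pt3 :=
  [set p | exists2 i, (i < size P)%N & edge P i p].

Definition knot_polygon (P : seq pt3) : Prop :=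
  [/\ (3 <= size P)%N, uniq P &
   forall i j, (i < size P)%N -> (j < size P)%N -> i <> j ->
     edge P i `&` edge P j =
       (if j == (i.+1 %% size P)%N then [set vtx P j]
        else if i == (j.+1 %% size P)%N then [set vtx P i] else set0)].

Definition delta_move (P Q : seq pt3) : Prop :=
  exists i c, [/\ (i < size P)%N,
    tri (vtx P i) (vtx P i.+1) c `&` kimg P = edge P i &
    Q = take i.+1 P ++ c :: drop i.+1 P].

(* elementary steps: Delta-moves, their inverses, and re-listing the same
   polygon (cyclic shift of the starting vertex, reversal) *)
Definition knot_step (P Q : seq pt3) : Prop :=
  [/\ knot_polygon P, knot_polygon Q &
      [\/ delta_move P Q, delta_move Q P, Q = rot 1 P | Q = rev P]].

Definition knot_equiv : seq pt3 -> seq pt3 -> Prop :=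
  clos_refl_sym_trans (seq pt3) knot_step.

Definition is_unknot (P : seq pt3) : Prop :=
  exists T, [/\ knot_polygon T, size T = 3%N & knot_equiv P T].

Definition preim (P : seq pt3) (q : pt2) : set pt3 :=
  [set p | kimg P p /\ proj p = q].

Definition pimg (P : seq pt3) : set pt2 := proj @` kimg P.

Definition double_pt (P : seq pt3) (q : pt2) : Prop :=
  exists p1 p2, p1 <> p2 /\ preim P q = [set p1] `|` [set p2].

Definition regular (P : seq pt3) : Prop :=
  [/\ knot_polygon P,
      (forall q p1 p2 p3, preim P q p1 -> preim P q p2 -> preim P q p3 ->
          [\/ p1 = p2, p1 = p3 | p2 = p3]),
      (exists s : seq pt2, forall q, double_pt P q <-> q \in s) &
      (forall i, (i < size P)%N -> ~ double_pt P (proj (vtx P i)))].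

Definition over_at (P : seq pt3) (q : pt2) (i : nat) : Prop :=
  exists p, [/\ preim P q p, edge P i p &
                forall p', preim P q p' -> height p' <= height p].
Definition under_at (P : seq pt3) (q : pt2) (i : nat) : Prop :=
  exists p, [/\ preim P q p, edge P i p &
                forall p', preim P q p' -> height p <= height p'].

Definition crossing_change (P : seq pt3) (C : set pt2) (Q : seq pt3) : Prop :=
  [/\ regular Q, size Q = size P,
      (forall i, (i < size P)%N -> proj (vtx Q i) = proj (vtx P i)) &
      (forall q, double_pt P q -> forall i,
          (C q -> (over_at Q q i <-> under_at P q i)) /\
          (~ C q -> (over_at Q q i <-> over_at P q i)))].

(* regions: connected components of the complement of the projection
   (in R^2; these correspond bijectively to the regions in S^2) *)
Definition region (P : seq pt3) (A : set pt2) : Prop :=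
  exists2 q, ~ pimg P q & A = connected_component (~` pimg P) q.

Definition frontier (A : set pt2) : set pt2 :=
  closure A `\` interior A.

Definition ncross (P : seq pt3) (A : set pt2) (n : nat) : Prop :=
  exists s : seq pt2, [/\ uniq s, size s = n &
    forall q, q \in s <-> (double_pt P q /\ frontier A q)].

(* performing region crossing changes at all regions of rs changes a crossing
   iff it lies on the boundary of an odd number of them *)
Definition rcc_set (rs : seq (set pt2)) : set pt2 :=
  [set q | odd (size [seq A <- rs | `[< frontier A q >] ])].

Definition unknotting_regions (P : seq pt3) (rs : seq (set pt2)) : Prop :=
  [/\ List.NoDup rs, (forall A, List.In A rs -> region P A) &
      exists Q, crossing_change P (rcc_set rs) Q /\ is_unknot Q].

Definition region_weight (P : seq pt3) (rs : seq (set pt2)) (n : nat) : Prop :=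
  exists cs : seq nat, [/\ size cs = size rs,
    (forall i, (i < size rs)%N -> ncross P (nth set0 rs i) (nth 0%N cs i)) &
    n = sumn cs].

Definition MRI_value (K : seq pt3) (n : nat) : Prop :=
  exists D rs, [/\ regular D, knot_equiv D K, unknotting_regions D rs &
                   region_weight D rs n].

Definition Reg_value (K : seq pt3) (n : nat) : Prop :=
  exists D A, [/\ regular D, knot_equiv D K, unknotting_regions D [:: A] &
                  ncross D A n].

End Knots.

(* ---------- minima in N u {oo}  (None = oo) ---------- *)
Lemma ex_asbool (P : nat -> Prop) : (exists n, P n) -> exists n, `[< P n >].
Proof. by move=> [n Hn]; exists n; apply: asboolT. Qed.

Definition min_ext (P : nat -> Prop) : option nat :=
  match pselect (exists n, P n) with
  | left H => Some (ex_minn (ex_asbool H))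
  | right _ => None
  end.

Definition ext_lt (a b : option nat) : Prop :=
  match a, b with
  | Some m, Some n => (m < n)%N
  | Some _, None => True
  | None, _ => False
  end.

Definition ext_le (a b : option nat) : Prop :=
  match a, b with
  | Some m, Some n => (m <= n)%N
  | _, None => True
  | None, Some _ => False
  end.

(* The knot K is represented by any polygonal knot of its type; Stdlib reals. *)
Definition MRI (K : seq (pt3 Rdefinitions.R)) : option nat := min_ext (MRI_value K).
Definition Reg (K : seq (pt3 Rdefinitions.R)) : option nat := min_ext (Reg_value K).

(* Main.v *)
(* It suffices to show that MRI(K) <= 3 implies Reg(K) <= MRI(K).  Let a set of
   unknotting regions of a diagram D realise MRI(K) <= 3.  If the set is empty,
   K is the unknot, and a triangle has Reg = 0.  If it is a single region there
   is nothing to do.  Otherwise some region A has c(A) <= 1.  If c(A) = 0, then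
   D has no crossing at all.  If c(A) = 1, walking along the knot in both
   directions from a point of the boundary of A the first crossing met is the
   only crossing q of A, so an arc of the knot is a loop based at q with no
   other crossing.  Such an arc can be lifted above (or pushed below) the rest
   of the knot and contracted there, so changing q does not change the knot
   type; after changing q in D, the region A can be dropped from the set.

   A pair of polygons over one projection is handled as one list of pairs of
   points, i.e. as a polygon in R^3 x R^3: its point set [cl jlerp L] records
   which points correspond, and does not change under subdivision or under a
   change of base point. *)

Require Import Defs.
From mathcomp Require Import all_boot all_order all_algebra.
From mathcomp Require Import all_classical all_reals all_analysis.
From mathcomp Require Import Rstruct Rstruct_topology.
From mathcomp Require Import ring lra.
From mathcomp Require Import zify.
From Stdlib Require Import Relations.Relation_Operators.
From Stdlib Require List.

Set Implicit Arguments.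
Unset Strict Implicit.
Unset Printing Implicit Defensive.

Import Order.TTheory GRing.Theory Num.Theory.
Import numFieldNormedType.Exports.
Import Defs.
Local Open Scope classical_set_scope.
Local Open Scope ring_scope.

(** * Polygonal paths *)

Section Paths.
Variables (R : realType) (T : Type) (f : T -> T -> R -> T).

(** [crossing_change] compares polygons vertex by vertex and prescribes only the order of the
    strands at crossings. Two facts about Delta-moves therefore carry the proof: polygons with the
    same projection and the same crossings are equivalent, and a kink can be flipped. For the
    second, lifting its loop far up and pushing it far down give two polygons that differ at q only
    and contract to the same shorter polygon; one of the two has the crossings of D. On the side of
    the regions no Jordan curve theorem is used. Near a point of the knot that is no crossing the
    projection cuts a small box into two sectors, each bounded by both branches, so the closure of A
    spreads along the knot up to the next crossing. Dropping A is sound because D with q changed and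
    the result of all the original changes differ exactly by the changes at the remaining regions.
    The bound 3 enters because two or more regions with at least 2 crossings each weigh at least 4,
    and each dropped region lowers the weight by one. *)

Definition affine : Prop :=
  [/\ forall a b, f a b 0 = a, forall a b, f a b 1 = b,
      forall a b s t, f a (f a b t) s = f a b (s * t) &
      forall a b s t, f (f a b t) b s = f a b (t + s * (1 - t))].

Definition gseg a b : set T := [set p | exists t : R, 0 <= t <= 1 /\ p = f a b t].

Fixpoint gpath a s : set T :=
  if s is b :: s' then gseg a b `|` gpath b s' else [set a].

Definition cl s : set T := if s is a :: s' then gpath a (rcons s' a) else set0.

Lemma gsegI a b t : 0 <= t <= 1 -> gseg a b (f a b t).
Proof. by move=> h; exists t. Qed.

Hypothesis Hf : affine.

Lemma gsegL a b : gseg a b a.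
Proof. by case: Hf => f0 _ _ _; exists 0; rewrite f0 lexx ler01. Qed.

Lemma gsegR a b : gseg a b b.
Proof. by case: Hf => _ f1 _ _; exists 1; rewrite f1 lexx ler01. Qed.

Lemma gpath_head a s : gpath a s a.
Proof. by case: s => [|b s] //=; left; apply: gsegL. Qed.

Lemma gpath_cat a s1 s2 : gpath a (s1 ++ s2) = gpath a s1 `|` gpath (last a s1) s2.
Proof.
elim: s1 a => [|b s1 IH] a /=; last by rewrite IH setUA.
by apply/seteqP; split=> [x|x [->|//]]; [right | apply: gpath_head].
Qed.

Lemma gpath_last a s : gpath a s (last a s).
Proof. by elim: s a => [|b s IH] a //=; right; apply: IH. Qed.

Lemma gpath_rcons a s b : gpath a (rcons s b) = gpath a s `|` gseg (last a s) b.
Proof.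
rewrite -cats1 gpath_cat /=; congr (_ `|` _).
by apply/seteqP; split=> [x [//|->]|x]; [apply: gsegR | left].
Qed.

(** The last two laws of [affine] rescale the parameter: the two pieces are the parameter intervals
    [[0, t]] and [[t, 1]]. *)
Lemma gseg_split a b t : 0 <= t <= 1 ->
  gseg a (f a b t) `|` gseg (f a b t) b = gseg a b.
Proof.
case: Hf => f0 f1 fL fR /andP[t0 t1]; apply/seteqP; split=> x.
  case=> [[s [/andP[s0 s1] ->]]|[s [/andP[s0 s1] ->]]].
    by rewrite fL; apply: gsegI; nra.
  by rewrite fR; apply: gsegI; nra.
case=> s [/andP[s0 s1] ->]; case: (leP s t) => st.
  left; case: (eqVneq t 0) => [tz|tn].
    have -> : s = 0 by lra.
    by rewrite f0; apply: gsegL.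
  have tp : 0 < t by rewrite lt_neqAle eq_sym tn t0.
  exists (s / t); rewrite fL; split; last by congr f; field.
  by rewrite divr_ge0 //= ler_pdivrMr // mul1r.
right; have tp : 0 < 1 - t by lra.
exists ((s - t) / (1 - t)); rewrite fR; split; last by congr f; field; lra.
by rewrite divr_ge0 /= ?ler_pdivrMr //; lra.
Qed.

(** Both sides consist of the same two paths and the same two joining segments; only the base point
    differs. *)
Lemma cl_catC s1 s2 : cl (s1 ++ s2) = cl (s2 ++ s1).
Proof.
case: s1 => [|a s1]; first by rewrite cats0.
case: s2 => [|b s2]; first by rewrite cats0.
rewrite /= !rcons_cat /= !gpath_cat /= !gpath_rcons.
by rewrite predeqE => x; rewrite /setU /=; tauto.
Qed.

Lemma cl_rot k s : cl (rot k s) = cl s.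
Proof. by rewrite /rot cl_catC cat_take_drop. Qed.

Lemma cl_split s1 a b t s2 : 0 <= t <= 1 ->
  cl (s1 ++ a :: f a b t :: b :: s2) = cl (s1 ++ a :: b :: s2).
Proof.
move=> h; rewrite cl_catC (cl_catC s1) /= (setUA _ _ (gpath b _)).
by rewrite gseg_split.
Qed.

Lemma gpath_nth x0 a s p : (0 < size s)%N ->
  gpath a s p <-> exists i, (i < size s)%N /\ gseg (nth x0 (a :: s) i) (nth x0 s i) p.
Proof.
elim: s a => [//|b s IH] a _; split.
  case=> [h|h]; first by exists 0%N.
  case: s IH h => [_ -> |c s IH h]; first by exists 0%N; split=> //; apply: gsegR.
  by have [i [i1 i2]] := (IH b isT).1 h; exists i.+1.
case=> [[|i]] [i1 i2] /=; first by left.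
have sp : (0 < size s)%N by move: i1; rewrite /=; lia.
by right; apply/(IH b sp); exists i.
Qed.

Lemma cl_nth x0 s p :
  cl s p <-> exists i, (i < size s)%N /\
    gseg (nth x0 s (i %% size s)) (nth x0 s (i.+1 %% size s)) p.
Proof.
case: s => [|a s]; first by split=> // -[i []].
rewrite /cl (@gpath_nth x0) ?size_rcons //.
have E i : (i < (size s).+1)%N -> (nth x0 (a :: rcons s a) i = nth x0 (a :: s) (i %% (size s).+1))
   /\ nth x0 (rcons s a) i = nth x0 (a :: s) (i.+1 %% (size s).+1).
  move=> h; rewrite modn_small //; split.
    by rewrite -rcons_cons nth_rcons /= h.
  rewrite nth_rcons; case: (ltnP i (size s)) => h'; first by rewrite modn_small.
  have -> : i = size s by lia.
  by rewrite eqxx modnn.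
split=> -[i [h1 h2]]; exists i; split=> //; move: h2.
  by rewrite /= in h1 *; case: (E i h1) => -> ->.
by rewrite /= in h1 *; case: (E i h1) => -> ->.
Qed.

End Paths.

Lemma gpath_map (R : realType) (T U : Type) (f : T -> T -> R -> T) (f' : U -> U -> R -> U)
    (g : T -> U) a s : (forall a b t, g (f a b t) = f' (g a) (g b) t) ->
  g @` gpath f a s = gpath f' (g a) (map g s).
Proof.
move=> gf; elim: s a => [|b s IH] a /=; first by rewrite image_set1.
rewrite image_setU IH; congr (_ `|` _); apply/seteqP; split=> x.
  by case=> y [t [t01 ->]] <-; exists t; rewrite gf.
by case=> t [t01 ->]; exists (f a b t); [exists t | rewrite gf].
Qed.

Lemma cl_map (R : realType) (T U : Type) (f : T -> T -> R -> T) (f' : U -> U -> R -> U)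
    (g : T -> U) s : (forall a b t, g (f a b t) = f' (g a) (g b) t) ->
  g @` cl f s = cl f' (map g s).
Proof.
case: s => [|a s] gf /=; first by rewrite image_set0.
by rewrite (gpath_map _ _ gf) map_rcons.
Qed.

Section Lerp.
Variable R : realType.
Local Notation pt3 := (pt3 R).
Local Notation pt2 := (pt2 R).
Implicit Types (a b c p : pt3) (P Q : seq pt3).

Lemma pt3_eq a b : a.1.1 = b.1.1 -> a.1.2 = b.1.2 -> a.2 = b.2 -> a = b.
Proof. by case: a b => [[? ?] ?] [[? ?] ?] /= -> -> ->. Qed.

Lemma pt2_eq (a b : pt2) : a.1 = b.1 -> a.2 = b.2 -> a = b.
Proof. by case: a b => [? ?] [? ?] /= -> ->. Qed.

Lemma lerp_affine : affine (@lerp R).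
Proof. by split=> *; apply: pt3_eq => /=; ring. Qed.

Definition lerp2 (a b : pt2) (t : R) : pt2 :=
  (a.1 + t * (b.1 - a.1), a.2 + t * (b.2 - a.2)).

Lemma lerp2_affine : affine lerp2.
Proof. by split=> *; apply: pt2_eq => /=; ring. Qed.

Definition jlerp (u v : pt3 * pt3) (t : R) : pt3 * pt3 :=
  (lerp u.1 v.1 t, lerp u.2 v.2 t).

Lemma jlerp_affine : affine jlerp.
Proof. by split=> *; rewrite [RHS]surjective_pairing; congr pair; apply: pt3_eq => /=; ring. Qed.

Lemma proj_lerp a b t : proj (lerp a b t) = lerp2 (proj a) (proj b) t.
Proof. by []. Qed.

Lemma kimgE P : kimg P = cl (@lerp R) P.
Proof.
apply/seteqP; split=> p; rewrite (cl_nth lerp_affine (0,0,0)).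
  by case=> i i1 i2; exists i; split.
by case=> i [i1 i2]; exists i.
Qed.

Lemma pimgE P : pimg P = cl lerp2 (map (@proj R) P).
Proof. by rewrite /pimg kimgE (cl_map _ (f' := lerp2)). Qed.

Lemma jimg1 L : fst @` cl jlerp L = kimg (unzip1 L).
Proof. by rewrite kimgE (cl_map _ (f' := @lerp R)). Qed.

Lemma jimg2 L : snd @` cl jlerp L = kimg (unzip2 L).
Proof. by rewrite kimgE (cl_map _ (f' := @lerp R)). Qed.

(** One of the three coordinates separates distinct points, which reduces questions about a segment
    to one real variable. *)
Lemma lerp_neq a b : a <> b -> exists g : pt3 -> R,
  [/\ g b - g a <> 0 & forall c d t, g (lerp c d t) = g c + t * (g d - g c)].
Proof.
move=> ab; case: (pselect (a.1.1 = b.1.1)) => h1; last first.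
  by exists (fun p => p.1.1); split=> // /eqP; rewrite subr_eq0 => /eqP /esym.
case: (pselect (a.1.2 = b.1.2)) => h2; last first.
  by exists (fun p => p.1.2); split=> // /eqP; rewrite subr_eq0 => /eqP /esym.
exists (fun p => p.2); split=> // /eqP; rewrite subr_eq0 => /eqP /esym h3.
exact/ab/pt3_eq.
Qed.

Lemma lerp_inj a b s t : a <> b -> lerp a b s = lerp a b t -> s = t.
Proof.
move=> /lerp_neq[g [gn gl]] /(congr1 g); rewrite !gl => /addrI h.
by apply: (mulIf _ h); apply/eqP.
Qed.

Lemma lerp0 a b : lerp a b 0 = a. Proof. by apply: pt3_eq => /=; ring. Qed.
Lemma lerp1 a b : lerp a b 1 = b. Proof. by apply: pt3_eq => /=; ring. Qed.
Lemma lerpC a b t : lerp a b t = lerp b a (1 - t).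
Proof. by apply: pt3_eq => /=; ring. Qed.

Lemma segC a b : seg a b = seg b a.
Proof.
by apply/seteqP; split=> p [t [h ->]]; exists (1 - t); split; [lra|apply: lerpC|lra|apply: lerpC].
Qed.

Lemma segL a b : seg a b a. Proof. exact: gsegL lerp_affine _ _. Qed.
Lemma segR a b : seg a b b. Proof. exact: gsegR lerp_affine _ _. Qed.

End Lerp.
#[global] Hint Resolve lerp_affine lerp2_affine jlerp_affine : core.

Lemma lt00_false (R : realType) : (0 : R) < 0 -> False.
Proof. by rewrite ltxx. Qed.

Ltac flra := match goal with R : realType |- _ => exfalso; apply: (@lt00_false R); lra end.

(** * Knot polygons and Delta-moves *)

Section KnotPolygon.
Variable R : realType.
Local Notation pt3 := (pt3 R).
Implicit Types (a b c p : pt3) (P Q : seq pt3).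
Local Notation path3 := (gpath (@lerp R)).
Local Notation o3 := ((0, 0, 0) : pt3).

Lemma vtx_mod P i : vtx P (i %% size P) = vtx P i.
Proof. by rewrite /vtx modn_mod. Qed.

Lemma vtx_small P i : (i < size P)%N -> vtx P i = nth o3 P i.
Proof. by move=> h; rewrite /vtx modn_small. Qed.

Lemma vtx_next a s i : (i < (size s).+1)%N -> vtx (a :: s) i.+1 = nth o3 (rcons s a) i.
Proof.
move=> h; rewrite nth_rcons; case: (ltnP i (size s)) => h'.
  by rewrite vtx_small.
have -> : i = size s by lia.
by rewrite eqxx /vtx /= modnn.
Qed.

(** Having three vertices makes the successor relation on the cycle asymmetric, so at most one of
    the two adjacency cases of [knot_polygon] applies. *)
Lemma modS_neq n i : (3 <= n)%N -> (i < n)%N -> i <> ((i.+1 %% n).+1 %% n)%N.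
Proof.
move=> n3 i1; case: (ltnP i.+1 n) => hi.
  rewrite (modn_small hi); case: (ltnP i.+2 n) => hi2; first by rewrite modn_small //; lia.
  by have -> : i.+2 = n by [lia]; rewrite modnn; lia.
by have -> : i.+1 = n by [lia]; rewrite modnn modn_small; lia.
Qed.

Lemma modS_inj n k l : (k < n)%N -> (l < n)%N -> (k.+1 %% n = l.+1 %% n)%N -> k = l.
Proof.
move=> k1 l1; case: (ltnP k.+1 n) => hk; case: (ltnP l.+1 n) => hl.
- by rewrite !modn_small //; lia.
- by have -> : l.+1 = n by [lia]; rewrite modnn modn_small //; lia.
- by have -> : k.+1 = n by [lia]; rewrite modnn modn_small //; lia.
by lia.
Qed.

(** Half-open edges run through every point of the closed polygon once, so simplicity becomes
    injectivity, without a distinction between adjacent and disjoint edges. *)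
Definition hinj P : Prop := forall i j (s t : R),
  (i < size P)%N -> (j < size P)%N -> 0 <= s < 1 -> 0 <= t < 1 ->
  lerp (vtx P i) (vtx P i.+1) s = lerp (vtx P j) (vtx P j.+1) t -> i = j /\ s = t.

Lemma knot_polygonP P : knot_polygon P <-> (3 <= size P)%N /\ hinj P.
Proof.
split.
  case=> n3 Pu Pe; split=> // i j s t i1 j1 s1 t1 e.
  have vn k : (k < size P)%N -> vtx P k <> vtx P k.+1.
    move=> k1; rewrite -(vtx_mod P k.+1) vtx_small // vtx_small ?ltn_mod; last by lia.
    move/eqP; rewrite nth_uniq // ?ltn_mod; last by lia.
    move/eqP; case: (ltnP k.+1 (size P)) => h; first by rewrite modn_small //; lia.
    by have -> : k.+1 = size P by [lia]; rewrite modnn; lia.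
  case: (eqVneq i j) => [ij|ij].
    by split=> //; move: e; rewrite ij; apply: lerp_inj; apply: vn.
  have := Pe i j i1 j1 (fun h => negP ij (introT eqP h)).
  move/(congr1 (@^~ (lerp (vtx P i) (vtx P i.+1) s))).
  have -> : (edge P i `&` edge P j) (lerp (vtx P i) (vtx P i.+1) s) = True.
    rewrite propeqE; split=> // _; split; first by exists s; split=> //; lra.
    by exists t; split=> //; lra.
  have H k l (x y : R) : (k < size P)%N -> (l < size P)%N -> 0 <= x < 1 ->
     l == (k.+1 %% size P)%N -> lerp (vtx P k) (vtx P k.+1) x = vtx P l -> False.
    move=> k1 l1 x1 /eqP ->; rewrite vtx_mod -[RHS](lerp1 (vtx P k)).
    by move/(lerp_inj (vn _ k1)); lra.
  case: ifP => [h /esym E|_].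
    have /= E' : [set vtx P j] (lerp (vtx P i) (vtx P i.+1) s) by rewrite E.
    by case: (H _ _ s t i1 j1 s1 h).
  case: ifP => [h /esym E|_ /esym E].
    have /= E' : [set vtx P i] (lerp (vtx P i) (vtx P i.+1) s) by rewrite E.
    by case: (H _ _ t s j1 i1 t1 h); rewrite -e.
  have : set0 (lerp (vtx P i) (vtx P i.+1) s) by rewrite E.
  by [].
case=> n3 hP.
have Pu : uniq P.
  apply/(uniqP o3) => i j i1 j1 e.
  have [//] : i = j /\ (0:R) = 0.
  apply: hP => //; rewrite ?lexx ?ltr01 //.
  by rewrite !lerp0 !vtx_small.
split=> // i j i1 j1 ij; apply/seteqP; split=> p.
  case=> -[s [s1 ps]] [t [t1 pt]].
  have nx k : (k < size P)%N -> (k.+1 %% size P < size P)%N by move=> _; rewrite ltn_mod; lia.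
  (* The end of edge [k] is read as the start of the next edge, so that [hinj] also covers the
     parameter 1. *)
  have E k : lerp (vtx P (k.+1 %% size P)) (vtx P (k.+1 %% size P).+1) 0 = lerp (vtx P k) (vtx P k.+1) 1.
    by rewrite lerp0 lerp1 vtx_mod.
  have z01 : 0 <= (0:R) < 1 by rewrite lexx ltr01.
  case: (ltP s 1) => s2; case: (ltP t 1) => t2.
  - by case: ij; apply: (hP i j s t _ _ _ _ _).1 => //; rewrite -?ps -?pt //; lra.
  - have te : t = 1 by lra.
    have h : i = (j.+1 %% size P)%N.
      apply: (hP i _ s 0 _ (nx _ j1) _ _ _).1 => //; first lra.
      by rewrite E -te -ps -pt.
    have -> : (j == i.+1 %% size P)%N = false.
      by apply/negP => /eqP h2; case: (modS_neq n3 i1); rewrite {1}h h2.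
    by rewrite h eqxx /= pt te lerp1 vtx_mod.
  - have se : s = 1 by lra.
    have h : j = (i.+1 %% size P)%N.
      apply: (hP j _ t 0 _ (nx _ i1) _ _ _).1 => //; first lra.
      by rewrite E -se -ps -pt.
    by rewrite h eqxx /= ps se lerp1 vtx_mod.
  - case: ij; apply: (modS_inj i1 j1).
    apply: (hP _ _ 0 0 (nx _ i1) (nx _ j1) _ _ _).1 => //.
    have [se te] : s = 1 /\ t = 1 by lra.
    by move: ps pt; rewrite se te !E => <- <-.
case: ifP => [/eqP h|_].
  by move=> ->; split; [rewrite h vtx_mod; apply: segR | apply: segL].
case: ifP => [/eqP h|_ //].
by move=> ->; split; [apply: segL | rewrite h vtx_mod; apply: segR].
Qed.

Lemma hinj_rot1 P : hinj P -> hinj (rot 1 P).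
Proof.
move=> hP; case: (posnP (size P)) => [/size0nil ->//|n0].
have E i : vtx (rot 1 P) i = vtx P i.+1.
  case: P {hP} n0 => [//|a s] _.
  rewrite -vtx_mod rot1_cons size_rcons vtx_small ?size_rcons ?ltn_mod //.
  rewrite -vtx_next ?ltn_mod // /vtx; congr nth.
  by rewrite /= -addn1 modnDml addn1.
move=> i j s t; rewrite size_rot => i1 j1 s1 t1; rewrite !E => e.
have F k : vtx P (k.+1 %% size P).+1 = vtx P k.+2.
  by rewrite /vtx -(addn1 (_ %% _)) modnDml addn1.
have [] := hP (i.+1 %% size P)%N (j.+1 %% size P)%N s t; rewrite ?ltn_mod // ?vtx_mod ?F //.
by move=> /modS_inj h ->; split=> //; apply: h.
Qed.

Lemma knot_polygon_rot k P : knot_polygon P -> knot_polygon (rot k P).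
Proof.
move=> h; elim: k => [|k IH]; first by rewrite rot0.
case: (leqP k.+1 (size P)) => hk.
  rewrite rotS //; move/knot_polygonP: IH => [n3 hi]; apply/knot_polygonP.
  by split; [rewrite size_rot | apply: hinj_rot1].
by rewrite (rot_oversize (ltnW hk)).
Qed.

Lemma equiv_rot k P : knot_polygon P -> knot_equiv P (rot k P).
Proof.
move=> h; elim: k => [|k IH]; first by rewrite rot0; apply: rst_refl.
case: (leqP k.+1 (size P)) => hk.
  apply: rst_trans IH _; apply: rst_step.
  split; [exact: knot_polygon_rot|exact: knot_polygon_rot|].
  by apply: Or43; rewrite rotS.
rewrite (rot_oversize (ltnW hk)); exact: rst_refl.
Qed.

(** A simple open arc, by recursion: the first edge meets the remaining path only in the vertex that
    they share. *)
Fixpoint spath a (l : seq pt3) {struct l} : Prop :=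
  if l is b :: l' then [/\ a <> b, forall p, seg a b p -> path3 b l' p -> p = b & spath b l']
  else True.

Lemma spathP a l : spath a l <->
  (forall i j (s t : R), (i < size l)%N -> (j < size l)%N -> 0 <= s < 1 -> 0 <= t < 1 ->
    lerp (nth o3 (a :: l) i) (nth o3 l i) s = lerp (nth o3 (a :: l) j) (nth o3 l j) t ->
    i = j /\ s = t) /\
  (forall i (s : R), (i < size l)%N -> 0 <= s < 1 ->
    lerp (nth o3 (a :: l) i) (nth o3 l i) s <> last a l).
Proof.
elim: l a => [|b l IH] a; first by split.
have mem p : path3 b l p -> p = last b l \/
   exists i s, [/\ (i < size l)%N, 0 <= s < 1 & p = lerp (nth o3 (b :: l) i) (nth o3 l i) s].
  elim: l {IH} b => [|c l IH] b; first by left.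
  case=> [[t [t1 ->]]|/IH]; last first.
    by case=> [|[i [s [i1 s1 e]]]]; [left | right; exists i.+1, s].
  case: (ltP t 1) => t2; first by right; exists 0%N, t; split=> //; lra.
  have -> : t = 1 by lra.
  rewrite lerp1; case: l {IH} => [|d l]; first by left.
  by right; exists 1%N, 0; split; rewrite ?lexx ?ltr01 //= lerp0.
have memI i (s : R) : (i < size l)%N -> 0 <= s < 1 ->
    path3 b l (lerp (nth o3 (b :: l) i) (nth o3 l i) s).
  move=> i1 s1; apply/(gpath_nth (lerp_affine R) o3); first by lia.
  by exists i; split=> //; exists s; split=> //; lra.
split.
  case=> ab hp /IH[h1 h2]; split.
    move=> [|i] [|j] s t i1 j1 s1 t1 /=.
    - by move/(lerp_inj ab).
    - move=> e; have /(lerp_inj ab) : lerp a b s = lerp a b 1.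
        rewrite [RHS]lerp1; apply: hp; first by exists s; split=> //; lra.
        by rewrite e; apply: memI.
      lra.
    - move=> e; have /(lerp_inj ab) : lerp a b t = lerp a b 1.
        rewrite [RHS]lerp1; apply: hp; first by exists t; split=> //; lra.
        by rewrite -e; apply: memI.
      lra.
    - by move/h1 => [] // -> ->.
  move=> [|i] s i1 s1 /=; last exact: h2.
  move=> e; have /(lerp_inj ab) : lerp a b s = lerp a b 1.
    rewrite [RHS]lerp1; apply: hp; first by exists s; split=> //; lra.
    by rewrite e; apply: gpath_last.
  lra.
case=> h1 h2.
have ab : a <> b.
  move=> ab; case: l {IH mem memI} h1 h2 => [|c l] h1 h2.
    by apply: (h2 0%N 0) => //=; rewrite ?lerp0 ?lexx ?ltr01.
  by case: (h1 0%N 1%N 0 0) => //=; rewrite ?lerp0 ?lexx ?ltr01.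
split=> //.
  move=> p [t [t1 ->]]; case: (ltP t 1) => t2; last first.
    by have -> : t = 1 by [lra]; rewrite lerp1.
  move/mem => [e|[i [s [i1 s1 e]]]].
    by case: (h2 0%N t) => //; lra.
  by case: (h1 0%N i.+1 t s) => //; lra.
apply/IH; split=> [i j s t i1 j1 s1 t1 e|i s i1 s1].
  by case: (h1 i.+1 j.+1 s t) => // -[].
exact: (h2 i.+1).
Qed.

(** Delta-moves are performed on the first edge after a rotation, so simplicity is wanted in the
    form of that edge together with a simple arc from its end back to its start. *)
Lemma knot_polygon_cons a b s : knot_polygon (a :: b :: s) <->
  [/\ (0 < size s)%N, a <> b, spath b (rcons s a) &
      forall p, seg a b p -> path3 b (rcons s a) p -> p = a \/ p = b].
Proof.
have V0 : vtx (a :: b :: s) 0 = a by rewrite vtx_small.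
have V1 : vtx (a :: b :: s) 1 = b by rewrite vtx_small.
have N1 i : (i < (size s).+1)%N -> vtx (a :: b :: s) i.+1 = nth o3 (b :: rcons s a) i.
  by move=> h; rewrite vtx_next // ltnW.
have N2 i : (i < (size s).+1)%N -> vtx (a :: b :: s) i.+2 = nth o3 (rcons s a) i.
  by move=> h; rewrite vtx_next.
rewrite knot_polygonP; split.
  case=> n3 h.
  have z01 : 0 <= (0:R) < 1 by rewrite lexx ltr01.
  have ab : a <> b.
    move=> ab; have [//] : 0%N = 1%N /\ (0:R) = 0.
    by apply: h => //; rewrite !lerp0 V0 V1.
  split=> //.
    apply/spathP; rewrite size_rcons; split.
      move=> i j x y i1 j1 x1 y1 e; case: (h i.+1 j.+1 x y) => //; last by move=> [].
      by rewrite !N2 // !N1.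
    move=> i x i1 x1; rewrite last_rcons => e.
    by case: (h i.+1 0%N x 0) => //; rewrite lerp0 V0 N2 // N1.
  move=> p [t [t1 pt]] /(gpath_nth (lerp_affine R) o3); rewrite size_rcons => -[] // i [i1 [x [x1 px]]].
  case: (eqVneq t 0) => t0; first by left; rewrite pt t0 lerp0.
  case: (eqVneq t 1) => t2; first by right; rewrite pt t2 lerp1.
  have t3 : 0 <= t < 1 by case/andP: t1 => ? ?; apply/andP; split=> //; rewrite lt_neqAle t2.
  case: (ltP x 1) => x2.
    case: (h 0%N i.+1 t x) => //; first by lra.
    by rewrite V0 V1 N2 // N1 // -pt px.
  have x3 : x = 1 by lra.
  case: (ltnP i (size s)) => i2.
    case: (h 0%N i.+2 t 0) => //.
    by rewrite lerp0 V0 V1 N2 // -pt px x3 lerp1.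
  case: (h 0%N 0%N t 0) => //; rewrite ?lerp0 ?V0 ?V1 //.
    rewrite -pt px x3 lerp1 nth_rcons.
    by have -> : i = size s by [apply/eqP; rewrite eqn_leq i2 -ltnS i1]; rewrite ltnn eqxx.
  by move=> _ t00; rewrite t00 eqxx in t0.
case=> s0 ab /spathP; rewrite size_rcons last_rcons => -[h1 h2] h3; split=> //.
have key i (x y : R) : (i < (size s).+1)%N -> 0 <= x < 1 -> 0 <= y < 1 ->
    lerp a b y = lerp (nth o3 (b :: rcons s a) i) (nth o3 (rcons s a) i) x -> False.
  move=> i1 x1 y1 e.
  case: (h3 (lerp a b y)).
  - by exists y; split=> //; lra.
  - apply/(gpath_nth (lerp_affine R) o3); rewrite size_rcons //.
    by exists i; split=> //; exists x; split=> //; lra.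
  - by move=> e2; apply: (h2 i x) => //; rewrite -e.
  move=> e2; have := e2; rewrite -[RHS](lerp1 a) => /(lerp_inj ab); lra.
move=> [|i] [|j] x y i1 j1 x1 y1; rewrite ?V0 ?V1.
- by move/(lerp_inj ab).
- by rewrite N2 // N1 // => /key; case=> //; rewrite ?x1 ?y1.
- by rewrite N2 // N1 // => /esym/key; case=> //; rewrite ?x1 ?y1.
by rewrite !N2 // !N1 // => /h1[] // -> ->.
Qed.

(** * Delta-moves on the first edge of a polygon *)

Lemma tri_seg a b c : seg a b `<=` tri a b c.
Proof.
move=> p [t [/andP[t0 t1] ->]]; exists (1 - t), t, 0; split; [lra|lra|lra|lra|].
by apply: pt3_eq => /=; ring.
Qed.

Lemma tri_seg1 a b c : seg a c `<=` tri a b c.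
Proof.
move=> p [t [/andP[t0 t1] ->]]; exists (1 - t), 0, t; split; [lra|lra|lra|lra|].
by apply: pt3_eq => /=; ring.
Qed.

Lemma tri_seg2 a b c : seg c b `<=` tri a b c.
Proof.
move=> p [t [/andP[t0 t1] ->]]; exists 0, t, (1 - t); split; [lra|lra|lra|lra|].
by apply: pt3_eq => /=; ring.
Qed.

Lemma kimg_cons2 a b s : kimg (a :: b :: s) = seg a b `|` path3 b (rcons s a).
Proof. by rewrite kimgE. Qed.

Lemma delta_equiv a b c s :
  knot_polygon (a :: b :: s) -> knot_polygon (a :: c :: b :: s) ->
  (forall p, tri a b c p -> path3 b (rcons s a) p -> p = a \/ p = b) ->
  knot_equiv (a :: b :: s) (a :: c :: b :: s).
Proof.
move=> h1 h2 h; apply: rst_step; split=> //; apply: Or41.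
exists 0%N, c; split=> //.
rewrite kimg_cons2 /edge !vtx_small //=; apply/seteqP; split=> p.
  case=> pt [//|pp]; case: (h p pt pp) => ->; [exact: segL | exact: segR].
by move=> ps; split; [apply: tri_seg | left].
Qed.

(* Only the part b, ..., a of the polygon, which stays fixed, has to avoid the
   triangle. *)
Lemma delta_insert a b c s : knot_polygon (a :: b :: s) -> c <> a -> c <> b ->
  (forall p, seg a c p -> seg c b p -> p = c) ->
  (forall p, tri a b c p -> path3 b (rcons s a) p -> p = a \/ p = b) ->
  knot_polygon (a :: c :: b :: s) /\ knot_equiv (a :: b :: s) (a :: c :: b :: s).
Proof.
move=> h ca cb hc ht.
suff h2 : knot_polygon (a :: c :: b :: s) by split=> //; apply: delta_equiv.
move/knot_polygon_cons: h => [s0 ab sb hab].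
have acb : ~ seg c b a by move=> h; apply/ca/esym/(hc a) => //; apply: segL.
have bac : ~ seg a c b by move=> h; apply/cb/esym/(hc b) => //; apply: segR.
apply/knot_polygon_cons; split=> //=; first exact/nesym.
  split=> // p p1 p2; case: (ht p _ p2) => // [|pa]; first exact: tri_seg2.
  by rewrite pa in p1.
move=> p p1 [p2|p2]; first by right; apply: hc.
case: (ht p _ p2) => [|->|pb]; [exact: tri_seg1|by left|].
by rewrite pb in p1.
Qed.

(** The inverse of an insertion. That [a] and [b] differ is not assumed but follows from simplicity
    of the larger polygon; [0 < size s] leaves three vertices. *)
Lemma delta_remove a b c s : (0 < size s)%N -> knot_polygon (a :: c :: b :: s) ->
  (forall p, tri a b c p -> path3 b (rcons s a) p -> p = a \/ p = b) ->
  knot_polygon (a :: b :: s) /\ knot_equiv (a :: c :: b :: s) (a :: b :: s).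
Proof.
move=> s0 h ht.
suff h2 : knot_polygon (a :: b :: s).
  by split=> //; apply: rst_sym; apply: delta_equiv.
move/knot_polygon_cons: (h) => [_ ac /= [cb hcb sb] hac].
apply/knot_polygon_cons; split=> //.
  move=> ab; case: (hac a); first exact: segL.
  - by right; rewrite ab; apply: gpath_head.
  - move=> _; rewrite ab in ac *; apply: ac; apply/esym.
    have := hcb b; rewrite -ab => h'.
    case: s s0 h {ht sb hac hcb h'} => [//|d s] _ /knot_polygonP[_ /(_ 0%N 2%N 0 0)].
    rewrite !vtx_small //= !lerp0 ab lexx ltr01; case=> //.
  by move=> e; rewrite e in ac.
by move=> p p1 p2; apply: ht => //; apply: tri_seg.
Qed.

Lemma equiv_catC (s1 s2 : seq pt3) : knot_polygon (s1 ++ s2) ->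
  knot_polygon (s2 ++ s1) /\ knot_equiv (s1 ++ s2) (s2 ++ s1).
Proof.
rewrite -(rot_size_cat s1 s2) => h.
by split; [apply: knot_polygon_rot | apply: equiv_rot].
Qed.

(** A degenerate Delta-move: the triangle collapses to the edge itself, which meets the rest of the
    polygon only in its ends. *)
Lemma knot_subdivide (s1 : seq pt3) a b s2 (t : R) : 0 < t < 1 -> knot_polygon (s1 ++ a :: b :: s2) ->
  knot_polygon (s1 ++ a :: lerp a b t :: b :: s2) /\
  knot_equiv (s1 ++ a :: b :: s2) (s1 ++ a :: lerp a b t :: b :: s2).
Proof.
move=> t01 /equiv_catC[/= k1 e1].
have t01' : 0 <= t <= 1 by lra.
have := k1 => /knot_polygon_cons[_ ab _ hab].
have [||||k2 e2] := delta_insert (c := lerp a b t) k1.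
- by rewrite -[X in _ <> X](lerp0 a b) => /(lerp_inj ab); lra.
- by rewrite -[X in _ <> X](lerp1 a b) => /(lerp_inj ab); lra.
- have [_ _ fL fR] := lerp_affine R.
  move=> p [x [x1 ->]] [y [y1]]; rewrite fL fR => /(lerp_inj ab) e.
  by congr lerp; nra.
- move=> p [x [y [z [x0 y0 z0 s1' ->]]]] pp; apply: hab => //.
  exists (y + z * t); split; first by nra.
  by have -> : x = 1 - y - z by [lra]; apply: pt3_eq => /=; ring.
have [k3 e3] := equiv_catC (s1 := [:: a, lerp a b t, b & s2]) k2.
by split=> //; apply: rst_trans e1 _; apply: rst_trans e2 _.
Qed.

End KnotPolygon.

(** * Regular projections *)

Section Joint.
Variable R : realType.
Local Notation pt3 := (pt3 R).
Local Notation pt2 := (pt2 R).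
Local Notation o3 := ((0, 0, 0) : pt3).
Implicit Types (a b c d p : pt3) (P Q : seq pt3) (q : pt2) (u v w : pt3 * pt3)
  (L : seq (pt3 * pt3)).

Lemma reg_knot P : regular P -> knot_polygon P. Proof. by case. Qed.

Lemma preim2 P p1 p2 : regular P -> kimg P p1 -> kimg P p2 -> p1 <> p2 ->
  proj p1 = proj p2 -> preim P (proj p1) = [set p1] `|` [set p2].
Proof.
case=> _ h2 _ _ k1 k2 n12 e; apply/seteqP; split=> p /=.
  move=> [kp ep]; case: (h2 (proj p1) p1 p2 p (conj k1 erefl) (conj k2 (esym e)) (conj kp ep)) => //.
  - by move=> ->; left.
  - by move=> ->; right.
by case=> ->; split.
Qed.

Lemma reg_double P p1 p2 : regular P -> kimg P p1 -> kimg P p2 -> p1 <> p2 ->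
  proj p1 = proj p2 -> double_pt P (proj p1).
Proof. by move=> rP k1 k2 n12 e; exists p1, p2; split=> //; apply: preim2. Qed.

Lemma proj_height p1 p2 : proj p1 = proj p2 -> p1.2 = p2.2 -> p1 = p2.
Proof. by move=> [e1 e2] e3; apply: pt3_eq. Qed.

Lemma lerp2_inj (x y : pt2) s t : x <> y -> lerp2 x y s = lerp2 x y t -> s = t.
Proof.
move=> xy [e1 e2]; apply/eqP; rewrite -subr_eq0; apply/eqP; apply: contra_notP xy => st.
have F (a b : R) : a + s * (b - a) = a + t * (b - a) -> a = b.
  move=> h; have : (s - t) * (b - a) = 0 by lra.
  by move/eqP; rewrite mulf_eq0 => /orP[/eqP//|/eqP]; lra.
by apply: pt2_eq; apply: F.
Qed.

(** A vertical edge would put three points, its ends and its midpoint, over one point of the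
    plane. *)
Lemma reg_edge P a b : regular P -> a <> b -> seg a b `<=` kimg P -> proj a <> proj b.
Proof.
case=> _ h2 _ _ ab sk e.
have E t : proj (lerp a b t) = proj a.
  by rewrite proj_lerp -e; apply: pt2_eq => /=; ring.
have pr t : 0 <= t <= 1 -> preim P (proj a) (lerp a b t).
  by move=> t1; split=> //; apply: sk; exists t.
case: (h2 (proj a) (lerp a b 0) (lerp a b (1/2)) (lerp a b 1)); try (apply: pr; lra).
all: by move/(lerp_inj ab); lra.
Qed.

Lemma reg_seg_inj P a b p1 p2 : regular P -> a <> b -> seg a b `<=` kimg P ->
  seg a b p1 -> seg a b p2 -> proj p1 = proj p2 -> p1 = p2.
Proof.
move=> rP ab sk [s [s1 ->]] [t [t1 ->]] e; congr lerp.
exact: lerp2_inj (reg_edge rP ab sk) e.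
Qed.

Lemma reg_vertex P a : regular P -> a \in P -> ~ double_pt P (proj a).
Proof.
by case=> _ _ _ h /(nthP o3)[i i1 <-]; rewrite -vtx_small //; apply: h.
Qed.

Lemma finite_doubles P (x y : pt2) : regular P -> x <> y ->
  ~ (forall r : R, 0 < r < 1 -> double_pt P (lerp2 x y r)).
Proof.
case=> _ _ [s hs] _ xy h.
(* These [N] equally spaced interior points of the segment are one more than the list of double
   points can hold. *)
pose N := (size s).+1; pose g (k : nat) := lerp2 x y (k.+1%:R / N.+1%:R).
have N0 : 0 < N.+1%:R :> R by rewrite ltr0n.
have gi : injective g.
  move=> k l /(lerp2_inj xy) kl.
  have iN : (N.+1%:R)^-1 != 0 :> R by rewrite invr_eq0 pnatr_eq0.
  by move/eqP: (mulIf iN kl); rewrite eqr_nat => /eqP[].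
have : (size (map g (iota 0 N)) <= size s)%N.
  apply: uniq_leq_size; first by rewrite map_inj_uniq // iota_uniq.
  move=> z /mapP[k]; rewrite mem_iota add0n => /andP[_ k1] ->.
  apply/hs/h; rewrite divr_gt0 ?ltr0n //= ltr_pdivrMr // mul1r ltr_nat.
  by rewrite ltnS.
by rewrite size_map size_iota ltnn.
Qed.

Definition edet (a b c d : pt2) : R :=
  (b.1 - a.1) * (d.2 - c.2) - (b.2 - a.2) * (d.1 - c.1).

(** Parallel edges with a common projected point would overlap along a segment, and every point of
    the overlap would be a double point, against finiteness. *)
Lemma reg_transversal P a b c d s t : regular P ->
  seg a b `<=` kimg P -> seg c d `<=` kimg P -> a <> b -> c <> d ->
  (forall x, seg a b x -> seg c d x -> x = a \/ x = b) ->
  0 < s < 1 -> 0 < t < 1 -> proj (lerp a b s) = proj (lerp c d t) ->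
  edet (proj a) (proj b) (proj c) (proj d) <> 0.
Proof.
move=> rP sab scd ab cd hi s01 t01 e det.
have pab := reg_edge rP ab sab; have pcd := reg_edge rP cd scd.
have [l [le1 le2]] : exists l : R, (proj d).1 - (proj c).1 = l * ((proj b).1 - (proj a).1) /\
   (proj d).2 - (proj c).2 = l * ((proj b).2 - (proj a).2).
  move: det; rewrite /edet.
  have : (proj b).1 - (proj a).1 != 0 \/ (proj b).2 - (proj a).2 != 0.
    case: eqP => [x1|]; last by left.
    case: eqP => [x2|]; last by right.
    by case: pab; apply: pt2_eq; lra.
  move: ((proj b).1 - _) ((proj b).2 - _) ((proj d).1 - _) ((proj d).2 - _) => x1 x2 y1 y2.
  case=> n det.
    exists (y1 / x1); split; first by field.
    by apply: (mulfI n); rewrite mulrA mulrCA mulfV // mulr1; lra.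
  exists (y2 / x2); split; last by field.
  by apply: (mulfI n); rewrite mulrA mulrCA mulfV // mulr1; lra.
have l0 : l != 0.
  by apply/eqP => l0; rewrite l0 !mul0r in le1 le2; apply: pcd; apply: pt2_eq; lra.
(* Moving by [k] along [ab] matches moving by [k / l] along [cd]; [k] is small enough to stay inside
   both edges. *)
have [k [k0 k1 k2]] : exists k : R, [/\ 0 < k, s + k < 1 & 0 < t + k / l < 1].
  pose m := Num.min t (1 - t).
  have m0 : 0 < m by rewrite lt_min; lra.
  have m1 : m <= t by rewrite ge_min lexx.
  have m2 : m <= 1 - t by rewrite ge_min lexx orbT.
  pose k := Num.min ((1 - s) / 2) (m * `|l| / 2).
  have al : 0 < `|l| by rewrite normr_gt0.
  have k0 : 0 < k by rewrite lt_min !divr_gt0 ?mulr_gt0 //; lra.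
  have k1 : k <= (1 - s) / 2 by rewrite ge_min lexx.
  have k2 : k <= m * `|l| / 2 by rewrite ge_min lexx orbT.
  exists k; split=> //; first by lra.
  have : `|k / l| <= m / 2.
    rewrite normrM normfV (gtr0_norm k0) ler_pdivrMr //; lra.
  by rewrite ler_norml => /andP[h1 h2]; lra.
case: (@finite_doubles P (proj (lerp a b s)) (proj (lerp a b (s + k))) rP).
  move=> e'; have : lerp a b s = lerp a b (s + k).
    by apply: reg_seg_inj rP ab sab _ _ e'; [exists s|exists (s + k)]; split=> //; lra.
  by move/(lerp_inj ab); lra.
move=> r r01.
have -> : lerp2 (proj (lerp a b s)) (proj (lerp a b (s + k))) r = proj (lerp a b (s + r * k)).
  by apply: pt2_eq => /=; ring.
have rk : 0 < r * k < k by nra.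
have tk : 0 <= t + r * (k / l) <= 1 by nra.
have hs : seg a b (lerp a b (s + r * k)) by exists (s + r * k); split=> //; lra.
have ht : seg c d (lerp c d (t + r * (k / l))) by exists (t + r * (k / l)).
apply: (reg_double rP (sab _ hs) (scd _ ht)).
  move=> e'; rewrite -e' in ht; case: (hi _ hs ht).
    by rewrite -[RHS](lerp0 a b) => /(lerp_inj ab); lra.
  by rewrite -[RHS](lerp1 a b) => /(lerp_inj ab); lra.
rewrite !proj_lerp /lerp2 in e *; case: e => e1 e2.
have kl : k / l * l = k by rewrite mulfVK.
apply: pt2_eq => /=.
  rewrite mulrDl addrA e1 (mulrDl t) addrA; congr (_ + _).
  by rewrite le1 -!mulrA; congr (_ * _); rewrite !mulrA kl.
rewrite mulrDl addrA e2 (mulrDl t) addrA; congr (_ + _).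
by rewrite le2 -!mulrA; congr (_ * _); rewrite !mulrA kl.
Qed.

End Joint.

(** * Two polygons with the same projection *)

Section Joint.
Variable R : realType.
Local Notation pt3 := (pt3 R).
Local Notation pt2 := (pt2 R).
Local Notation o3 := ((0, 0, 0) : pt3).
Local Notation o33 := ((o3, o3) : pt3 * pt3).
Implicit Types (a b c d p : pt3) (P Q : seq pt3) (q : pt2) (u v w : pt3 * pt3)
  (L : seq (pt3 * pt3)).
Local Notation jcl := (cl (@jlerp R)).
Local Notation path3 := (gpath (@lerp R)).

(** Two edges at [b] whose projections meet in a second point are parallel. [reg_transversal]
    excludes this once the meeting point is known to be a double point interior to both. *)
Lemma reg_adjacent P a b c s p p' : regular P -> P = a :: b :: c :: s ->
  seg a b p -> seg b c p' -> proj p = proj p' -> p = b /\ p' = b.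
Proof.
move=> rP EP sp sp' e.
have := reg_knot rP; rewrite EP => /knot_polygon_cons[_ ab /= [bc hbcs _] hab].
have hit x : seg a b x -> seg b c x -> x = a \/ x = b by move=> h1 h2; apply: hab => //; left.
have sab : seg a b `<=` kimg P by rewrite EP kimg_cons2 => x; left.
have sbc : seg b c `<=` kimg P by rewrite EP kimg_cons2 => x; right; left.
have hbc x : seg b c x -> seg a b x -> x = b.
  move=> x1 x2; case: (hit _ x2 x1) => // xa; rewrite xa in x1.
  have ac := hbcs _ x1 (eq_ind _ (path3 c (rcons s a)) (gpath_last (@lerp R) _ _) _ (last_rcons _ _ _)).
  by have := reg_knot rP; rewrite EP -ac => -[_ /=]; rewrite !inE eqxx orbT.
case: (pselect (p = p')) => [pp'|npp'].
  by rewrite -pp' in sp' *; rewrite (hbc _ sp' sp).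
have dp := reg_double rP (sab _ sp) (sbc _ sp') npp' e.
have nv x : x \in P -> proj p <> proj x.
  by move=> xP ex; apply: (reg_vertex rP xP); rewrite -ex.
case: sp npp' e dp nv => s0 [s1 ->] npp' e dp nv; case: sp' npp' e => t0 [t1 ->] npp' e.
have n0 : s0 <> 0.
  by move=> h; apply: (nv a); rewrite ?EP ?inE ?eqxx // h lerp0.
have n1 : s0 <> 1.
  by move=> h; apply: (nv b); rewrite ?EP ?inE ?eqxx ?orbT // h lerp1.
have m0 : t0 <> 0.
  by move=> h; apply: (nv b); rewrite ?EP ?inE ?eqxx ?orbT // e h lerp0.
have m1 : t0 <> 1.
  by move=> h; apply: (nv c); rewrite ?EP ?inE ?eqxx ?orbT // e h lerp1.
clear EP.
have s2 : 0 < s0 < 1 by lra.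
have t2 : 0 < t0 < 1 by lra.
case: (reg_transversal rP sab sbc ab bc hit s2 t2 e).
move: e; rewrite !proj_lerp /lerp2 /edet /= => -[].
move: a.1.1 a.1.2 b.1.1 b.1.2 c.1.1 c.1.2 => a1 a2 b1 b2 c1 c2 e1 e2.
have s3 : 1 - s0 != 0 by apply/eqP => h; flra.
have e1' : (1 - s0) * (b1 - a1) = - t0 * (c1 - b1) by lra.
have e2' : (1 - s0) * (b2 - a2) = - t0 * (c2 - b2) by lra.
apply: (mulfI s3); rewrite mulr0 mulrBr !mulrA e1' e2'; ring.
Qed.

Lemma cl_nth1 (T : Type) (f : T -> T -> R -> T) x0 s (p : T) : affine f -> cl f s p ->
  exists i t, [/\ (i < size s)%N, 0 <= t < 1 &
    p = f (nth x0 s (i %% size s)) (nth x0 s (i.+1 %% size s)) t].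
Proof.
move=> Hf /(cl_nth Hf x0)[i [i1 [t [t1 ->]]]]; have [f0 f1 _ _] := Hf.
case: (ltP t 1) => t2; first by exists i, t; split=> //; lra.
have -> : t = 1 by lra.
exists (i.+1 %% size s)%N, 0; split; rewrite ?lexx ?ltr01 ?ltn_mod //; first by lia.
by rewrite f1 f0 modn_mod.
Qed.

Lemma vtx_unzip1 L i : vtx (unzip1 L) i = (nth o33 L (i %% size L)).1.
Proof.
rewrite /vtx size_map; case: (posnP (size L)) => [/size0nil ->|n0]; first by rewrite !nth_nil.
by rewrite (nth_map o33) // ltn_mod.
Qed.

Lemma vtx_unzip2 L i : vtx (unzip2 L) i = (nth o33 L (i %% size L)).2.
Proof.
rewrite /vtx size_map; case: (posnP (size L)) => [/size0nil ->|n0]; first by rewrite !nth_nil.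
by rewrite (nth_map o33) // ltn_mod.
Qed.

Lemma jcl_nth L u : jcl L u <-> exists i t, [/\ (i < size L)%N, 0 <= t <= 1,
  u.1 = lerp (vtx (unzip1 L) i) (vtx (unzip1 L) i.+1) t &
  u.2 = lerp (vtx (unzip2 L) i) (vtx (unzip2 L) i.+1) t].
Proof.
rewrite (cl_nth (jlerp_affine R) o33); split.
  move=> [i [i1 [t [t1 ->]]]]; exists i, t; split=> //; first by rewrite !vtx_unzip1.
  by rewrite !vtx_unzip2.
move=> [i [t [i1 t1 e1 e2]]]; exists i; split=> //; exists t; split=> //.
by rewrite [LHS]surjective_pairing e1 e2 !vtx_unzip1 !vtx_unzip2.
Qed.

Lemma jcl_nth1 L u : jcl L u -> exists i t, [/\ (i < size L)%N, 0 <= t < 1,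
  u.1 = lerp (vtx (unzip1 L) i) (vtx (unzip1 L) i.+1) t &
  u.2 = lerp (vtx (unzip2 L) i) (vtx (unzip2 L) i.+1) t].
Proof.
move/(cl_nth1 o33 (jlerp_affine R)) => [i [t [i1 t1 ->]]].
exists i, t; split=> //; first by rewrite !vtx_unzip1.
by rewrite !vtx_unzip2.
Qed.

(** With [jinj2]: the point set of [L] is the graph of a bijection between the two polygons. *)
Lemma jinj1 L u v : knot_polygon (unzip1 L) -> jcl L u -> jcl L v -> u.1 = v.1 -> u = v.
Proof.
move=> /knot_polygonP[_ h] /jcl_nth1[i [s [i1 s1 eu1 eu2]]] /jcl_nth1[j [t [j1 t1 ev1 ev2]]] e.
have [ij st] : i = j /\ s = t by apply: h; rewrite ?size_map // -eu1 -ev1.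
by rewrite [LHS]surjective_pairing [RHS]surjective_pairing e eu2 ev2 ij st.
Qed.

Lemma jinj2 L u v : knot_polygon (unzip2 L) -> jcl L u -> jcl L v -> u.2 = v.2 -> u = v.
Proof.
move=> /knot_polygonP[_ h] /jcl_nth1[i [s [i1 s1 eu1 eu2]]] /jcl_nth1[j [t [j1 t1 ev1 ev2]]] e.
have [ij st] : i = j /\ s = t by apply: h; rewrite ?size_map // -eu2 -ev2.
by rewrite [LHS]surjective_pairing [RHS]surjective_pairing e eu1 ev1 ij st.
Qed.

Definition shad L : Prop := forall u, u \in L -> proj u.1 = proj u.2.

Lemma shad_jcl L u : shad L -> jcl L u -> proj u.1 = proj u.2.
Proof.
move=> hL /(cl_nth (jlerp_affine R) o33)[i [i1 [t [t1 ->]]]].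
have n0 : (0 < size L)%N by lia.
by rewrite !proj_lerp !hL // mem_nth // ltn_mod.
Qed.

Lemma kimg1P L p : kimg (unzip1 L) p <-> exists2 u, jcl L u & u.1 = p.
Proof. by rewrite -jimg1. Qed.

Lemma kimg2P L p : kimg (unzip2 L) p <-> exists2 u, jcl L u & u.2 = p.
Proof. by rewrite -jimg2. Qed.

(** Stated for two parametrisations [f], [g] of the polygons by one set, so that exchanging them
    gives the converse. *)
Lemma double_transfer (C : set (pt3 * pt3)) (f g : pt3 * pt3 -> pt3) P Q q :
  kimg P = f @` C -> kimg Q = g @` C -> (forall u, C u -> proj (f u) = proj (g u)) ->
  (forall u v, C u -> C v -> f u = f v -> u = v) ->
  (forall u v, C u -> C v -> g u = g v -> u = v) ->
  double_pt P q -> double_pt Q q.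
Proof.
move=> kP kQ hp fi gi [p1 [p2 [n12 e]]].
have : preim P q p1 by rewrite e; left.
have : preim P q p2 by rewrite e; right.
rewrite /preim kP => -[[u2 c2 e2] q2] [[u1 c1 e1] q1].
exists (g u1), (g u2); split.
  by move/(gi _ _ c1 c2) => eu; apply: n12; rewrite -e1 -e2 eu.
apply/seteqP; split=> p.
  rewrite /preim /= kQ => -[[u c <-] eu].
  have : preim P q (f u) by split; [rewrite kP; exists u | rewrite hp].
  rewrite e -e1 -e2 => -[/(fi _ _ c c1) ->|/(fi _ _ c c2) ->]; [by left | by right].
case=> ->; split.
- by rewrite kQ; exists u1.
- by rewrite -hp // e1.
- by rewrite kQ; exists u2.
by rewrite -hp // e2.
Qed.

Definition gap L : Prop := forall u v, jcl L u -> jcl L v -> proj u.1 = proj v.1 ->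
  u.1 <> v.1 -> u.2 <> v.2.

Lemma gap_inj L u v : shad L -> regular (unzip1 L) -> gap L -> jcl L u -> jcl L v ->
  u.2 = v.2 -> u = v.
Proof.
move=> hL rP g cu cv e; apply: (jinj1 (reg_knot rP)) => //.
apply: contrapT => n; apply: (g u v) => //.
by rewrite (shad_jcl hL cu) (shad_jcl hL cv) e.
Qed.

Lemma unzip_double L q : shad L -> knot_polygon (unzip1 L) -> knot_polygon (unzip2 L) ->
  double_pt (unzip2 L) q <-> double_pt (unzip1 L) q.
Proof.
move=> hL k1 k2; split.
  apply: (double_transfer (C := jcl L) (f := snd) (g := fst)); rewrite ?jimg1 ?jimg2 //.
  - by move=> u c; rewrite (shad_jcl hL c).
  - by move=> u v; apply: (jinj2 k2).
  - by move=> u v; apply: (jinj1 k1).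
apply: (double_transfer (C := jcl L) (f := fst) (g := snd)); rewrite ?jimg1 ?jimg2 //.
- by move=> u c; rewrite (shad_jcl hL c).
- by move=> u v; apply: (jinj1 k1).
- by move=> u v; apply: (jinj2 k2).
Qed.

(** Over a fixed regular projection a new choice of heights can fail in one way only: the two
    strands at a crossing may touch, which [gap] excludes. *)
Lemma reg_transfer L : shad L -> regular (unzip1 L) -> gap L -> regular (unzip2 L).
Proof.
move=> hL rP g.
have kQ : knot_polygon (unzip2 L).
  have /knot_polygonP[n3 h] := reg_knot rP; apply/knot_polygonP.
  rewrite !size_map in n3 *; split=> // i j s t; rewrite size_map => i1 j1 s1 t1 e.
  pose u := (lerp (vtx (unzip1 L) i) (vtx (unzip1 L) i.+1) s, lerp (vtx (unzip2 L) i) (vtx (unzip2 L) i.+1) s).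
  pose v := (lerp (vtx (unzip1 L) j) (vtx (unzip1 L) j.+1) t, lerp (vtx (unzip2 L) j) (vtx (unzip2 L) j.+1) t).
  have cu : jcl L u by apply/jcl_nth; exists i, s; split=> //; lra.
  have cv : jcl L v by apply/jcl_nth; exists j, t; split=> //; lra.
  have uv : u.1 = v.1 by rewrite (gap_inj hL rP g cu cv e).
  by apply: (h i j s t _ _ s1 t1 uv); rewrite size_map.
have D q := unzip_double q hL (reg_knot rP) kQ.
case: (rP) => _ h2 [s hs] h4; split=> //.
- move=> q p1 p2 p3 [/kimg2P[u1 c1 <-] e1] [/kimg2P[u2 c2 <-] e2] [/kimg2P[u3 c3 <-] e3].
  have pr u : jcl L u -> proj u.2 = q -> preim (unzip1 L) q u.1.
    by move=> c e; split; [apply/kimg1P; exists u | rewrite (shad_jcl hL c)].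
  have J := jinj1 (reg_knot rP).
  case: (h2 q _ _ _ (pr _ c1 e1) (pr _ c2 e2) (pr _ c3 e3)) => /J.
  + by move=> /(_ c1 c2) ->; apply: Or31.
  + by move=> /(_ c1 c3) ->; apply: Or32.
  + by move=> /(_ c2 c3) ->; apply: Or33.
- by exists s => q; rewrite D.
move=> i i1; rewrite D vtx_unzip2 -hL.
  by rewrite -vtx_unzip1; apply: h4; rewrite !size_map in i1 *.
rewrite size_map in i1; apply: mem_nth; rewrite ltn_mod; lia.
Qed.

(* crossing_change (unzip1 L) C (unzip2 L), expressed by the point set of L only. *)
Definition cross_rel (C : set pt2) L : Prop := forall u v, jcl L u -> jcl L v ->
  proj u.1 = proj v.1 -> u.1.2 < v.1.2 ->
  (C (proj u.1) -> v.2.2 < u.2.2) /\ (~ C (proj u.1) -> u.2.2 < v.2.2).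

Lemma cross_gap C L : cross_rel C L -> gap L.
Proof.
move=> h u v cu cv e n e2.
have : u.1.2 <> v.1.2 by move=> e3; apply: n; apply: proj_height.
case: (ltgtP u.1.2 v.1.2) => // l _.
  by case: (h u v cu cv e l) => h1 h2; case: (pselect (C (proj u.1))) => [/h1|/h2]; rewrite e2 ltxx.
case: (h v u cv cu (esym e) l) => h1 h2.
by case: (pselect (C (proj v.1))) => [/h1|/h2]; rewrite e2 ltxx.
Qed.

Lemma over_char P (u v : pt3) k : preim P (proj u) = [set u] `|` [set v] -> u.2 < v.2 ->
  (over_at P (proj u) k <-> edge P k v) /\ (under_at P (proj u) k <-> edge P k u).
Proof.
move=> e h.
have hu : preim P (proj u) u by rewrite e; left.
have hv : preim P (proj u) v by rewrite e; right.
split; split.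
- case=> p [hp ep /(_ v hv)]; rewrite /height; move: hp ep; rewrite e => -[->|->] ep //.
  by rewrite leNgt h.
- move=> ek; exists v; split=> // p'; rewrite e /height => -[->|->]; rewrite ?lexx ?ltW //.
- case=> p [hp ep /(_ u hu)]; rewrite /height; move: hp ep; rewrite e => -[->|->] ep //.
  by rewrite leNgt h.
- move=> ek; exists u; split=> // p'; rewrite e /height => -[->|->]; rewrite ?lexx ?ltW //.
Qed.

Lemma edge_unzip L k u : knot_polygon (unzip1 L) -> knot_polygon (unzip2 L) -> jcl L u ->
  edge (unzip1 L) k u.1 <-> edge (unzip2 L) k u.2.
Proof.
move=> k1 k2 cu.
have n0 : (0 < size L)%N by case: k1; rewrite size_map; lia.
have W (t : R) : 0 <= t <= 1 -> jcl L (lerp (vtx (unzip1 L) k) (vtx (unzip1 L) k.+1) t,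
    lerp (vtx (unzip2 L) k) (vtx (unzip2 L) k.+1) t).
  move=> t1; apply/jcl_nth; exists (k %% size L)%N, t; rewrite ltn_mod; split=> //=.
    by rewrite !vtx_unzip1 modn_mod -(addn1 (_ %% _)) modnDml addn1.
  by rewrite !vtx_unzip2 modn_mod -(addn1 (_ %% _)) modnDml addn1.
split=> -[t [t1 e]]; exists t; split=> //.
  by rewrite (jinj1 k1 cu (W t t1) e).
by rewrite (jinj2 k2 cu (W t t1) e).
Qed.

Lemma edge_kimg P i : knot_polygon P -> edge P i `<=` kimg P.
Proof.
case=> n3 _ _ p ep; exists (i %% size P)%N; first by rewrite ltn_mod; lia.
by move: ep; rewrite /edge /vtx modn_mod -(addn1 (_ %% _)) modnDml addn1.
Qed.

Lemma edge_inj P i p1 p2 : regular P -> edge P i p1 -> edge P i p2 -> proj p1 = proj p2 -> p1 = p2.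
Proof.
move=> rP; have [n3 Pu _] := reg_knot rP.
apply: reg_seg_inj rP _ (edge_kimg (reg_knot rP)) => /eqP.
have n0 : (0 < size P)%N by lia.
rewrite /vtx nth_uniq ?ltn_mod // => /eqP.
rewrite -addn1 -modnDml; move: (ltn_pmod i n0); move: (i %% _)%N => k k1.
case: (ltnP (k + 1) (size P)) => h; first by rewrite modn_small //; lia.
by have -> : (k + 1)%N = size P by [lia]; rewrite modnn; lia.
Qed.

(** [crossing_change] names strands by edge indices, [cross_rel] by heights of corresponding points.
    An edge contains at most one of the two points over a crossing, so its index determines the
    strand. *)
Lemma crossing_change_rel C L : shad L -> regular (unzip1 L) ->
  crossing_change (unzip1 L) C (unzip2 L) <-> regular (unzip2 L) /\ cross_rel C L.
Proof.
move=> hL rP.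
have pr u : jcl L u -> kimg (unzip1 L) u.1 by move=> c; apply/kimg1P; exists u.
have pr2 u : jcl L u -> kimg (unzip2 L) u.2 by move=> c; apply/kimg2P; exists u.
split.
  move=> [rQ _ _ hq]; split=> // u v cu cv e l.
  have k1 := reg_knot rP; have k2 := reg_knot rQ.
  have n1 : u.1 <> v.1 by move=> n; rewrite n ltxx in l.
  have n2 : u.2 <> v.2 by move=> n; apply: n1; rewrite (jinj2 k2 cu cv n).
  have su := shad_jcl hL cu; have sv := shad_jcl hL cv.
  have e2 : proj u.2 = proj v.2 by rewrite -su -sv.
  have dq := reg_double rP (pr _ cu) (pr _ cv) n1 e.
  have P1 := preim2 rP (pr _ cu) (pr _ cv) n1 e.
  have P2 := preim2 rQ (pr2 _ cu) (pr2 _ cv) n2 e2.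
  have P3 := preim2 rQ (pr2 _ cv) (pr2 _ cu) (nesym n2) (esym e2).
  have n3 : v.2.2 <> u.2.2 by move=> h; apply: n2; apply: proj_height.
  have [i [s [i1 s1 eu1 _]]] := jcl_nth1 cu; have [j [t [j1 t1 ev1 _]]] := jcl_nth1 cv.
  have Ei : edge (unzip1 L) i u.1 by exists s; split=> //; lra.
  have Ej : edge (unzip1 L) j v.1 by exists t; split=> //; lra.
  split=> hC.
    have [/(_ hC) h _] := hq _ dq i.
    have h' := (h.2 ((over_char i P1 l).2.2 Ei)).
    (* If the order were kept, [v] would lie on the edge [i] that contains [u], over the same
       point. *)
    case: (ltgtP v.2.2 u.2.2) n3 => // l' _; case: n1.
    have := (over_char i P2 l').1; rewrite -su => -[/(_ h') h'' _].
    by apply: (edge_inj rP Ei) => //; apply/(edge_unzip _ k1 k2).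
  have [_ /(_ hC) h] := hq _ dq j.
  have h' := (h.2 ((over_char j P1 l).1.2 Ej)).
  case: (ltgtP v.2.2 u.2.2) n3 => // l' _; case: n1.
  have := (over_char j P3 l').1; rewrite -sv -e => -[/(_ h') h'' _].
  by apply/esym/(edge_inj rP Ej) => //; apply/(edge_unzip _ k1 k2).
move=> [rQ hX]; split=> //; first by rewrite !size_map.
  move=> i; rewrite size_map => i1; rewrite vtx_unzip1 vtx_unzip2 hL //.
  by apply: mem_nth; rewrite ltn_mod; lia.
move=> q [p1 [p2 [n12 e]]] i.
have k1 := reg_knot rP; have k2 := reg_knot rQ.
have : preim (unzip1 L) q p1 by rewrite e; left.
have : preim (unzip1 L) q p2 by rewrite e; right.
move=> [/kimg1P[v' cv' ev] qv] [/kimg1P[u' cu' eu] qu].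
have [u [v [cu [cv [uv1 uv2 uv3]]]]] : exists u v, jcl L u /\ jcl L v /\
   [/\ proj u.1 = q, proj v.1 = q & u.1.2 < v.1.2].
  have : p1.2 <> p2.2 by move=> h; apply: n12; apply: proj_height => //; rewrite qu qv.
  case: (ltgtP p1.2 p2.2) => // l _; first by exists u', v'; rewrite eu ev.
  by exists v', u'; rewrite eu ev.
have e1 : proj u.1 = proj v.1 by rewrite uv1 uv2.
have n1 : u.1 <> v.1 by move=> n; rewrite n ltxx in uv3.
have n2 : u.2 <> v.2 by move=> n; apply: n1; rewrite (jinj2 k2 cu cv n).
have su := shad_jcl hL cu; have sv := shad_jcl hL cv.
have e2 : proj u.2 = proj v.2 by rewrite -su -sv.
have P1 := preim2 rP (pr _ cu) (pr _ cv) n1 e1.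
have P2 := preim2 rQ (pr2 _ cu) (pr2 _ cv) n2 e2.
have P3 := preim2 rQ (pr2 _ cv) (pr2 _ cu) (nesym n2) (esym e2).
have [hC hN] := hX u v cu cv e1 uv3.
have qu2 : proj u.2 = q by rewrite -su.
have qv2 : proj v.2 = q by rewrite -sv.
have [ov1 ov2] := over_char i P1 uv3.
rewrite uv1 in hC hN ov1 ov2.
split=> c.
  have := (over_char i P3 (hC c)).1; rewrite qv2 => ->.
  by rewrite ov2 (edge_unzip i k1 k2 cu).
have := (over_char i P2 (hN c)).1; rewrite qu2 => ->.
by rewrite ov1 (edge_unzip i k1 k2 cv).
Qed.

End Joint.

(** * Moving one vertex vertically *)

Section Isotopy.
Variable R : realType.
Local Notation pt3 := (pt3 R).
Local Notation pt2 := (pt2 R).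
Local Notation o3 := ((0, 0, 0) : pt3).
Local Notation o33 := ((o3, o3) : pt3 * pt3).
Implicit Types (a b c d p : pt3) (P Q : seq pt3) (q : pt2) (u v w : pt3 * pt3)
  (L : seq (pt3 * pt3)).
Local Notation jcl := (cl (@jlerp R)).
Local Notation path3 := (gpath (@lerp R)).

Lemma vtx_in P i : (0 < size P)%N -> vtx P i \in P.
Proof. by move=> h; rewrite /vtx mem_nth // ltn_mod. Qed.

(** Apart from simplicity and the clause on vertices, regularity depends on the point set only. *)
Lemma reg_perm P Q : regular P -> knot_polygon Q -> kimg Q = kimg P ->
  (forall x, x \in Q -> ~ double_pt P (proj x)) -> regular Q.
Proof.
move=> [_ h2 [s hs] _] kQ e hQ.
have D q : double_pt Q q <-> double_pt P q by rewrite /double_pt /preim e.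
split=> //.
- by move=> q p1 p2 p3; rewrite /preim e; apply: h2.
- by exists s => q; rewrite D.
move=> i i1; rewrite D; apply: hQ; apply: vtx_in; exact: leq_ltn_trans i1.
Qed.

Lemma reg_rot k P : regular P -> regular (rot k P).
Proof.
move=> rP; apply: (reg_perm rP).
- exact/knot_polygon_rot/reg_knot.
- by rewrite !kimgE cl_rot.
by move=> x; rewrite mem_rot; apply: reg_vertex.
Qed.

Local Notation dg := (fun p : pt3 => (p, p)).

Lemma dg_path b s p : path3 b s p -> gpath (@jlerp R) (dg b) (map dg s) (dg p).
Proof.
move=> h; have <- := gpath_map (f := @lerp R) (f' := @jlerp R) (g := dg) b s (fun _ _ _ => erefl).
by exists p.
Qed.

(** [h] is the height of a strand, [g0] and [g1] are the heights of an edge before and after a move.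
    A strand on the same side of both positions can be a weighted mean of them only by touching. *)
Lemma same_side_convex (y z : R) (g0 g1 h : R) : 0 <= y -> 0 <= z -> 0 < y + z ->
  (y + z) * h = y * g0 + z * g1 -> (g0 < h -> g1 < h) -> (h < g0 -> h < g1) -> g0 = h.
Proof.
move=> y0 z0 yz e h1 h2.
have pos (k0 k1 : R) : 0 < k0 -> 0 < k1 -> 0 < y * k0 + z * k1.
  move=> p0 p1; case: (ltP 0 y) => y1.
    by apply: ltr_pwDl; [apply: mulr_gt0 | apply: mulr_ge0 => //; apply: ltW].
  by apply: ltr_wpDl; [apply: mulr_ge0 => //; apply: ltW | apply: mulr_gt0 => //; lra].
case: (ltgtP g0 h) => // l; exfalso.
  by have l1 := h1 l; have := pos (h - g0) (h - g1); rewrite !subr_gt0 => /(_ l l1); lra.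
by have l1 := h2 l; have := pos (g0 - h) (g1 - h); rewrite !subr_gt0 => /(_ l l1); lra.
Qed.

(** Moving [v] vertically sweeps two vertical triangles: one Delta-move inserts [v'], a second
    removes [v]. A strand meeting a triangle would lie between the old and the new position of an
    edge, so its crossing with that edge would change. *)
Lemma vertex_move a (v v' : pt3) b s :
  let L := (a, a) :: (v, v') :: (b, b) :: map dg s in
  proj v = proj v' -> regular (unzip1 L) -> cross_rel set0 L ->
  knot_equiv (unzip1 L) (unzip2 L).
Proof.
move=> L pv rP hX.
have hL : shad L.
  move=> u; rewrite !inE => /or4P[/eqP->|/eqP->|/eqP->|/mapP[x _ ->]] //.
have rQ := reg_transfer hL rP (cross_gap hX).
have E1 : unzip1 L = a :: v :: b :: s.
  by rewrite /L /= /unzip1 -map_comp /=; congr [:: _, _, _ & _]; rewrite map_id.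
have E2 : unzip2 L = a :: v' :: b :: s.
  by rewrite /L /= /unzip2 -map_comp /=; congr [:: _, _, _ & _]; rewrite map_id.
rewrite E1 in rP *; rewrite E2 in rQ *.
case: (pselect (v = v')) => [<-|nv]; first exact: rst_refl.
have kP := reg_knot rP; have kQ := reg_knot rQ.
have C1 (t : R) : 0 <= t <= 1 -> jcl L (lerp a v t, lerp a v' t) by move=> t1; left; exists t.
have C2 (t : R) : 0 <= t <= 1 -> jcl L (lerp v b t, lerp v' b t) by move=> t1; right; left; exists t.
have C3 p : path3 b (rcons s a) p -> jcl L (p, p).
  by move=> /dg_path h; right; right; move: h; rewrite map_rcons.
have [n1 n2] : proj a <> proj v /\ v' <> a.
  have nav : a <> v by have := kP => /knot_polygon_cons[].
  have h : proj a <> proj v.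
    by apply: reg_edge rP nav _; rewrite kimg_cons2; left.
  by split=> // e; apply: h; rewrite pv e.
have pa (t : R) : proj (lerp a v t) = proj (lerp a v' t) by rewrite !proj_lerp pv.
have pb (t : R) : proj (lerp v b t) = proj (lerp v' b t) by rewrite !proj_lerp pv.
have [||||k1 e1] := delta_insert (c := v') kP.
- exact: n2.
- exact/nesym.
- move=> p [t [t1 et]] [r [r1 er]].
  have : proj p = proj v' by rewrite er proj_lerp pv; apply: pt2_eq => /=; ring.
  have -> : proj v' = proj (lerp a v 1) by rewrite lerp1.
  by rewrite et -pa !proj_lerp => /(lerp2_inj n1) ->; rewrite lerp1.
- move=> p [x [y [z [x0 y0 z0 s1 ep]]]] hp.
  have pp : proj p = proj (lerp a v (y + z)).
    have [pv1 pv2] : v.1.1 = v'.1.1 /\ v.1.2 = v'.1.2 by case: pv.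
    have xe : x = 1 - y - z by lra.
    by rewrite ep xe; apply: pt2_eq => /=; rewrite -?pv1 -?pv2; ring.
  have yz : 0 <= y + z <= 1 by lra.
  case: (eqVneq (y + z) 0) => yz0.
    left; have [xe [ye ze]] : x = 1 /\ y = 0 /\ z = 0 by lra.
    by rewrite ep xe ye ze; apply: pt3_eq => /=; ring.
  have yz1 : 0 < y + z by rewrite lt_neqAle eq_sym yz0; lra.
  case: hp => hp.
    right; have [] // := reg_adjacent rP erefl (p := lerp a v (y + z)) (p' := p) => //.
    by exists (y + z).
  suff e0 : lerp a v (y + z) = p.
    have [_ _ _ hh] := (knot_polygon_cons _ _ _).1 kP.
    by apply: hh; [exists (y + z) | right].
  apply: proj_height => //.
  apply: (@same_side_convex y z _ (lerp a v' (y + z)).2) => //.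
  + by rewrite ep /=; have -> : x = 1 - y - z by [lra]; ring.
  + by move=> l; case: (hX _ _ (C1 _ yz) (C3 _ hp) (esym pp) l) => _; apply=> -[].
  + by move=> l; case: (hX _ _ (C3 _ hp) (C1 _ yz) pp l) => _; apply=> -[].
have k2 := knot_polygon_rot 1 k1; have e2 := equiv_rot 1 k1.
rewrite rot1_cons /= in k2 e2.
have [||k3 e3] := delta_remove (s := rcons s a) _ k2; first by rewrite size_rcons.
  move=> p [y [x [z [y0 x0 z0 s1 ep]]]].
  have pp : proj p = proj (lerp v b x).
    have [pv1 pv2] : v.1.1 = v'.1.1 /\ v.1.2 = v'.1.2 by case: pv.
    have ye : y = 1 - x - z by lra.
    by rewrite ep ye; apply: pt2_eq => /=; rewrite -?pv1 -?pv2; ring.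
  have x1 : 0 <= x <= 1 by lra.
  rewrite gpath_rcons // last_rcons => -[hp|hp]; last first.
    left; have [] // := reg_adjacent rQ erefl (p := p) (p' := lerp v' b x) => //.
      by exists x.
    by rewrite -pb.
  case: (eqVneq x 1) => xn.
    right; have [xe [ye ze]] : x = 1 /\ y = 0 /\ z = 0 by lra.
    by rewrite ep xe ye ze; apply: pt3_eq => /=; ring.
  have x2 : x < 1 by rewrite lt_neqAle xn; lra.
  suff e0 : lerp v b x = p.
    right; have [_ _ /= [_ hh _] _] := (knot_polygon_cons _ _ _).1 kP.
    by apply: hh => //; exists x.
  apply: proj_height => //.
  apply: (@same_side_convex z y _ (lerp v' b x).2) => //; first by lra.
  + by rewrite ep /=; have -> : x = 1 - y - z by [lra]; ring.
  + by move=> l; case: (hX _ _ (C2 _ x1) (C3 _ hp) (esym pp) l) => _; apply=> -[].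
  + by move=> l; case: (hX _ _ (C3 _ hp) (C2 _ x1) pp l) => _; apply=> -[].
apply: rst_trans e1 _; apply: rst_trans e2 _; apply: rst_trans e3 _.
by apply: rst_sym; have := equiv_rot 1 kQ; rewrite rot1_cons.
Qed.

Lemma cross_rel_rot C k L : cross_rel C L -> cross_rel C (rot k L).
Proof. by rewrite /cross_rel cl_rot. Qed.

Lemma vertex_move_at k L : (k < size L)%N -> shad L ->
  (forall i, (i < size L)%N -> i <> k -> (nth o33 L i).1 = (nth o33 L i).2) ->
  regular (unzip1 L) -> cross_rel set0 L -> knot_equiv (unzip1 L) (unzip2 L).
Proof.
move=> k1 hL hd rP hX.
have n3 : (3 <= size L)%N by have [] := reg_knot rP; rewrite size_map.
have rQ := reg_transfer hL rP (cross_gap hX).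
(* Rotating by [r] puts the vertex [k] in position 1; for [k = 0] its predecessor is the last
   vertex. *)
pose r := if k is k'.+1 then k' else (size L).-1.
have Er : exists u0 u1 u2 s, rot r L = [:: u0, u1, u2 & map dg s] /\
    u0.1 = u0.2 /\ u2.1 = u2.2 /\ proj u1.1 = proj u1.2.
  have r1 : (r < size L)%N by rewrite /r; case: k {hd r} k1 => [|k]; lia.
  have nr i : (i < size L)%N -> nth o33 (rot r L) i = nth o33 L ((i + r) %% size L)%N.
    move=> i1; rewrite /rot nth_cat size_drop nth_drop.
    case: ltnP => h; first by rewrite modn_small addnC //; lia.
    rewrite nth_take; last by lia.
    have -> : (i + r)%N = (size L + (i - (size L - r)))%N by lia.
    by rewrite modnDl modn_small //; lia.
  have nk i : (i < size L)%N -> i <> 1%N -> ((i + r) %% size L)%N <> k.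
    rewrite /r; case: k {hd r r1 nr} k1 => [|k] k1 i1 ni.
      case: (posnP i) => i0; first by rewrite i0 add0n modn_small; lia.
      have -> : (i + (size L).-1)%N = (size L + i.-1)%N by lia.
      by rewrite modnDl modn_small; lia.
    case: (ltnP (i + k) (size L)) => h; first by rewrite modn_small //; lia.
    have -> : (i + k)%N = (size L + (i + k - size L))%N by lia.
    by rewrite modnDl modn_small; lia.
  have dr i : (i < size L)%N -> i <> 1%N -> (nth o33 (rot r L) i).1 = (nth o33 (rot r L) i).2.
    by move=> i1 ni; rewrite nr //; apply: hd; [rewrite ltn_mod; lia | apply: nk].
  have sr : size (rot r L) = size L by rewrite size_rot.
  case E : (rot r L) sr dr => [|u0 [|u1 [|u2 s]]] sr dr; try by move: n3; rewrite -sr.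
  exists u0, u1, u2, (unzip1 s); split; last first.
    split; first by apply: (dr 0%N); lia.
    split; first by apply: (dr 2%N); lia.
    by apply: hL; rewrite -(mem_rot r) E !inE eqxx orbT.
  congr [:: _, _, _ & _]; rewrite /unzip1 -map_comp -[LHS]map_id.
  apply/eq_in_map => u /(nthP o33)[i i1 <-] /=.
  have e : (nth o33 s i).1 = (nth o33 s i).2 by apply: (dr i.+3) => //; rewrite -sr.
  by rewrite [LHS]surjective_pairing -e.
case: Er => u0 [[v v'] [u2 [s [E [d0 [d2 d1]]]]]].
have h := vertex_move (a := u0.1) (b := u2.1) (s := s) d1.
have E' : rot r L = [:: (u0.1, u0.1), (v, v'), (u2.1, u2.1) & map dg s].
  by rewrite E; congr [:: _, _, _ & _]; rewrite [LHS]surjective_pairing ?d0 ?d2.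
rewrite -E' in h.
have h1 := h; rewrite /unzip1 /unzip2 !map_rot in h1.
apply: rst_trans (equiv_rot r (reg_knot rP)) _.
apply: rst_trans _ (rst_sym _ _ _ _ (equiv_rot r (reg_knot rQ))).
by apply: h1; [apply: reg_rot | apply: cross_rel_rot].
Qed.

(** Two changes of one polygon differ exactly where one of them changes a crossing and the other
    does not. Applied with both sets empty, and to a single crossing against the set of a list of
    regions. *)
Lemma cross_rel_comp (C1 C2 : set pt2) L1 L2 : shad L1 -> shad L2 ->
  unzip1 L1 = unzip1 L2 -> regular (unzip1 L1) -> cross_rel C1 L1 -> cross_rel C2 L2 ->
  let J := zip (unzip2 L1) (unzip2 L2) in
  shad J /\ cross_rel [set q | ~ (C1 q <-> C2 q)] J.
Proof.
move=> h1 h2 e12 rP X1 X2 J.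
have sz : size L1 = size L2 by have := congr1 size e12; rewrite !size_map.
have sJ : size J = size L1 by rewrite size_zip !size_map sz minnn.
have J1 : unzip1 J = unzip2 L1 by rewrite unzip1_zip // !size_map sz.
have J2 : unzip2 J = unzip2 L2 by rewrite unzip2_zip // !size_map sz.
have hJ : shad J.
  move=> u /(nthP o33)[i i1 <-]; rewrite sJ in i1.
  have i2 : (i < size L2)%N by rewrite -sz.
  rewrite nth_zip ?size_map // (nth_map o33) // (nth_map o33 _ snd) //=.
  rewrite -h1 ?mem_nth // -h2 ?mem_nth //.
  by rewrite -!(nth_map o33 o3 fst) // -/(unzip1 L1) e12.
split=> // u v /jcl_nth[i [s [i1 s1 u1 u2]]] /jcl_nth[j [t [j1 t1 v1 v2]]].
rewrite J1 J2 sJ in i1 j1 u1 u2 v1 v2.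
pose p := lerp (vtx (unzip1 L1) i) (vtx (unzip1 L1) i.+1) s.
pose p' := lerp (vtx (unzip1 L1) j) (vtx (unzip1 L1) j.+1) t.
have cp1 : jcl L1 (p, u.1) by apply/jcl_nth; exists i, s.
have cp2 : jcl L2 (p, u.2) by apply/jcl_nth; exists i, s; rewrite -sz -e12.
have cp'1 : jcl L1 (p', v.1) by apply/jcl_nth; exists j, t.
have cp'2 : jcl L2 (p', v.2) by apply/jcl_nth; exists j, t; rewrite -sz -e12.
move=> e l.
have pu : proj p = proj u.1 by exact: (shad_jcl h1 cp1).
have pv : proj p' = proj v.1 by exact: (shad_jcl h1 cp'1).
have epp : proj p = proj p' by rewrite pu pv.
have : p.2 <> p'.2.
  move=> h; have pp : p = p' by apply: proj_height.
  by have /(congr1 snd) /= uv := jinj1 (reg_knot rP) cp1 cp'1 pp; rewrite uv ltxx in l.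
rewrite -pu /=; case: (ltgtP p.2 p'.2) => // lp _.
  case: (X1 _ _ cp1 cp'1 epp lp) => /= c1 _.
  have nC1 : ~ C1 (proj p) by move=> /c1; rewrite ltNge (ltW l).
  case: (X2 _ _ cp2 cp'2 epp lp) => /= d1 d2; split=> hC.
    by apply: d1; apply: contrapT => nC2; apply: hC.
  by apply: d2 => C2p; apply: hC => -[_ /(_ C2p)].
case: (X1 _ _ cp'1 cp1 (esym epp) lp) => /= _ c1; rewrite -epp in c1.
have hC1 : C1 (proj p) by apply: contrapT => /c1; rewrite ltNge (ltW l).
case: (X2 _ _ cp'2 cp2 (esym epp) lp) => /= d1 d2; rewrite -epp in d1 d2; split=> hC.
  by apply: d2 => C2p; apply: hC.
by apply: d1; apply: contrapT => nC2; apply: hC => -[/(_ hC1)].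
Qed.

End Isotopy.

(** * Polygons with the same projection and the same crossings *)

Section HeightIsotopy.
Variable R : realType.
Local Notation pt3 := (pt3 R).
Local Notation pt2 := (pt2 R).
Local Notation o3 := ((0, 0, 0) : pt3).
Local Notation o33 := ((o3, o3) : pt3 * pt3).
Implicit Types (a b c d p : pt3) (P Q : seq pt3) (q : pt2) (u v w : pt3 * pt3)
  (L : seq (pt3 * pt3)).
Local Notation jcl := (cl (@jlerp R)).

(** There are finitely many double points, so the minimum can be built along their list; both
    polygons are measured at once. *)
Lemma min_gap L : shad L -> regular (unzip1 L) -> cross_rel set0 L ->
  exists2 e : R, 0 < e & forall u v, jcl L u -> jcl L v -> proj u.1 = proj v.1 ->
    u.1.2 < v.1.2 -> e <= v.1.2 - u.1.2 /\ e <= v.2.2 - u.2.2.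
Proof.
move=> hL rP hX; have [_ _ [s hs] _] := rP.
suff [e e0 h] : exists2 e : R, 0 < e & forall u v, jcl L u -> jcl L v ->
    proj u.1 = proj v.1 -> proj u.1 \in s ->
    u.1.2 < v.1.2 -> e <= v.1.2 - u.1.2 /\ e <= v.2.2 - u.2.2.
  exists e => // u v cu cv euv l; apply: h => //; apply/hs.
  apply: (reg_double rP) euv; first by apply/kimg1P; exists u.
    by apply/kimg1P; exists v.
  by move=> n; rewrite n ltxx in l.
elim: s {hs} => [|q s [e e0 IH]]; first by exists 1.
have [f f0 hf] : exists2 f : R, 0 < f & forall u v, jcl L u -> jcl L v ->
    proj u.1 = proj v.1 -> proj u.1 = q ->
    u.1.2 < v.1.2 -> f <= v.1.2 - u.1.2 /\ f <= v.2.2 - u.2.2.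
  case: (pselect (exists u v, [/\ jcl L u, jcl L v, proj u.1 = proj v.1, proj u.1 = q &
      u.1.2 < v.1.2])); last first.
    move=> n; exists 1 => // u v cu cv e1 e2 l; case: n; exists u, v; split=> //.
  move=> [u [v [cu cv e1 e2 l]]].
  have l2 : u.2.2 < v.2.2 by case: (hX u v cu cv e1 l) => _; apply=> -[].
  exists (Num.min (v.1.2 - u.1.2) (v.2.2 - u.2.2)).
    by rewrite lt_min !subr_gt0 l l2.
  have n1 : u.1 <> v.1 by move=> n; rewrite n ltxx in l.
  have k1 : kimg (unzip1 L) u.1 by apply/kimg1P; exists u.
  have k2 : kimg (unzip1 L) v.1 by apply/kimg1P; exists v.
  have P1 := preim2 rP k1 k2 n1 e1.
  move=> u' v' cu' cv' e1' e2' l'.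
  have : preim (unzip1 L) (proj u.1) u'.1 by split; [apply/kimg1P; exists u' | rewrite e2].
  have : preim (unzip1 L) (proj u.1) v'.1 by split; [apply/kimg1P; exists v' | rewrite e2 -e1'].
  have J := jinj1 (reg_knot rP).
  rewrite P1 => -[] /= hv [] /= hu.
  - by rewrite hu hv ltxx in l'.
  - by rewrite hu hv ltNge (ltW l) in l'.
  - have := J _ _ cu' cu hu; have := J _ _ cv' cv hv => -> ->.
    by rewrite !ge_min !lexx orbT.
  by rewrite hu hv ltxx in l'.
exists (Num.min e f); first by rewrite lt_min e0 f0.
move=> u v cu cv e1; rewrite inE => /orP[/eqP h|h] l.
  have [h1 h2] := hf u v cu cv e1 h l.
  by rewrite !ge_min h1 h2 !orbT.
have [h1 h2] := IH u v cu cv e1 h l.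
by rewrite !ge_min h1 h2.
Qed.

Lemma max_shift L : exists2 B : R, 0 <= B & forall u, u \in L -> `|u.2.2 - u.1.2| <= B.
Proof.
elim: L => [|u L [B B0 hB]]; first by exists 0.
exists (Num.max B `|u.2.2 - u.1.2|); first by rewrite le_max B0.
move=> v; rewrite inE => /orP[/eqP ->|/hB h]; first by rewrite le_max lexx orbT.
by rewrite le_max h.
Qed.

(** Each vertex has its own parameter, which allows moving one vertex at a time. *)
Definition blend L (t : nat -> R) i : pt3 := lerp (nth o33 L i).1 (nth o33 L i).2 (t i).

Definition blend_from L t : seq (pt3 * pt3) :=
  mkseq (fun i => ((nth o33 L i).1, blend L t i)) (size L).

Lemma blend_small (B e a x : R) (u : pt3 * pt3) :
  `|u.2.2 - u.1.2| <= B -> 0 <= e -> a <= x <= a + e ->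
  `|(lerp u.1 u.2 x).2 - (lerp u.1 u.2 a).2| <= e * B.
Proof.
move=> h e0 x1.
have -> : (lerp u.1 u.2 x).2 - (lerp u.1 u.2 a).2 = (x - a) * (u.2.2 - u.1.2).
  by rewrite /=; ring.
rewrite normrM; apply: ler_pM => //; rewrite ger0_norm; lra.
Qed.

Lemma shad_blend L t : shad L -> shad (blend_from L t).
Proof.
move=> hL u /mapP[i]; rewrite mem_iota add0n => /andP[_ i1] -> /=.
rewrite /blend proj_lerp -hL ?mem_nth //; apply: pt2_eq => /=; ring.
Qed.

Lemma unzip1_blend L t : unzip1 (blend_from L t) = unzip1 L.
Proof.
apply: (eq_from_nth (x0 := o3)); rewrite ?size_map ?size_iota // => i i1.
by rewrite (nth_map o33) ?size_map ?size_iota // nth_mkseq //= (nth_map o33).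
Qed.

Lemma vtx_blend L t i : (0 < size L)%N -> vtx (unzip2 (blend_from L t)) i = blend L t (i %% size L).
Proof. by move=> n0; rewrite vtx_unzip2 size_mkseq nth_mkseq ?ltn_mod. Qed.

Lemma convex_norm (s d0 d1 m : R) : 0 <= s <= 1 -> `|d0| <= m -> `|d1| <= m ->
  `|(1 - s) * d0 + s * d1| <= m.
Proof.
move=> /andP[s0 s1]; rewrite !ler_norml => /andP[h1 h2] /andP[h3 h4].
have t0 : 0 <= 1 - s by lra.
have := mulr_ge0 s0 (_ : 0 <= m - d1); have := mulr_ge0 s0 (_ : 0 <= m + d1).
have := mulr_ge0 t0 (_ : 0 <= m - d0); have := mulr_ge0 t0 (_ : 0 <= m + d0).
move=> /(_ ltac:(lra)) a1 /(_ ltac:(lra)) a2 /(_ ltac:(lra)) a3 /(_ ltac:(lra)) a4; lra.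
Qed.

(** With all parameters equal to [a], every gap is a mean of the two given gaps, hence at least
    [de]. Spreading the parameters over a range [e] moves each height by at most [e * B], so two
    strands lose at most [2 * (e * B)]. *)
Lemma near_blend_rel L (e B de a : R) (t : nat -> R) :
  (forall u v, jcl L u -> jcl L v -> proj u.1 = proj v.1 ->
    u.1.2 < v.1.2 -> de <= v.1.2 - u.1.2 /\ de <= v.2.2 - u.2.2) ->
  (forall u, u \in L -> `|u.2.2 - u.1.2| <= B) -> 0 <= e -> 0 <= a <= 1 ->
  2 * (e * B) < de -> (forall i, (i < size L)%N -> a <= t i <= a + e) ->
  cross_rel set0 (blend_from L t).
Proof.
move=> hg hB e0 a01 hde ht.
have key u : jcl (blend_from L t) u -> exists2 w, jcl L w &
    w.1 = u.1 /\ `|u.2.2 - (lerp w.1 w.2 a).2| <= e * B.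
  move=> /jcl_nth[i [s [i1 s1 u1 u2]]]; rewrite size_mkseq in i1.
  have n0 : (0 < size L)%N by apply: leq_ltn_trans i1.
  exists (u.1, lerp (vtx (unzip2 L) i) (vtx (unzip2 L) i.+1) s).
    by apply/jcl_nth; exists i, s; split=> //; rewrite u1 unzip1_blend.
  split=> //.
  have E k : exists2 w, w \in L & w = ((vtx (unzip1 L) k), (vtx (unzip2 L) k)) /\
       vtx (unzip2 (blend_from L t)) k = lerp w.1 w.2 (t (k %% size L)%N).
    exists (nth o33 L (k %% size L)); first by rewrite mem_nth // ltn_mod.
    by rewrite vtx_blend // vtx_unzip1 vtx_unzip2 -surjective_pairing.
  have bd k : `|(vtx (unzip2 (blend_from L t)) k).2 - (lerp (vtx (unzip1 L) k) (vtx (unzip2 L) k) a).2| <= e * B.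
    have [w wL [ew ->]] := E k.
    have -> : vtx (unzip1 L) k = w.1 by rewrite ew.
    have -> : vtx (unzip2 L) k = w.2 by rewrite ew.
    apply: blend_small => //; [exact: hB | apply: ht].
    by rewrite ltn_mod.
  have -> : u.2.2 - (lerp (u.1, lerp (vtx (unzip2 L) i) (vtx (unzip2 L) i.+1) s).1
      (u.1, lerp (vtx (unzip2 L) i) (vtx (unzip2 L) i.+1) s).2 a).2 =
    (1 - s) * ((vtx (unzip2 (blend_from L t)) i).2 - (lerp (vtx (unzip1 L) i) (vtx (unzip2 L) i) a).2)
    + s * ((vtx (unzip2 (blend_from L t)) i.+1).2 - (lerp (vtx (unzip1 L) i.+1) (vtx (unzip2 L) i.+1) a).2).
    by rewrite u2 u1 unzip1_blend /=; ring.
  exact: convex_norm.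
move=> u v H H0 H1 H2; split=> [[]|_]; have [w cw [ew bw]] := key u H; have [w' cw' [ew' bw']] := key v H0.
rewrite -ew -ew' in H1 H2.
have [g1 g2] := hg w w' cw cw' H1 H2.
move: bw bw'; rewrite !ler_norml /= => /andP[b1 b2] /andP[b3 b4].
have : de <= w'.1.2 + a * (w'.2.2 - w'.1.2) - (w.1.2 + a * (w.2.2 - w.1.2)) by nra.
lra.
Qed.

Lemma cross_rel_blend L t t' : shad L -> regular (unzip1 L) ->
  cross_rel set0 (blend_from L t) -> cross_rel set0 (blend_from L t') ->
  forall k, (forall i, (i < size L)%N -> i <> k -> t i = t' i) -> (k < size L)%N ->
  knot_equiv (unzip2 (blend_from L t)) (unzip2 (blend_from L t')).
Proof.
move=> hL rP X1 X2 k tk k1.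
have h1 := shad_blend (t := t) hL; have h2 := shad_blend (t := t') hL.
have [] := cross_rel_comp h1 h2 _ _ X1 X2; rewrite ?unzip1_blend //.
set J := zip _ _ => hJ XJ.
have J1 : unzip1 J = unzip2 (blend_from L t) by rewrite unzip1_zip // !size_map !size_iota.
have J2 : unzip2 J = unzip2 (blend_from L t') by rewrite unzip2_zip // !size_map !size_iota.
have sJ : size J = size L by rewrite size_zip !size_map !size_iota minnn.
rewrite -J1 -J2; apply: (vertex_move_at (k := k)) => //.
- by rewrite sJ.
- move=> i; rewrite sJ => i1 ik.
  by rewrite nth_zip ?size_map ?size_iota //= !(nth_map o33) ?size_map ?size_iota // !nth_mkseq //= /blend tk.
- rewrite J1; apply: reg_transfer => //; first by rewrite unzip1_blend.
  exact: cross_gap X1.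
by move=> u v cu cv e l; have [_ h] := XJ u v cu cv e l; split=> [[]|_]; apply: h; apply.
Qed.

(* The heights of unzip1 L are moved to those of unzip2 L in N small rounds,
   one vertex at a time within each round. *)
Lemma height_isotopy L : shad L -> regular (unzip1 L) -> cross_rel set0 L ->
  knot_equiv (unzip1 L) (unzip2 L).
Proof.
move=> hL rP hX.
have [de de0 hg] := min_gap hL rP hX.
have [B B0 hB] := max_shift L.
(* Chosen so that one round, with [e = 1 / N], satisfies [2 * (e * B) < de]. *)
pose N := (Num.bound (2 * B / de)).+1.
have N0 : 0 < N%:R :> R by rewrite ltr0n.
have hN : 2 * (N%:R^-1 * B) < de.
  have : 2 * B / de < N%:R.
    have : 0 <= 2 * B / de by rewrite divr_ge0 ?mulr_ge0 // ltW.
    move/archi_boundP => h; apply: lt_trans h _; rewrite ltr_nat //.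
  by rewrite ltr_pdivrMr // => h; rewrite mulrCA ltr_pdivrMl.
(* In round [k] the first [m] vertices have already advanced from [k / N] to [(k + 1) / N]. *)
pose t k m (i : nat) : R := (k + (i < m)%N)%:R / N%:R.
have X k m : (k < N)%N -> cross_rel set0 (blend_from L (t k m)).
  move=> kN; apply: (near_blend_rel (e := N%:R^-1) (a := k%:R / N%:R) hg hB) => //.
  - by rewrite divr_ge0 //= ler_pdivrMr // mul1r ler_nat ltnW.
  move=> i _; rewrite /t natrD mulrDl lerDl lerD2l.
  by case: (i < m)%N; rewrite ?mul1r ?mul0r ?invr_ge0 lexx ltW.
have S1 k m : (k < N)%N -> (m <= size L)%N ->
    knot_equiv (unzip2 (blend_from L (t k 0%N))) (unzip2 (blend_from L (t k m))).
  move=> kN; elim: m => [|m IH] m1; first exact: rst_refl.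
  apply: rst_trans (IH (ltnW m1)) _.
  apply: (cross_rel_blend hL rP (X _ _ kN) (X _ _ kN) (k := m)) => // i i1 im.
  by rewrite /t ltnS [in RHS]leq_eqVlt (introF eqP im).
have B_eq t1 t2 : (forall i, (i < size L)%N -> t1 i = t2 i) ->
    unzip2 (blend_from L t1) = unzip2 (blend_from L t2).
  move=> h; congr unzip2; apply/eq_in_map => i; rewrite mem_iota add0n => /andP[_ i1].
  by rewrite /blend h.
have S2 k : (k <= N)%N ->
    knot_equiv (unzip2 (blend_from L (t 0%N 0%N))) (unzip2 (blend_from L (t k 0%N))).
  elim: k => [|k IH] k1; first exact: rst_refl.
  apply: rst_trans (IH (ltnW k1)) _; apply: rst_trans (S1 _ (size L) k1 (leqnn _)) _.
  rewrite (B_eq _ (t k.+1 0%N)); first exact: rst_refl.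
  by move=> i i1; rewrite /t i1 /= addn1 addn0.
have E (t1 : nat -> R) (c : R) : (forall i, (i < size L)%N -> t1 i = c) ->
    unzip2 (blend_from L t1) = map (fun u => lerp u.1 u.2 c) L.
  move=> h; apply: (eq_from_nth (x0 := o3)); rewrite ?size_map ?size_iota // => i i1.
  by rewrite !(nth_map o33) ?size_map ?size_iota // nth_mkseq //= /blend h.
have := S2 N (leqnn _); rewrite (E _ 0) => [|i _]; last by rewrite /t /= mul0r.
rewrite (E _ 1) => [|i _]; last by rewrite /t /= addn0 divff // gt_eqF.
congr (knot_equiv _ _); apply: eq_map => u; by rewrite ?lerp0 ?lerp1.
Qed.

End HeightIsotopy.

(** * Collapsing a cone *)

Section Kink.
Variable R : realType.
Local Notation pt3 := (pt3 R).
Local Notation pt2 := (pt2 R).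
Implicit Types (p x y z : pt3) (P Q : seq pt3) (q : pt2) (u v w : pt3 * pt3)
  (L : seq (pt3 * pt3)).
Local Notation path3 := (gpath (@lerp R)).

(** Half spaces are convex; the factor [s] serves upper and lower ones alike. *)
Lemma path_level (s H : R) z (r : seq pt3) p : s * z.2 <= H ->
  (forall x, x \in r -> s * x.2 <= H) -> path3 z r p -> s * p.2 <= H.
Proof.
elim: r z => [|x r IH] z hz hr; first by move=> ->.
have hx : s * x.2 <= H by apply: hr; rewrite inE eqxx.
case=> [[t [t1 ->]]|]; last first.
  by apply: IH => // y yr; apply: hr; rewrite inE yr orbT.
have -> : s * (lerp z x t).2 = (1 - t) * (s * z.2) + t * (s * x.2) by rewrite /=; ring.
nra.
Qed.

(** Strands at or beyond the level [H] on the side away from [W] can meet the triangle [W], [z1],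
    [z2] in its base only, and the other edge at [W] cannot pierce it. The vertices [zs] are thus
    cut off one after the other. *)
Lemma cone_collapse (s H : R) y W zs zk r : (0 < size r)%N ->
  knot_polygon (y :: W :: zs ++ zk :: r) -> H < s * W.2 -> s * y.2 < H ->
  (forall z, z \in rcons zs zk -> s * z.2 = H) -> (forall z, z \in r -> s * z.2 <= H) ->
  knot_polygon (y :: W :: zk :: r) /\
  knot_equiv (y :: W :: zs ++ zk :: r) (y :: W :: zk :: r).
Proof.
move=> r0 k0 HW Hy Hz Hr; elim: zs k0 Hz => [|z1 zs IH] k0 Hz.
  by split=> //; apply: rst_refl.
have [z2 [rest E]] : exists z2 rest, zs ++ zk :: r = z2 :: rest.
  by case: (zs) => [|z zs']; eexists _, _; reflexivity.
have Hz1 : s * z1.2 = H by apply: Hz; rewrite inE eqxx.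
have Hall z : z \in z2 :: rest -> s * z.2 <= H.
  rewrite -E mem_cat inE => /or3P[h|/eqP ->|/Hr //].
    by rewrite Hz // inE mem_rcons inE h !orbT.
  by rewrite Hz // inE mem_rcons inE eqxx !orbT.
have Hz2 : s * z2.2 = H.
  apply: Hz; case: (zs) E => [|z zs'] [-> _]; by rewrite !inE eqxx !orbT.
have k0' := k0; rewrite /= E in k0'.
have [_ yW /= [_ _ [_ hz _]] hyW] := (knot_polygon_cons _ _ _).1 k0'.
have [k1 e1] := equiv_catC (s1 := [:: y]) k0'.
rewrite /= cats1 /= in k1 e1.
have [||k2 e2] := delta_remove (s := rcons rest y) _ k1; first by rewrite size_rcons.
  move=> p [a [b [c [a0 b0 c0 abc ep]]]].
  (* The height of [p] over the level [H] is proportional to the weight [a] of the apex. *)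
  have lp : s * p.2 = a * (s * W.2) + (1 - a) * H.
    have -> : s * p.2 = a * (s * W.2) + b * (s * z2.2) + c * (s * z1.2) by rewrite ep /=; ring.
    have -> : a = 1 - b - c by lra.
    by rewrite Hz1 Hz2; ring.
  rewrite gpath_rcons // last_rcons => -[hp|].
    have lp2 : s * p.2 <= H.
      apply: path_level hp; first by rewrite Hz2.
      move=> z; rewrite mem_rcons inE => /orP[/eqP ->|h]; first exact: ltW.
      by apply: Hall; rewrite inE h orbT.
    have a00 : a = 0 by nra.
    right; apply: hz => //; exists b; split; first by lra.
    have ce : c = 1 - b by lra.
    by rewrite ep a00 ce; apply: pt3_eq => /=; ring.
  move=> [l [l1 el]].
  case: (eqVneq a 1) => a1.
    left; have [be ce] : b = 0 /\ c = 0 by lra.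
    by rewrite ep a1 be ce; apply: pt3_eq => /=; ring.
  have a2 : 0 < 1 - a by rewrite subr_gt0 lt_neqAle a1; lra.
  have an : 1 - a != 0 by rewrite gt_eqF.
  (* [d] is where the ray from [W] through [p] reaches [[z1, z2]]; it also lies on the line through
     [y] and [W], at parameter [m]. *)
  pose m := (l - a) / (1 - a).
  have mE : m * (1 - a) = l - a by rewrite /m divfK.
  have bE : b / (1 - a) * (1 - a) = b by rewrite divfK.
  pose d := lerp y W m.
  have ed : d = lerp z1 z2 (b / (1 - a)).
    have F (f : pt3 -> R) : (forall x z t, f (lerp x z t) = f x + t * (f z - f x)) ->
        f p = a * f W + b * f z2 + c * f z1 -> f d = f (lerp z1 z2 (b / (1 - a))).
      move=> fl fp; apply: (mulfI an); rewrite !fl; move: fp; rewrite el fl.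
      set k := b / (1 - a) in bE *; move: (f y) (f W) (f z1) (f z2) => Y V Z1 Z2 fp.
      have -> : (1 - a) * (Y + m * (V - Y)) = (1 - a) * Y + m * (1 - a) * (V - Y) by ring.
      have -> : (1 - a) * (Z1 + k * (Z2 - Z1)) = (1 - a) * Z1 + k * (1 - a) * (Z2 - Z1) by ring.
      rewrite mE bE.
      have ce : c = 1 - a - b by lra.
      by rewrite ce in fp; lra.
    by apply: pt3_eq; [apply: (F (fun p => p.1.1)) | apply: (F (fun p => p.1.2)) | apply: (F snd)];
       rewrite ?ep.
  have ld : s * d.2 = H.
    rewrite ed /=; have -> : s * (z1.2 + b / (1 - a) * (z2.2 - z1.2)) =
      s * z1.2 + b / (1 - a) * (s * z2.2 - s * z1.2) by ring.
    by rewrite Hz1 Hz2 subrr mulr0 addr0.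
  have ld' : s * d.2 = (1 - m) * (s * y.2) + m * (s * W.2) by rewrite /=; ring.
  have m01 : 0 <= m <= 1.
    apply/andP; split; rewrite leNgt; apply/negP => hm; nra.
  case: (hyW d).
  - by exists m.
  - right; left; exists (b / (1 - a)); split=> //.
    apply/andP; split; first by apply: divr_ge0 => //; exact: ltW.
    by rewrite ler_pdivrMr // mul1r; lra.
  - by move=> dy; rewrite dy in ld; flra.
  by move=> dy; rewrite dy in ld; flra.
have k3 : knot_polygon (y :: W :: zs ++ zk :: r) /\
    knot_equiv (W :: z2 :: rcons rest y) (y :: W :: zs ++ zk :: r).
  by have := equiv_catC (s1 := W :: z2 :: rest) (s2 := [:: y]); rewrite E /= cats1; apply.
have [k4 e4] := IH k3.1 (fun z h => Hz z (mem_behead (s := z1 :: _) h)).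
split=> //; rewrite /= E in e1 e4 *.
apply: rst_trans e1 _; apply: rst_trans e2 _; apply: rst_trans _ e4.
by have := k3.2; rewrite E.
Qed.

End Kink.

(** * Changing the crossing of a kink *)

Section KinkFlip.
Variable R : realType.
Local Notation pt3 := (pt3 R).
Local Notation pt2 := (pt2 R).
Implicit Types (p : pt3) (P Q : seq pt3) (u v w : pt3 * pt3)
  (L : seq (pt3 * pt3)).
Local Notation jcl := (cl (@jlerp R)).
Local Notation path3 := (gpath (@lerp R)).
Local Notation dg := (fun p : pt3 => (p, p)).

Definition at_height p (h : R) : pt3 := (p.1, h).

(** The factor 2 makes any two of these heights differ by less than [H]. *)
Lemma max_height (P : seq pt3) : exists2 H : R, 0 < H & forall p, p \in P -> 2 * `|p.2| < H.
Proof.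
elim: P => [|p P [H H0 hH]]; first by exists 1.
exists (H + 2 * `|p.2|); first by rewrite ltr_wpDr // mulr_ge0.
move=> z; rewrite inE => /orP[/eqP ->|/hH h]; first by rewrite ltrDr.
by apply: lt_le_trans h _; rewrite lerDl mulr_ge0.
Qed.

(** Two segments run to the apex at height [2 * H]: one from [y], the other in the triangle along
    the median from the midpoint of [x] and the base vertex at height [H]. Over the crossing the
    first is the higher one, so they share the apex only. *)
Lemma apex_weights (mu nu rh l H hx hy : R) : mu + nu + rh = 1 -> mu = 2 * l - 1 ->
  nu - rh = 0 -> 0 < H + hy - hx ->
  mu * (2 * H) + nu * hx + rh * H = (1 - l) * hy + l * (2 * H) ->
  mu = 1 /\ nu = 0 /\ rh = 0.
Proof.
move=> s1 h1 h2 Hxy e.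
have : (1 - mu) * (H + hy - hx) = 0.
  have -> : mu = 1 - nu - rh by lra.
  have nr : nu = rh by lra.
  have lr : l = 1 - rh by lra.
  by move: e; rewrite h1 nr lr; lra.
move/eqP; rewrite mulf_eq0 (gt_eqF Hxy) orbF subr_eq0 => /eqP m1.
by split; [|split]; lra.
Qed.

(** Normal form of a kink: [[y, w1]] and [[wm, x]] cross at their common projected midpoint [q],
    with half edges [a] and [b]. [hull] lets the rest of the knot enter the parallelogram with
    corners over [y], [wm], [w1], [x] only in [x] and [y]. *)
Variables (y w1 wm x : pt3) (ws rest : seq pt3) (q a b : pt2).
Let P := y :: w1 :: ws ++ wm :: x :: rest.
Hypothesis rP : regular P.
Hypothesis rest0 : (0 < size rest)%N.
Hypothesis ey : proj y = (q.1 - a.1, q.2 - a.2).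
Hypothesis ew1 : proj w1 = (q.1 + a.1, q.2 + a.2).
Hypothesis ewm : proj wm = (q.1 - b.1, q.2 - b.2).
Hypothesis ex : proj x = (q.1 + b.1, q.2 + b.2).
Hypothesis det : a.1 * b.2 - a.2 * b.1 != 0.
Hypothesis hull : forall p (al be : R), path3 x (rcons rest y) p -> `|al| + `|be| <= 1 ->
  proj p = (q.1 + al * a.1 + be * b.1, q.2 + al * a.2 + be * b.2) -> p = x \/ p = y.
Hypothesis loop : forall p, path3 y (w1 :: ws ++ [:: wm; x]) p ->
  double_pt P (proj p) -> proj p = q.

Let m1 := lerp y w1 (1/2).
Let m2 := lerp wm x (1/2).

Lemma coord_inj (al be al' be' : R) :
  (q.1 + al * a.1 + be * b.1, q.2 + al * a.2 + be * b.2) =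
  (q.1 + al' * a.1 + be' * b.1, q.2 + al' * a.2 + be' * b.2) -> al = al' /\ be = be'.
Proof.
case=> e1 e2.
have h1 : (al - al') * a.1 = (be' - be) * b.1 by lra.
have h2 : (al - al') * a.2 = (be' - be) * b.2 by lra.
have h3 : (al - al') * (a.1 * b.2 - a.2 * b.1) = 0.
  by rewrite mulrBr !mulrA h1 h2; ring.
have h4 : (be' - be) * (a.1 * b.2 - a.2 * b.1) = 0.
  have -> : (be' - be) * (a.1 * b.2 - a.2 * b.1) = a.1 * ((be' - be) * b.2) - a.2 * ((be' - be) * b.1) by ring.
  by rewrite -h1 -h2; ring.
move/eqP: h3; rewrite mulf_eq0 (negbTE det) orbF => /eqP h3.
move/eqP: h4; rewrite mulf_eq0 (negbTE det) orbF => /eqP h4.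
lra.
Qed.

Lemma kimg_loop_split p : kimg P p <->
  path3 y (w1 :: ws ++ [:: wm; x]) p \/ path3 x (rcons rest y) p.
Proof.
have -> : kimg P = path3 y ((w1 :: ws ++ [:: wm; x]) ++ rcons rest y).
  by rewrite kimgE /P /= rcons_cat /= -catA.
by rewrite gpath_cat //= last_cat.
Qed.

Lemma mid_facts : [/\ kimg P m1, kimg P m2, proj m1 = q, proj m2 = q & m1 <> m2].
Proof.
have h1 : proj m1 = q by rewrite proj_lerp ey ew1; apply: pt2_eq => /=; lra.
have h2 : proj m2 = q by rewrite proj_lerp ewm ex; apply: pt2_eq => /=; lra.
have i1 : 0 <= (1/2 : R) <= 1 by lra.
have s1 : seg y w1 m1 by exists (1/2).
have p2 : path3 w1 (ws ++ [:: wm; x]) m2.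
  by rewrite gpath_cat //; right; right; left; exists (1/2).
have p2' : path3 w1 (rcons (ws ++ wm :: x :: rest) y) m2.
  have -> : rcons (ws ++ wm :: x :: rest) y = (ws ++ [:: wm; x]) ++ rcons rest y.
    by rewrite rcons_cat -catA.
  by rewrite gpath_cat //; left.
split=> //; first by apply/kimg_loop_split; left; left.
  by apply/kimg_loop_split; left; right.
move=> e; have [_ yw _ hh] := (knot_polygon_cons _ _ _).1 (reg_knot rP).
rewrite -e in p2'; case: (hh _ s1 p2').
  by rewrite -[RHS](lerp0 y w1) => /(lerp_inj yw); lra.
by rewrite -[RHS](lerp1 y w1) => /(lerp_inj yw); lra.
Qed.

Definition lift_pair (h : R) p : pt3 * pt3 := (p, at_height p h).

(* The loop w1, ..., wm is moved to the level s * H and its first vertex to the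
   level s * 2H: this makes [y, w1] the over strand at q for s = 1 and the
   under strand for s = -1. *)
Definition loop_lift (s H : R) : seq (pt3 * pt3) :=
  dg y :: lift_pair (s * (2 * H)) w1 :: map (lift_pair (s * H)) ws ++
    lift_pair (s * H) wm :: dg x :: map dg rest.

Lemma unzip1_loop_lift s H : unzip1 (loop_lift s H) = P.
Proof.
rewrite /loop_lift /unzip1 /= map_cat -map_comp /= -map_comp.
by congr [:: _, _ & _ ++ _ :: _ :: _]; rewrite map_id.
Qed.

Lemma unzip2_loop_lift s H : unzip2 (loop_lift s H) =
  y :: at_height w1 (s * (2 * H)) :: map (at_height^~ (s * H)) ws ++
    at_height wm (s * H) :: x :: rest.
Proof.
rewrite /loop_lift /unzip2 /= map_cat -map_comp /= -map_comp.
by congr [:: _, _ & _ ++ _ :: _ :: _]; rewrite map_id.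
Qed.

Lemma shad_loop_lift s H : shad (loop_lift s H).
Proof.
move=> u; rewrite !inE mem_cat !inE => /or3P[/eqP->//|/eqP->//|/orP[/mapP[p _ ->]//|]].
by move=> /or3P[/eqP->//|/eqP->//|/mapP[p _ ->]].
Qed.

Lemma jcl_loop_lift s H u : jcl (loop_lift s H) u ->
  path3 y (w1 :: ws ++ [:: wm; x]) u.1 \/ (path3 x (rcons rest y) u.1 /\ u.1 = u.2).
Proof.
have -> : jcl (loop_lift s H) = gpath (@jlerp R) (dg y)
   ((lift_pair (s * (2 * H)) w1 :: map (lift_pair (s * H)) ws ++ [:: lift_pair (s * H) wm; dg x]) ++
     map dg (rcons rest y)).
  by rewrite /cl /loop_lift map_rcons rcons_cons rcons_cat /= -catA.
rewrite gpath_cat // => -[h|].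
  left; have E : w1 :: ws ++ [:: wm; x] = map fst
      (lift_pair (s * (2 * H)) w1 :: map (lift_pair (s * H)) ws ++ [:: lift_pair (s * H) wm; dg x]).
    by rewrite /= map_cat -map_comp; congr (_ :: _ ++ _); rewrite -[LHS]map_id.
  by rewrite E -(gpath_map (f := @jlerp R) (g := fst) (dg y)) //; exists u.
rewrite /= last_cat /= -(gpath_map (f := @lerp R) (g := dg)) // => -[p hp <-].
by right.
Qed.

(** Over double points other than [q] both strands belong to the unmoved part, since the loop passes
    through [q] only. At [q] the crossing changes exactly when the sign [s] disagrees with the order
    of [m1] and [m2]. *)
Lemma loop_lift_rel s H : (s = 1 \/ s = -1) -> 0 < H ->
  (forall p, p \in [:: y, x & rest] -> 2 * `|p.2| < H) ->
  cross_rel [set r | r = q /\ s * (m1.2 - m2.2) < 0] (loop_lift s H).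
Proof.
move=> hs H0 hH u v cu cv e l.
have [k1 k2 q1 q2 n12] := mid_facts.
have U1 := unzip1_loop_lift s H.
have n1 : u.1 <> v.1 by move=> n; rewrite n ltxx in l.
have ku : kimg P u.1 by rewrite -U1; apply/kimg1P; exists u.
have kv : kimg P v.1 by rewrite -U1; apply/kimg1P; exists v.
have dq := reg_double rP ku kv n1 e.
case: (pselect (proj u.1 = q)) => eq; last first.
  split=> [[]//|_].
  case: (jcl_loop_lift cu) => [h|[_ <-]]; first by case: eq; apply: loop.
  case: (jcl_loop_lift cv) => [h|[_ <- //]]; case: eq; rewrite e; apply: loop => //.
  by rewrite -e.
pose M1 := (m1, lerp y (at_height w1 (s * (2 * H))) (1/2)).
pose M2 := (m2, lerp (at_height wm (s * H)) x (1/2)).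
have i1 : 0 <= (1/2 : R) <= 1 by lra.
have c1 : jcl (loop_lift s H) M1 by left; exists (1/2).
have c2 : jcl (loop_lift s H) M2.
  have -> : jcl (loop_lift s H) = gpath (@jlerp R) (dg y)
   ((lift_pair (s * (2 * H)) w1 :: map (lift_pair (s * H)) ws) ++ lift_pair (s * H) wm ::
     dg x :: map dg (rcons rest y)).
    by rewrite /cl /loop_lift map_rcons /= rcons_cat /=.
  by rewrite gpath_cat //; right; right; left; exists (1/2).
have hMM : 0 < s * (M1.2.2 - M2.2.2).
  have hy : 2 * `|y.2| < H by apply: hH; rewrite inE eqxx.
  have hx : 2 * `|x.2| < H by apply: hH; rewrite !inE eqxx orbT.
  have : - `|y.2| <= y.2 <= `|y.2| by rewrite -ler_norml.
  have : - `|x.2| <= x.2 <= `|x.2| by rewrite -ler_norml.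
  by rewrite /M1 /M2 /=; case: hs => ->; lra.
have pre := preim2 rP k1 k2 n12 (etrans q1 (esym q2)).
have J := jinj1 (L := loop_lift s H); rewrite U1 in J.
have {}J := J _ _ (reg_knot rP).
have : preim P (proj m1) u.1 by split=> //; rewrite q1.
have : preim P (proj m1) v.1 by split=> //; rewrite q1 -e.
rewrite pre => -[] /= hv [] /= hu.
- by rewrite hu hv in n1.
- have eu := J _ _ cu c2 hu; have ev := J _ _ cv c1 hv.
  rewrite eu ev in l *; rewrite /M1 /M2 /= in hMM l *.
  split=> [[_ h]|h]; case: hs h hMM => -> h hMM.
  + lra.
  + lra.
  + lra.
  + by case: h; split=> //; lra.
- have eu := J _ _ cu c1 hu; have ev := J _ _ cv c2 hv.
  rewrite eu ev in l *; rewrite /M1 /M2 /= in hMM l *.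
  split=> [[_ h]|h]; case: hs h hMM => -> h hMM.
  + lra.
  + lra.
  + by case: h; split=> //; lra.
  + lra.
by rewrite hu hv in n1.
Qed.

(** [cone_collapse] leaves the vertices [W] and [Z]. The triangles that remove [Z] and then [W]
    project into the parallelogram of the crossing, which [hull] keeps free of the rest of the
    knot. *)
Lemma loop_remove s H : (s = 1 \/ s = -1) -> 0 < H ->
  (forall p, p \in [:: y, x & rest] -> 2 * `|p.2| < H) ->
  knot_polygon (unzip2 (loop_lift s H)) ->
  knot_equiv (unzip2 (loop_lift s H)) [:: y, x & rest].
Proof.
move=> hs H0 hH; rewrite unzip2_loop_lift.
set W := at_height w1 _; set Z := at_height wm _ => k0.
have ss : s * s = 1 by case: hs => ->; ring.
have lev p : p \in [:: y, x & rest] -> s * p.2 < H.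
  move/hH => h; apply: le_lt_trans (ler_norm _) _; rewrite normrM.
  have -> : `|s| = 1 by case: hs => ->; rewrite ?normrN normr1.
  by have := normr_ge0 p.2; lra.
have lW : s * W.2 = 2 * H by rewrite /W /at_height /= (mulrA s s) ss mul1r.
have lZ : s * Z.2 = H by rewrite /Z /at_height /= mulrA ss mul1r.
have [|||||k1 e1] := @cone_collapse _ s H y W _ Z (x :: rest) _ k0 => //.
- by rewrite lW; lra.
- by apply: lev; rewrite inE eqxx.
- by move=> z; rewrite mem_rcons inE => /orP[/eqP->//|/mapP[p _ ->]]; rewrite ?lZ //= mulrA ss mul1r.
- by move=> z h; apply/ltW/lev; rewrite inE h orbT.
apply: rst_trans e1 _.
have hx : s * x.2 < H by apply: lev; rewrite !inE eqxx orbT.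
have hy : s * y.2 < H by apply: lev; rewrite !inE eqxx.
have hhx : 2 * `|s * x.2| < H.
  rewrite normrM; have -> : `|s| = 1 by case: hs => ->; rewrite ?normrN normr1.
  by rewrite mul1r; apply: hH; rewrite !inE eqxx orbT.
have hhy : 2 * `|s * y.2| < H.
  rewrite normrM; have -> : `|s| = 1 by case: hs => ->; rewrite ?normrN normr1.
  by rewrite mul1r; apply: hH; rewrite !inE eqxx.
have := hhx; have := hhy.
have : - `|s * y.2| <= s * y.2 <= `|s * y.2| by rewrite -ler_norml.
have : - `|s * x.2| <= s * x.2 <= `|s * x.2| by rewrite -ler_norml.
move=> bx bY bhy bhx.
have Hxy : 0 < H + s * y.2 - s * x.2 by lra.
clear bx bY bhy bhx.
have [y1 y2] : y.1.1 = q.1 - a.1 /\ y.1.2 = q.2 - a.2 by case: ey.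
have [w11 w12] : W.1.1 = q.1 + a.1 /\ W.1.2 = q.2 + a.2 by case: ew1.
have [z1 z2] : Z.1.1 = q.1 - b.1 /\ Z.1.2 = q.2 - b.2 by case: ewm.
have [x1 x2] : x.1.1 = q.1 + b.1 /\ x.1.2 = q.2 + b.2 by case: ex.
have [k2 e2] := equiv_catC (s1 := [:: y]) k1.
rewrite /= cats1 /= in k2 e2.
have [||k3 e3] := delta_remove (s := rcons rest y) _ k2; first by rewrite size_rcons.
  move=> p [mu [nu [rh [mu0 nu0 rh0 m1' ep]]]].
  (* In the frame [a], [b] at [q] the coordinates are [mu] and [nu - rh], of total size at most 1,
     as [hull] asks. *)
  have pp : proj p = (q.1 + mu * a.1 + (nu - rh) * b.1, q.2 + mu * a.2 + (nu - rh) * b.2).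
    have me : mu = 1 - nu - rh by lra.
    by rewrite ep; apply: pt2_eq => /=; rewrite ?w11 ?x1 ?z1 ?w12 ?x2 ?z2 me; ring.
  rewrite gpath_rcons // last_rcons => -[hp|[l [l1 el]]].
    right; case: (hull hp _ pp) => // [|py].
      rewrite (ger0_norm mu0); have : `|nu - rh| <= nu + rh by rewrite ler_norml; lra.
      lra.
    move: pp; rewrite py ey.
    have -> : (q.1 - a.1, q.2 - a.2) = (q.1 + (-1) * a.1 + 0 * b.1, q.2 + (-1) * a.2 + 0 * b.2).
      by apply: pt2_eq => /=; ring.
    by move/coord_inj => [h _]; move: mu0; rewrite -h oppr_ge0 ler10.
  have pl : proj p = (q.1 + (2 * l - 1) * a.1 + 0 * b.1, q.2 + (2 * l - 1) * a.2 + 0 * b.2).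
    by rewrite el; apply: pt2_eq => /=; rewrite ?w11 ?y1 ?w12 ?y2; ring.
  have [h1 h2] : mu = 2 * l - 1 /\ nu - rh = 0 by apply: coord_inj; rewrite -pp -pl.
  have lp1 : s * p.2 = mu * (s * W.2) + nu * (s * x.2) + rh * (s * Z.2) by rewrite ep /=; ring.
  have lp2 : s * p.2 = (1 - l) * (s * y.2) + l * (s * W.2) by rewrite el /=; ring.
  have [mu1 [ne re]] : mu = 1 /\ nu = 0 /\ rh = 0.
    by rewrite lW lZ in lp1; rewrite lW in lp2; apply: (apex_weights m1' h1 h2 Hxy); rewrite -lp1 lp2.
  left; move: ep.
  by move=> ->; rewrite mu1 ne re; apply: pt3_eq => /=; ring.
have [k4 e4] : knot_polygon (y :: W :: x :: rest) /\
    knot_equiv (W :: x :: rcons rest y) (y :: W :: x :: rest).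
  by have := equiv_catC (s1 := W :: x :: rest) (s2 := [:: y]); rewrite /= cats1; apply.
have [|k5 e5] := delta_remove rest0 k4.
  move=> p [mu [nu [rh [mu0 nu0 rh0 m1' ep]]]] hp.
  have pp : proj p = (q.1 + (rh - mu) * a.1 + nu * b.1, q.2 + (rh - mu) * a.2 + nu * b.2).
    have me : nu = 1 - mu - rh by lra.
    by rewrite ep; apply: pt2_eq => /=; rewrite ?w11 ?x1 ?y1 ?w12 ?x2 ?y2 me; ring.
  case: (hull hp _ pp) => //; last by left.
    rewrite (ger0_norm nu0); have : `|rh - mu| <= rh + mu by rewrite ler_norml; lra.
    lra.
  by right.
apply: rst_trans e2 _; apply: rst_trans e3 _; exact: rst_trans e4 e5.
Qed.

(** Lifting the loop with either sign gives a polygon that contracts to [[:: y, x & rest]]. For the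
    sign that keeps the crossing, [height_isotopy] joins the lift to [P]; the opposite sign provides
    the flipped polygon. *)
Lemma kink_flip : exists L, [/\ unzip1 L = P, shad L, regular (unzip2 L),
  knot_equiv P (unzip2 L) & cross_rel [set q] L].
Proof.
have [H H0 hH] := max_height [:: y, x & rest].
have [k1 k2 q1 q2 n12] := mid_facts.
have nz : m1.2 - m2.2 != 0.
  rewrite subr_eq0; apply/eqP => h; apply: n12; apply: proj_height => //.
  by rewrite q1 q2.
have [s [hs sm]] : exists s : R, (s = 1 \/ s = -1) /\ 0 < s * (m1.2 - m2.2).
  case: (ltgtP (m1.2 - m2.2) 0) nz => // l _.
    by exists (-1); split; [right | lra].
  by exists 1; split; [left | lra].
have hs' : - s = 1 \/ - s = -1 by case: hs => ->; [right | left; rewrite opprK].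
have X s' (h : s' = 1 \/ s' = -1) := loop_lift_rel h H0 hH.
have RR s' : s' = 1 \/ s' = -1 -> regular (unzip2 (loop_lift s' H)).
  move=> h; apply: reg_transfer; first exact: shad_loop_lift.
    by rewrite unzip1_loop_lift.
  exact: cross_gap (X _ h).
have E s' (h : s' = 1 \/ s' = -1) := loop_remove h H0 hH (reg_knot (RR _ h)).
exists (loop_lift (- s) H); split.
- exact: unzip1_loop_lift.
- exact: shad_loop_lift.
- exact: RR.
- apply: rst_trans _ (rst_sym _ _ _ _ (E _ hs')); apply: rst_trans _ (E _ hs).
  rewrite -{1}(unzip1_loop_lift s H); apply: height_isotopy.
  + exact: shad_loop_lift.
  + by rewrite unzip1_loop_lift.
  move=> u v cu cv e l; have [_ h] := X s hs u v cu cv e l.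
  by split=> [[]|_]; apply: h => -[_]; lra.
move=> u v cu cv e l; have [h1 h2] := X _ hs' u v cu cv e l.
split=> h; first by apply: h1; split=> //; lra.
by apply: h2 => -[].
Qed.

End KinkFlip.

(** * Subdividing and re-rooting *)

Section JointMoves.
Variable R : realType.
Local Notation pt3 := (pt3 R).
Local Notation o3 := ((0, 0, 0) : pt3).
Local Notation o33 := ((o3, o3) : pt3 * pt3).
Implicit Types (p : pt3) (P Q : seq pt3) (u v w : pt3 * pt3)
  (L : seq (pt3 * pt3)).
Local Notation jcl := (cl (@jlerp R)).
Local Notation dg := (fun p : pt3 => (p, p)).

Definition good L : Prop := [/\ shad L, regular (unzip1 L) & regular (unzip2 L)].

(** The vertex lists may change but the joint point set may not, so [cross_rel] carries over from
    one list to the other. *)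
Definition jequiv L L' : Prop := [/\ good L', jcl L' = jcl L,
  knot_equiv (unzip1 L) (unzip1 L') & knot_equiv (unzip2 L) (unzip2 L')].

Lemma jequiv_trans L1 L2 L3 : jequiv L1 L2 -> jequiv L2 L3 -> jequiv L1 L3.
Proof.
move=> [_ e1 k1 k1'] [g e2 k2 k2']; split=> //; first by rewrite e2.
  exact: rst_trans k1 k2.
exact: rst_trans k1' k2'.
Qed.

Lemma jequiv_rot k L : good L -> jequiv L (rot k L).
Proof.
move=> [hL rP rQ]; rewrite /jequiv /good /unzip1 /unzip2 !map_rot; split.
- split; [|exact: reg_rot|exact: reg_rot].
  by move=> u; rewrite mem_rot; apply: hL.
- by rewrite cl_rot.
- exact/equiv_rot/reg_knot.
exact/equiv_rot/reg_knot.
Qed.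

Lemma jequiv_catC L1 L2 : good (L1 ++ L2) -> jequiv (L1 ++ L2) (L2 ++ L1).
Proof. by move=> g; rewrite -(rot_size_cat L1 L2); apply: jequiv_rot. Qed.

Lemma kimg_unzip L L' : jcl L' = jcl L -> kimg (unzip1 L') = kimg (unzip1 L) /\
  kimg (unzip2 L') = kimg (unzip2 L).
Proof. by move=> e; rewrite -!jimg1 -!jimg2 e. Qed.

Lemma jequiv_split L1 u v L2 (t : R) : good (L1 ++ u :: v :: L2) -> 0 < t < 1 ->
  ~ double_pt (unzip1 (L1 ++ u :: v :: L2)) (proj (jlerp u v t).1) ->
  jequiv (L1 ++ u :: v :: L2) (L1 ++ u :: jlerp u v t :: v :: L2).
Proof.
move=> [hL rP rQ] t01 nd; have t01' : 0 <= t <= 1 by lra.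
set L := L1 ++ _ in hL rP rQ nd *; set L' := L1 ++ _.
have eC : jcl L' = jcl L by apply: cl_split.
have [K1 K2] := kimg_unzip eC.
have kP := reg_knot rP; have kQ := reg_knot rQ.
have [kP' eP] : knot_polygon (unzip1 L') /\ knot_equiv (unzip1 L) (unzip1 L').
  move: kP; rewrite /L /L' /unzip1 !map_cat; exact: knot_subdivide.
have [kQ' eQ] : knot_polygon (unzip2 L') /\ knot_equiv (unzip2 L) (unzip2 L').
  move: kQ; rewrite /L /L' /unzip2 !map_cat; exact: knot_subdivide.
have cu : u \in L by rewrite mem_cat inE eqxx orbT.
have cv : v \in L by rewrite mem_cat !inE eqxx !orbT.
have sc : proj (jlerp u v t).1 = proj (jlerp u v t).2 by rewrite !proj_lerp !hL.
have mem z : z \in L' -> z = jlerp u v t \/ z \in L.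
  rewrite /L /L' !mem_cat !inE => /or4P[->|->|/eqP->|/orP[->|->]]; rewrite ?orbT; by [left | right].
have hL' : shad L' by move=> z /mem[->//|]; apply: hL.
split=> //; split=> //.
  apply: (reg_perm rP kP' K1) => z /mapP[w /mem[-> ->|wL ->]] //.
  by apply: (reg_vertex rP); apply: map_f.
apply: (reg_perm rQ kQ' K2) => z /mapP[w /mem wL ->].
rewrite (unzip_double _ hL kP kQ); case: wL => [->|wL]; first by rewrite -sc.
by rewrite -hL //; apply: (reg_vertex rP); apply: map_f.
Qed.

(** Any point off the crossings can serve as base point of both polygons at once. *)
Lemma revertex L u : good L -> jcl L u -> ~ double_pt (unzip1 L) (proj u.1) ->
  exists L', jequiv L (u :: L').
Proof.
move=> gL /(cl_nth1 o33 (jlerp_affine R))[i [t [i1 t1 eu]]] nd.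
have gr := jequiv_rot i gL.
have n2 : (1 < size (rot i L))%N.
  by rewrite size_rot; have [_ /reg_knot[+ _ _] _] := gL; rewrite size_map; lia.
have nr j : (j < size L)%N -> nth o33 (rot i L) j = nth o33 L ((j + i) %% size L)%N.
  move=> j1; rewrite /rot nth_cat size_drop nth_drop.
  case: ltnP => h; first by rewrite modn_small addnC //; lia.
  rewrite nth_take; last by lia.
  have -> : (j + i)%N = (size L + (j - (size L - i)))%N by lia.
  by rewrite modnDl modn_small //; lia.
have r0 := nr 0%N; have r1 := nr 1%N.
rewrite add0n in r0; rewrite add1n in r1.
rewrite -r0 ?(leq_trans _ i1) // -r1 in eu; last by move: n2; rewrite size_rot.
case E : (rot i L) n2 eu gr => [|a [|b s]] // _ /= eu gr.
case: (eqVneq t 0) => t0.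
  have [f0 _ _ _] := jlerp_affine R.
  by exists (b :: s); rewrite eu t0 f0.
have t2 : 0 < t < 1 by case/andP: t1 => h1 h2; rewrite h2 lt_neqAle eq_sym t0 h1.
have [gr' er _ _] := gr.
have D : double_pt (unzip1 (a :: b :: s)) (proj u.1) <-> double_pt (unzip1 L) (proj u.1).
  by rewrite /double_pt /preim (kimg_unzip er).1.
have nd' : ~ double_pt (unzip1 (a :: b :: s)) (proj (jlerp a b t).1) by rewrite -eu D.
have j1 := jequiv_split (L1 := [::]) gr' t2 nd'; rewrite /cat -eu in j1.
exists (b :: s ++ [:: a]).
apply: jequiv_trans gr (jequiv_trans j1 _).
by case: j1 => g _ _ _; have := jequiv_rot 1 g; rewrite rot1_cons -cats1.
Qed.

(** A single polygon is treated as a pair of equal ones, so that results on pairs apply to it. *)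
Lemma good_diag P : regular P -> good (map dg P).
Proof.
have e1 : unzip1 (map dg P) = P by rewrite /unzip1 -map_comp map_id.
have e2 : unzip2 (map dg P) = P by rewrite /unzip2 -map_comp map_id.
by move=> rP; split; rewrite ?e1 ?e2 // => u /mapP[p _ ->].
Qed.

Lemma revertex1 P p : regular P -> kimg P p -> ~ double_pt P (proj p) ->
  exists P', regular (p :: P') /\ kimg (p :: P') = kimg P.
Proof.
move=> rP kp nd.
have e1 : unzip1 (map dg P) = P by rewrite /unzip1 -map_comp map_id.
have c : jcl (map dg P) (p, p).
  rewrite -(cl_map (f := @lerp R) (g := dg)) //; exists p => //.
  by rewrite -kimgE.
have [|L' [[_ g _] e _ _]] := revertex (good_diag rP) c; first by rewrite e1.
exists (unzip1 L'); split=> //.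
by have := (kimg_unzip e).1; rewrite e1.
Qed.

End JointMoves.

(** * Regions of the plane *)

Section Plane.
Variable R : realType.
Local Notation pt2 := (pt2 R).
Local Notation path2 := (gpath (@lerp2 R)).

Definition near2 (e : R) (x y : pt2) : Prop := `|y.1 - x.1| < e /\ `|y.2 - x.2| < e.

Lemma near2W (e e' : R) x y : e <= e' -> near2 e x y -> near2 e' x y.
Proof. by move=> h [h1 h2]; split; apply: lt_le_trans h. Qed.

(** The substitute for compactness along a segment: the supremum of the parameters up to which [S]
    holds cannot be smaller than [T]. *)
Lemma real_ind (S : R -> Prop) (T : R) : 0 <= T -> S 0 ->
  (forall t, 0 <= t < T -> S t -> exists2 e : R, 0 < e & forall s, t <= s < t + e -> S s) ->
  (forall t, 0 < t <= T -> (forall s, 0 <= s < t -> S s) -> S t) ->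
  forall t, 0 <= t <= T -> S t.
Proof.
move=> T0 S0 hop hcl.
pose E := [set t : R | 0 <= t <= T /\ forall s, 0 <= s <= t -> S s].
have E0 : E 0.
  split; first by rewrite lexx.
  by move=> s s0; have -> : s = 0 by lra.
have ubE : ubound E T by move=> t [/andP[]].
have supE : has_sup E by split; [exists 0 | exists T].
set m := sup E.
have m0 : 0 <= m by apply: (ub_le_sup supE.2).
have mT : m <= T by apply: ge_sup => //; exists 0.
have below s : 0 <= s < m -> S s.
  move=> /andP[s0 sm].
  have [|t [_ ht] lt] := sup_adherent (eps := m - s) _ supE; first by rewrite subr_gt0.
  by apply: ht; rewrite s0 ltW // (le_lt_trans _ lt) // opprB addrC subrK.
have Sm : S m.
  case: (eqVneq m 0) => [-> //|mn]; apply: hcl below.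
  by rewrite mT lt_neqAle eq_sym mn m0.
have : T <= m.
  rewrite leNgt; apply/negP => mT'.
  have [|e e0 he] := hop m _ Sm; first by rewrite m0.
  pose t := Num.min (m + e / 2) T.
  have t1 : t <= m + e / 2 by rewrite ge_min lexx.
  have t2 : t <= T by rewrite ge_min lexx orbT.
  have t3 : m < t by rewrite lt_min mT' andbT; lra.
  have : E t.
    split; first by rewrite t2 (le_trans m0 (ltW t3)).
    move=> s /andP[s0 st]; case: (ltP s m) => sm; first by apply: below; rewrite s0.
    by apply: he; lra.
  by move/(ub_le_sup supE.2); rewrite leNgt t3.
move=> Tm t /andP[t0 tT]; case: (ltP t m) => tm; first by apply: below; rewrite t0.
by have -> : t = m by lra.
Qed.

Lemma linear_far (c0 c1 c2 : R) (x : pt2) : c0 + c1 * x.1 + c2 * x.2 < 0 ->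
  exists2 e : R, 0 < e & forall y, near2 e x y -> c0 + c1 * y.1 + c2 * y.2 < 0.
Proof.
move=> h; set g := c0 + _ + _ in h.
have d0 : 0 < `|c1| + `|c2| + 1 by rewrite ltr_wpDl // addr_ge0.
exists (- g / (`|c1| + `|c2| + 1)); first by rewrite divr_gt0 // oppr_gt0.
set e := _ / _; move=> y [h1 h2].
have eE : e * (`|c1| + `|c2| + 1) = - g by rewrite /e divfK // gt_eqF.
have e0 : 0 < e by apply: le_lt_trans h1.
have b (c d : R) : `|d| < e -> c * d <= `|c| * e.
  move=> hd; apply: le_trans (ler_norm _) _; rewrite normrM.
  by apply: ler_wpM2l => //; apply: ltW.
have := b c1 _ h1; have := b c2 _ h2; rewrite /g in eE; nra.
Qed.

Lemma seg2_far (a b x : pt2) : ~ gseg (@lerp2 R) a b x ->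
  exists2 e : R, 0 < e & forall y, near2 e x y -> ~ gseg (@lerp2 R) a b y.
Proof.
move=> nx; pose N := (b.1 - a.1) ^+ 2 + (b.2 - a.2) ^+ 2.
(* [a, b] is cut out by finitely many affine inequalities *)
suff [c0 [c1 [c2 [hx hs]]]] : exists c0 c1 c2 : R, c0 + c1 * x.1 + c2 * x.2 < 0 /\
    forall t, 0 <= t <= 1 -> 0 <= c0 + c1 * (lerp2 a b t).1 + c2 * (lerp2 a b t).2.
  have [e e0 he] := linear_far hx; exists e => // y /he hy [t [t1 yt]].
  by have := hs t t1; rewrite -yt leNgt hy.
have N0 : 0 <= N by rewrite addr_ge0 // sqr_ge0.
case: (eqVneq N 0) => Nz.
  have [b1 b2] : b.1 - a.1 = 0 /\ b.2 - a.2 = 0.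
    by move/eqP: Nz; rewrite paddr_eq0 ?sqr_ge0 // !sqrf_eq0 => /andP[/eqP ? /eqP ?].
  case: (ltgtP x.1 a.1) => x1.
  - exists (- a.1), 1, 0; split; first by lra.
    by move=> t _ /=; rewrite b1 b2; lra.
  - exists a.1, (- 1), 0; split; first by lra.
    by move=> t _ /=; rewrite b1 b2; lra.
  case: (ltgtP x.2 a.2) => x2.
  - exists (- a.2), 0, 1; split; first by lra.
    by move=> t _ /=; rewrite b1 b2; lra.
  - exists a.2, 0, (- 1); split; first by lra.
    by move=> t _ /=; rewrite b1 b2; lra.
  exfalso; apply: nx; have -> : x = a by apply: pt2_eq.
  exact: gsegL (lerp2_affine R) _ _.
have Np : 0 < N by rewrite lt_neqAle eq_sym Nz.
(* [D] tells on which side of the line [x] lies, [E] its position along the line, to be compared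
   with 0 and with the squared length [N]. *)
pose D := (b.1 - a.1) * (x.2 - a.2) - (b.2 - a.2) * (x.1 - a.1).
pose E := (b.1 - a.1) * (x.1 - a.1) + (b.2 - a.2) * (x.2 - a.2).
case: (ltgtP D 0) => D0.
- exists (- (b.1 - a.1) * a.2 + (b.2 - a.2) * a.1), (- (b.2 - a.2)), (b.1 - a.1); split.
    by rewrite /D in D0; lra.
  by move=> t _ /=; nra.
- exists ((b.1 - a.1) * a.2 - (b.2 - a.2) * a.1), (b.2 - a.2), (- (b.1 - a.1)); split.
    by rewrite /D in D0; lra.
  by move=> t _ /=; nra.
case: (ltP E 0) => E0.
  exists (- (b.1 - a.1) * a.1 - (b.2 - a.2) * a.2), (b.1 - a.1), (b.2 - a.2); split.
    by rewrite /E in E0; lra.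
  move=> t /andP[t0 _] /=.
  have -> : forall a1 a2 b1 b2 : R, - (b1 - a1) * a1 - (b2 - a2) * a2 + (b1 - a1) * (a1 + t * (b1 - a1)) +
    (b2 - a2) * (a2 + t * (b2 - a2)) = t * ((b1 - a1) ^+ 2 + (b2 - a2) ^+ 2) by move=> *; ring.
  by rewrite mulr_ge0 // addr_ge0 // sqr_ge0.
case: (ltP N E) => NE.
  exists (N + (b.1 - a.1) * a.1 + (b.2 - a.2) * a.2), (- (b.1 - a.1)), (- (b.2 - a.2)); split.
    by rewrite /E in NE; lra.
  move=> t /andP[_ t1] /=; rewrite /N.
  have -> : forall a1 a2 b1 b2 : R, ((b1 - a1) ^+ 2 + (b2 - a2) ^+ 2) + (b1 - a1) * a1 + (b2 - a2) * a2 +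
      - (b1 - a1) * (a1 + t * (b1 - a1)) +
    - (b2 - a2) * (a2 + t * (b2 - a2)) = (1 - t) * ((b1 - a1) ^+ 2 + (b2 - a2) ^+ 2) by move=> *; ring.
  by rewrite mulr_ge0 ?subr_ge0 // addr_ge0 // sqr_ge0.
exfalso; apply: nx; exists (E / N); split.
  by rewrite divr_ge0 //= ler_pdivrMr // mul1r.
apply: pt2_eq => /=; apply: (mulfI Nz); rewrite mulrDr mulrA (mulrC N (E / N)) divfK //.
  have -> : N * x.1 = N * a.1 + E * (b.1 - a.1) - D * (b.2 - a.2) by rewrite /N /E /D; ring.
  by rewrite D0; ring.
have -> : N * x.2 = N * a.2 + E * (b.2 - a.2) + D * (b.1 - a.1) by rewrite /N /E /D; ring.
by rewrite D0; ring.
Qed.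

Lemma path2_far (a : pt2) s x : ~ path2 a s x ->
  exists2 e : R, 0 < e & forall y, near2 e x y -> ~ path2 a s y.
Proof.
elim: s a => [|b s IH] a nx.
  have [|e e0 he] := @seg2_far a a x.
    move=> [t [_ xt]]; apply: nx; rewrite xt /=; apply: pt2_eq => /=; ring.
  exists e => // y /he hy ya; apply: hy; rewrite ya; exact: gsegL (lerp2_affine R) _ _.
have [|e e0 he] := @seg2_far a b x; first by move=> h; apply: nx; left.
have [|f f0 hf] := IH b; first by move=> h; apply: nx; right.
exists (Num.min e f); first by rewrite lt_min e0.
move=> y hy [h|h].
  by apply: (he y) h; apply: near2W hy; rewrite ge_min lexx.
by apply: (hf y) h; apply: near2W hy; rewrite ge_min lexx orbT.
Qed.

Lemma closure_near (A : set pt2) x : closure A x <->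
  forall e : R, 0 < e -> exists2 y, A y & near2 e x y.
Proof.
split=> [h e e0|h B /nbhs_ballP[e /= e0 he]].
  have /h[y [Ay [b1 b2]]] : nbhs x (ball x e) by apply: nbhsx_ballx.
  by exists y => //; split; rewrite distrC.
have [y Ay [n1 n2]] := h e e0; exists y; split=> //; apply: he.
by split; rewrite /ball /= distrC.
Qed.

Lemma closure_limit (A : set pt2) (a b : pt2) (t : R) : 0 < t ->
  (forall s, 0 <= s < t -> closure A (lerp2 a b s)) -> closure A (lerp2 a b t).
Proof.
move=> t0 h; apply/closure_near => e e0.
pose d := `|b.1 - a.1| + `|b.2 - a.2| + 1.
have d0 : 0 < d by rewrite ltr_wpDl // addr_ge0.
(* [d] bounds the speed of the segment, so stepping back by [r] costs at most half of [e]. *)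
pose r := Num.min t (e / (2 * d)).
have r0 : 0 < r by rewrite lt_min t0 divr_gt0 // mulr_gt0.
have r1 : r <= t by rewrite ge_min lexx.
have r2 : r * (2 * d) <= e by rewrite -ler_pdivlMr ?mulr_gt0 // ge_min lexx orbT.
have /h /closure_near /(_ (e / 2)) : 0 <= t - r < t by lra.
case=> [|y Ay [n1 n2]]; first by lra.
exists y => //.
have B (c v z : R) : `|c| <= d -> `|z - (v + (t - r) * c)| < e / 2 -> `|z - (v + t * c)| < e.
  move=> hc hz; have -> : z - (v + t * c) = (z - (v + (t - r) * c)) + (- (r * c)) by ring.
  apply: le_lt_trans (ler_normD _ _) _; rewrite normrN normrM (gtr0_norm r0).
  have : r * `|c| <= r * d by rewrite ler_pM2l.
  lra.
have [g1 g2] := (normr_ge0 (b.1 - a.1), normr_ge0 (b.2 - a.2)).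
by split; apply: B n1 || apply: B n2; rewrite /d; lra.
Qed.

(** * Components of the complement of a plane set, explored along straight segments *)

Section Region.
Variables (U : set pt2) (q0 : pt2).
Let A := connected_component U q0.

Lemma lerp2_connected (y z : pt2) : connected [set lerp2 y z t | t in [set t : R | 0 <= t <= 1]].
Proof.
apply: connected_continuous_connected; last first.
  apply: continuous_subspaceT => t.
  have h (c d : R) : (fun t : R => c + t * (d - c)) x @[x --> t] --> c + t * (d - c).
    by apply: cvgD; [exact: cvg_cst | apply: cvgMl; exact: cvg_id].
  exact: cvg_pair (h y.1 z.1) (h y.2 z.2).
have -> : [set t : R | 0 <= t <= 1] = `[0, 1]%classic.
  by apply/seteqP; split=> t /=; rewrite in_itv.
exact: segment_connected.
Qed.

Lemma region_sub : A `<=` U.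
Proof. exact: connected_component_sub. Qed.

Lemma region_seg y z : A y -> (forall t, 0 <= t <= 1 -> U (lerp2 y z t)) -> A z.
Proof.
move=> Ay h; rewrite /A (same_connected_component Ay).
have [l0 l1 _ _] := lerp2_affine R.
apply: (connected_component_max _ _ (@lerp2_connected y z)).
- by exists 0; rewrite ?l0 //= lexx ler01.
- by move=> _ [t t1 <-]; apply: h.
by exists 1; rewrite ?l1 //= lexx ler01.
Qed.

(** All points before [z] on the line of sight belong to the region, and [closure_limit] adds the
    end. *)
Lemma region_visible y z : A y -> (forall t, 0 <= t < 1 -> U (lerp2 y z t)) -> closure A z.
Proof.
move=> Ay h; have [l0 l1 lL lR] := lerp2_affine R.
rewrite -[z](l1 y); apply: closure_limit => // s /andP[s0 s1].
apply: subset_closure; apply: region_seg Ay _ => t /andP[t0 t1].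
by rewrite lL; apply: h; nra.
Qed.

End Region.

End Plane.

(** * Local sectors *)

Section Sectors.
Variable R : realType.
Local Notation pt2 := (pt2 R).
Implicit Types (u w eta zeta : pt2).

Definition cr u w : R := u.1 * w.2 - u.2 * w.1.

Definition off_rays u w eta : Prop :=
  (forall t : R, 0 <= t -> eta <> (t * u.1, t * u.2)) /\
  (forall t : R, 0 <= t -> eta <> (t * w.1, t * w.2)).

Lemma off_raysC u w eta : off_rays u w eta -> off_rays w u eta.
Proof. by case. Qed.

Lemma cr_eq0 u eta : (u.1 != 0) || (u.2 != 0) -> cr u eta = 0 ->
  exists k : R, eta = (k * u.1, k * u.2).
Proof.
rewrite /cr; case: u eta => [u1 u2] [v1 v2] /= /orP[n|n] e.
  exists (v1 / u1); apply: pt2_eq => /=; first by field.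
  by apply: (mulfI n); rewrite mulrA mulrCA mulfV // mulr1; lra.
exists (v2 / u2); apply: pt2_eq => /=; last by field.
by apply: (mulfI n); rewrite mulrA mulrCA mulfV // mulr1; lra.
Qed.

(* Around a point with two rays u, w leaving it, the complement of the rays has
   two sectors; both are bounded by both rays.  When u and w are independent,
   the reflex sector is covered by the two half planes D < 0 and E < 0. *)
Lemma sector (e : R) u w (A C : set pt2) : 0 < e ->
  (u.1 != 0) || (u.2 != 0) -> (w.1 != 0) || (w.2 != 0) ->
  (forall c : R, 0 < c -> w <> (c * u.1, c * u.2)) ->
  (forall eta zeta, A eta -> near2 e 0 eta -> near2 e 0 zeta ->
     (forall t, 0 <= t <= 1 -> off_rays u w (lerp2 eta zeta t)) -> A zeta) ->
  (forall eta zeta, A eta -> near2 e 0 eta -> near2 e 0 zeta ->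
     (forall t, 0 <= t < 1 -> off_rays u w (lerp2 eta zeta t)) -> C zeta) ->
  forall eta, A eta -> near2 e 0 eta -> off_rays u w eta ->
  forall r : R, 0 <= r -> near2 e 0 (r * u.1, r * u.2) -> C (r * u.1, r * u.2).
Proof.
move=> e0 un wn nsd H1 H2 eta Aeta neta oeta r r0 nr.
have crl v x y t : cr v (lerp2 x y t) = (1 - t) * cr v x + t * cr v y by rewrite /cr /=; ring.
have crr v x y t : cr (lerp2 x y t) v = (1 - t) * cr x v + t * cr y v by rewrite /cr /=; ring.
have cru t : cr u (t * u.1, t * u.2) = 0 by rewrite /cr /=; ring.
have crw t : cr u (t * w.1, t * w.2) = t * cr u w by rewrite /cr /=; ring.
have cruw t : cr (t * u.1, t * u.2) w = t * cr u w by rewrite /cr /=; ring.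
have crww t : cr (t * w.1, t * w.2) w = 0 by rewrite /cr /=; ring.
(* Dependent rays point in opposite directions, so together they form a line, and each of its two
   sides sees all of it. *)
case: (eqVneq (cr u w) 0) => [d0|dn].
  have [c cE] := cr_eq0 un d0.
  have c0 : c < 0.
    rewrite ltNge; apply/negP => c0; case: (eqVneq c 0) => cz.
      by move: wn; rewrite cE cz /= !mul0r eqxx.
    by apply: (nsd c) => //; rewrite lt_neqAle eq_sym cz.
  case: (eqVneq (cr u eta) 0) => [z0|zn].
    have [k kE] := cr_eq0 un z0; case: oeta => o1 o2; exfalso.
    case: (leP 0 k) => k0; first exact: o1 kE.
    apply: (o2 (k / c)); first by apply: mulr_le0; [exact: ltW | rewrite invr_le0 ltW].
    have cn : c != 0 by rewrite lt_eqF.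
    by rewrite kE cE /=; apply: pt2_eq => /=; rewrite mulrA divfK.
  apply: (H2 eta) => // t /andP[t0 t1].
  have nz : cr u (lerp2 eta (r * u.1, r * u.2) t) != 0.
    by rewrite crl cru mulr0 addr0 mulf_neq0 // gt_eqF // subr_gt0.
  by split=> t' t'0 E; move: nz; rewrite E ?cru ?crw ?d0 ?mulr0 eqxx.
(* The sign [s] normalises the orientation: the convex sector is where both determinants, multiplied
   by [s], are positive. *)
have [s hs] : exists s : R, 0 < s * cr u w.
  case: (ltgtP (cr u w) 0) dn => // d _; first by exists (-1); rewrite mulN1r oppr_gt0.
  by exists 1; rewrite mul1r.
have offD z : s * cr u z < 0 -> off_rays u w z.
  move=> h; split=> t t0 E; move: h; rewrite E ?cru ?crw ?mulr0 ?ltxx //.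
  by rewrite mulrCA ltNge mulr_ge0 // ltW.
have offE z : s * cr z w < 0 -> off_rays u w z.
  move=> h; split=> t t0 E; move: h; rewrite E ?cruw ?crww ?mulr0 ?ltxx //.
  by rewrite mulrCA ltNge mulr_ge0 // ltW.
have offDE z : 0 < s * cr u z -> 0 < s * cr z w -> off_rays u w z.
  move=> h1 h2; split=> t t0 E; first by move: h1; rewrite E cru mulr0 ltxx.
  by move: h2; rewrite E crww mulr0 ltxx.
have D_case z : A z -> near2 e 0 z -> s * cr u z < 0 -> C (r * u.1, r * u.2).
  move=> Az nz h; apply: (H2 z) => // t /andP[t0 t1]; apply: offD.
  by rewrite crl cru mulr0 addr0 mulrCA pmulr_rlt0 // subr_gt0.
case: (ltP (s * cr u eta) 0) => D0; first exact: D_case D0.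
case: (ltP (s * cr eta w) 0) => E0.
  (* [z] points away from the convex sector and lies in both half planes, so it leads from one half
     plane of the reflex sector to the other; the factor [d] makes it fit the box. *)
  pose K := `|u.1 + w.1| + `|u.2 + w.2| + 1.
  have K0 : 0 < K by rewrite ltr_wpDl // addr_ge0.
  pose d := e / K.
  have d0 : 0 < d by rewrite divr_gt0.
  have dK : d * K = e by rewrite /d divfK // gt_eqF.
  pose z : pt2 := (- d * (u.1 + w.1), - d * (u.2 + w.2)).
  have nz : near2 e 0 z.
    by split; rewrite /= subr0 normrM normrN (gtr0_norm d0) -dK ltr_pM2l // /K;
      have := normr_ge0 (u.1 + w.1); have := normr_ge0 (u.2 + w.2); lra.
  have Dz : s * cr u z < 0.
    have -> : s * cr u z = - (d * (s * cr u w)) by rewrite /cr /=; ring.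
    by rewrite oppr_lt0 mulr_gt0.
  have Ez : s * cr z w < 0.
    have -> : s * cr z w = - (d * (s * cr u w)) by rewrite /cr /=; ring.
    by rewrite oppr_lt0 mulr_gt0.
  apply: (D_case z) => //; apply: (H1 eta) => // t t1; apply: offE.
  rewrite crr mulrDr !(mulrCA s); case/andP: t1 => t0 t1.
  have h2 : t * (s * cr z w) <= 0 by rewrite mulr_ge0_le0 // ltW.
  case: (ltP t 1) => t2; last by have -> : t = 1 by [lra]; rewrite subrr mul0r add0r mul1r.
  have h1 : (1 - t) * (s * cr eta w) < 0 by rewrite pmulr_rlt0 // subr_gt0.
  by rewrite -[ltRHS]addr0 ltr_leD.
case: oeta => o1 o2.
have D1 : 0 < s * cr u eta.
  rewrite lt_neqAle D0 andbT eq_sym; apply/eqP => /eqP; rewrite mulf_eq0 => /orP[/eqP sz|/eqP z0].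
    by rewrite sz mul0r ltxx in hs.
  have [k kE] := cr_eq0 un z0; apply: (o1 k) => //.
  by move: E0; rewrite kE cruw mulrCA pmulr_lge0.
have E1 : 0 < s * cr eta w.
  rewrite lt_neqAle E0 andbT eq_sym; apply/eqP => /eqP; rewrite mulf_eq0 => /orP[/eqP sz|/eqP z0].
    by rewrite sz mul0r ltxx in hs.
  have z0' : cr w eta = 0 by rewrite /cr -[RHS]oppr0 -z0 /cr; ring.
  have [k kE] := cr_eq0 wn z0'; apply: (o2 k) => //.
  by move: D0; rewrite kE crw mulrCA pmulr_lge0.
apply: (H2 eta) => // t /andP[t0 t1]; apply: offDE.
  by rewrite crl cru mulr0 addr0 mulrCA mulr_gt0 // subr_gt0.
rewrite crr cruw mulrDr !(mulrCA s) ltr_pwDl //; first by rewrite mulr_gt0 // subr_gt0.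
by rewrite mulr_ge0 // mulr_ge0 // ltW.
Qed.

End Sectors.

(** * Regions along the projection *)

Section Regions.
Variable R : realType.
Local Notation pt3 := (pt3 R).
Local Notation pt2 := (pt2 R).
Implicit Types (a b c d p : pt3) (P Q : seq pt3).
Local Notation path3 := (gpath (@lerp R)).
Local Notation path2 := (gpath (@lerp2 R)).

Lemma spath_last b s a : spath b (rcons s a) -> ~ path3 b s a.
Proof.
elim: s b => [|c s IH] b /= [ba h1 h2]; first exact/nesym.
case=> [h|]; last exact: IH.
have ac : a = c.
  by apply: h1 => //; have := gpath_last (@lerp R) c (rcons s a); rewrite last_rcons.
by apply: (IH c h2); rewrite ac; apply: gpath_head.
Qed.

Definition region_of P (q0 : pt2) : set pt2 := connected_component (~` pimg P) q0.

Lemma region_of_kimg P Q q0 : kimg P = kimg Q -> region_of P q0 = region_of Q q0.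
Proof. by move=> e; rewrite /region_of /pimg e. Qed.

(** A point of a ray this close to its origin comes before the far end of the edge, so it belongs to
    the projection. *)
Lemma norm_maxP (x y t e : R) : (x != 0) || (y != 0) -> 0 <= t ->
  e <= `|x| + `|y| -> `|t * x| < e / 2 -> `|t * y| < e / 2 -> t < 1.
Proof.
move=> n t0 h; rewrite !normrM (ger0_norm t0) => h1 h2.
rewrite ltNge; apply/negP => t1.
have [x0 y0] := (normr_ge0 x, normr_ge0 y).
nra.
Qed.

(** Near a vertex that is no crossing the projection consists of two rays, towards [b] and towards
    the last vertex [l]. [sector], used for each ray, shows that a region touching [a] touches
    both. *)
Lemma spread_head a b s q0 : regular (a :: b :: s) ->
  closure (region_of (a :: b :: s) q0) (proj a) ->
  exists2 e : R, 0 < e & forall p, kimg (a :: b :: s) p -> near2 e (proj a) (proj p) ->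
    closure (region_of (a :: b :: s) q0) (proj p).
Proof.
move=> rP cA; set P := a :: b :: s in rP cA *; set A := region_of P q0 in cA *.
have kP := reg_knot rP; have [s0 ab sp hab] := (knot_polygon_cons _ _ _).1 kP.
set l := last b s.
have kE p : kimg P p <-> [\/ seg a b p, path3 b s p | seg l a p].
  rewrite kimg_cons2 gpath_rcons //; split.
    by case=> [|[]]; [apply: Or31 | apply: Or32 | apply: Or33].
  by case; [left | right; left | right; right].
have [s' Es] : exists s', s = rcons s' l.
  by rewrite /l; case: (lastP s) s0 => // s1 z _; exists s1; rewrite last_rcons.
have rP' : regular (l :: a :: b :: s').
  by have := reg_rot (size (a :: b :: s')) rP; rewrite /P {1}Es -cats1 -!cat_cons rot_size_cat.
have la : l <> a by have := reg_knot rP' => /knot_polygon_cons[].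
have kl : kimg (l :: a :: b :: s') = kimg P.
  by rewrite !kimgE /P Es -cats1 -!cat_cons (cl_catC _ (a :: b :: s')).
have pab : proj a <> proj b by apply: (reg_edge rP ab) => p hp; apply/kE/Or31.
have pla : proj l <> proj a by apply: (reg_edge rP la) => p hp; apply/kE/Or33.
have nd : ~ double_pt P (proj a) by apply: (reg_vertex rP); rewrite inE eqxx.
have npath : ~ path2 (proj b) (map (@proj R) s) (proj a).
  rewrite -(gpath_map (f := @lerp R)) // => -[p hp e].
  have kp : kimg P p by apply/kE/Or32.
  have ka : kimg P a by apply/kE/Or31/segL.
  apply: nd; rewrite -e; apply: (reg_double rP kp ka) => // pa.
  by apply: (spath_last sp); rewrite -pa.
have [e1 e10 he1] := path2_far npath.
pose u : pt2 := ((proj b).1 - (proj a).1, (proj b).2 - (proj a).2).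
pose w : pt2 := ((proj l).1 - (proj a).1, (proj l).2 - (proj a).2).
have un : (u.1 != 0) || (u.2 != 0).
  rewrite -negb_and; apply/negP => /andP[/eqP h1 /eqP h2]; apply: pab.
  by apply: pt2_eq; move: h1 h2; rewrite /u; cbn [fst snd]; lra.
have wn : (w.1 != 0) || (w.2 != 0).
  rewrite -negb_and; apply/negP => /andP[/eqP h1 /eqP h2]; apply: pla.
  by apply: pt2_eq; move: h1 h2; rewrite /w; cbn [fst snd]; lra.
have eab t : proj (lerp a b t) = ((proj a).1 + t * u.1, (proj a).2 + t * u.2) by [].
have ela t : proj (lerp l a t) = ((proj a).1 + (1 - t) * w.1, (proj a).2 + (1 - t) * w.2).
  by rewrite proj_lerp; apply: pt2_eq => /=; ring.
(* Rays in the same direction would make two adjacent edges overlap in projection, against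
   [reg_adjacent]. *)
have nsd (c : R) : 0 < c -> w <> (c * u.1, c * u.2).
  move=> c0 wE; have c1 : 0 < 1 + c by lra.
  have [|||_] := reg_adjacent (p := lerp l a (1 - (1 + c)^-1)) (p' := lerp a b (c / (1 + c))) rP' erefl.
  - exists (1 - (1 + c)^-1); split=> //; rewrite subr_ge0 lerBlDr lerDl invr_ge0 (ltW c1) andbT.
    by rewrite invf_le1 //; lra.
  - exists (c / (1 + c)); split=> //; rewrite divr_ge0 ?(ltW c0) ?(ltW c1) //= ler_pdivrMr // mul1r; lra.
  - by rewrite ela eab wE /=; apply: pt2_eq => /=; field; rewrite gt_eqF.
  rewrite -[RHS](lerp0 a b) => /(lerp_inj ab)/eqP.
  by rewrite mulf_eq0 invr_eq0 !gt_eqF.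
pose M := Num.min (`|u.1| + `|u.2|) (`|w.1| + `|w.2|).
have M0 : 0 < M.
  have sp2 (x y : R) : (x != 0) || (y != 0) -> 0 < `|x| + `|y|.
    move=> n; rewrite lt_neqAle addr_ge0 // andbT eq_sym paddr_eq0 // !normr_eq0 negb_and //.
  by rewrite lt_min !sp2.
(* Small enough to avoid all other edges and to stay short of the far ends of the two edges at
   [a]. *)
pose e := Num.min e1 (M / 2).
have e0 : 0 < e by rewrite lt_min e10 divr_gt0.
have ee1 : e <= e1 by rewrite ge_min lexx.
have eM : e <= M / 2 by rewrite ge_min lexx orbT.
have Mu : M <= `|u.1| + `|u.2| by rewrite ge_min lexx.
have Mw : M <= `|w.1| + `|w.2| by rewrite ge_min lexx orbT.
pose sh (z : pt2) : pt2 := ((proj a).1 + z.1, (proj a).2 + z.2).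
have shl z z' t : lerp2 (sh z) (sh z') t = sh (lerp2 z z' t) by apply: pt2_eq => /=; ring.
have nsh z : near2 e 0 z <-> near2 e (proj a) (sh z).
  by rewrite /near2 /sh /= !subr0 (addrC (proj a).1) (addrC (proj a).2) !addrK.
have offU z : near2 e 0 z -> off_rays u w z -> (~` pimg P) (sh z).
  move=> nz [fu fw] [p /kE kp pz]; case: kp.
  - move=> [t [t1 pt]]; apply: (fu t); first by lra.
    move: pz; rewrite pt eab => -[h1 h2]; apply: pt2_eq => /=.
      exact: (addrI _ (esym h1)).
    exact: (addrI _ (esym h2)).
  - move=> hp; apply: (he1 (sh z)); first by apply: near2W ee1 _; apply/nsh.
    by rewrite -(gpath_map (f := @lerp R)) //; exists p.
  move=> [t [t1 pt]]; apply: (fw (1 - t)); first by lra.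
  move: pz; rewrite pt ela => -[h1 h2]; apply: pt2_eq => /=.
    exact: (addrI _ (esym h1)).
  exact: (addrI _ (esym h2)).
have nconv z z' t : near2 e 0 z -> near2 e 0 z' -> 0 <= t <= 1 -> near2 e 0 (lerp2 z z' t).
  rewrite /near2 /= !subr0 => -[a1 a2] [b1 b2] t1.
  have cv (x x' : R) : `|x| < e -> `|x'| < e -> `|x + t * (x' - x)| < e.
    move=> h1 h2; have -> : x + t * (x' - x) = (1 - t) * x + t * x' by ring.
    apply: (@le_lt_trans _ _ (Num.max `|x| `|x'|)); last by rewrite gt_max h1 h2.
    by apply: convex_norm => //; rewrite le_max lexx ?orbT.
  by split; apply: cv.
pose AA : set pt2 := fun z => A (sh z).
pose CC : set pt2 := fun z => closure A (sh z).
have H1 z z' : AA z -> near2 e 0 z -> near2 e 0 z' ->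
     (forall t, 0 <= t <= 1 -> off_rays u w (lerp2 z z' t)) -> AA z'.
  move=> Az nz nz' h; apply: (region_seg Az) => t t1; rewrite shl.
  by apply: offU; [apply: nconv | apply: h].
have H2 z z' : AA z -> near2 e 0 z -> near2 e 0 z' ->
     (forall t, 0 <= t < 1 -> off_rays u w (lerp2 z z' t)) -> CC z'.
  move=> Az nz nz' h; apply: (region_visible Az) => t t1; rewrite shl.
  by apply: offU; [apply: nconv => //; lra | apply: h].
have [y Ay ny] := (closure_near _ _).1 cA e e0.
pose eta : pt2 := (y.1 - (proj a).1, y.2 - (proj a).2).
have she : sh eta = y by apply: pt2_eq => /=; ring.
have Ae : AA eta by rewrite /AA she.
have ne : near2 e 0 eta by apply/nsh; rewrite she.
have oe : off_rays u w eta.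
  have ynp : ~ pimg P y by have := region_sub Ay.
  have eM' : e <= M / 2 := eM.
  have [n1 n2] : `|eta.1| < e /\ `|eta.2| < e by move: ne; rewrite /near2 /= !subr0.
  split=> t t0 E; apply: ynp; rewrite -she E.
    have t1 : t < 1.
      by apply: (norm_maxP un t0 Mu); apply: (lt_le_trans _ eM); [move: n1|move: n2]; rewrite E.
    by exists (lerp a b t) => //; apply/kE/Or31; exists t; split=> //; lra.
  have t1 : t < 1.
    by apply: (norm_maxP wn t0 Mw); apply: (lt_le_trans _ eM); [move: n1|move: n2]; rewrite E.
  exists (lerp l a (1 - t)); first by apply/kE/Or33; exists (1 - t); split=> //; lra.
  by rewrite ela; apply: pt2_eq => /=; ring.
exists e => // p /kE kp np; case: kp.
- move=> [t [t1 pt]].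
  have t0 : 0 <= t by lra.
  have -> : proj p = sh (t * u.1, t * u.2) by rewrite pt eab.
  apply: (sector e0 un wn nsd H1 H2 Ae ne oe t0).
  by apply/nsh; move: np; rewrite pt eab.
- move=> hp; exfalso; apply: (he1 (proj p)); first exact: near2W ee1 np.
  by rewrite -(gpath_map (f := @lerp R)) //; exists p.
move=> [t [t1 pt]].
have t0 : 0 <= 1 - t by lra.
have -> : proj p = sh ((1 - t) * w.1, (1 - t) * w.2) by rewrite pt ela.
have nsd' (c : R) : 0 < c -> u <> (c * w.1, c * w.2).
  move=> c0 uE; apply: (nsd c^-1); first by rewrite invr_gt0.
  have cn : c != 0 by rewrite gt_eqF.
  by rewrite uE /= !mulKf // -surjective_pairing.
apply: (@sector R e w u AA CC e0 wn un nsd' _ _ eta Ae ne (off_raysC oe) _ t0).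
- by move=> z z' h1 h2 h3 h4; apply: (H1 z) => // r r1; apply/off_raysC/h4.
- by move=> z z' h1 h2 h3 h4; apply: (H2 z) => // r r1; apply/off_raysC/h4.
by apply/nsh; move: np; rewrite pt ela.
Qed.

(** A point that is no crossing becomes the first vertex after re-rooting, which leaves the regions
    unchanged. *)
Lemma closure_spread P p q0 : regular P -> kimg P p -> ~ double_pt P (proj p) ->
  closure (region_of P q0) (proj p) ->
  exists2 e : R, 0 < e & forall p', kimg P p' -> near2 e (proj p) (proj p') ->
    closure (region_of P q0) (proj p').
Proof.
move=> rP kp nd; have [P' [rP' kE]] := revertex1 rP kp nd.
rewrite -(region_of_kimg q0 kE) -kE.
by case: P' rP' {kE} => [/reg_knot[]//|b s] rP'; apply: spread_head.
Qed.

End Regions.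

(** * Walking along the boundary of a region *)

Section Walk.
Variable R : realType.
Local Notation pt3 := (pt3 R).
Local Notation pt2 := (pt2 R).
Implicit Types (a b c d p : pt3) (P Q : seq pt3).
Local Notation path3 := (gpath (@lerp R)).

(** Real induction: [closure_spread] gives the step to the right, [closure_limit] the limit. The end
    [T] itself may be a crossing. *)
Lemma walk_seg P c d q0 (T : R) : regular P -> seg c d `<=` kimg P -> 0 <= T <= 1 ->
  closure (region_of P q0) (proj c) ->
  (forall t, 0 <= t < T -> ~ double_pt P (proj (lerp c d t))) ->
  forall t, 0 <= t <= T -> closure (region_of P q0) (proj (lerp c d t)).
Proof.
move=> rP sk /andP[T0 T1] cc nd; apply: real_ind => //.
- by rewrite lerp0.
- move=> t /andP[t0 tT] ct.
  have kt : kimg P (lerp c d t) by apply: sk; exists t; split=> //; lra.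
  have [e e0 he] := closure_spread rP kt (nd t (introT andP (conj t0 tT))) ct.
  pose K := `|d.1.1 - c.1.1| + `|d.1.2 - c.1.2| + 1.
  have K0 : 0 < K by rewrite ltr_wpDl // addr_ge0.
  have f0 : 0 < Num.min (1 - t) (e / K) by rewrite lt_min divr_gt0 // andbT; lra.
  exists (Num.min (1 - t) (e / K)) => // s /andP[ts se].
  have s1 : s < t + (1 - t) by apply: lt_le_trans se _; rewrite lerD2l ge_min lexx.
  have s2 : s < t + e / K by apply: lt_le_trans se _; rewrite lerD2l ge_min lexx orbT.
  apply: he; first by apply: sk; exists s; split=> //; lra.
  have hK : (s - t) * K < e by rewrite -ltr_pdivlMr //; lra.
  have B (x y : R) : `|y - x| <= K -> `|x + s * (y - x) - (x + t * (y - x))| < e.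
    move=> h; have -> : x + s * (y - x) - (x + t * (y - x)) = (s - t) * (y - x) by ring.
    rewrite normrM ger0_norm; last by lra.
    by apply: le_lt_trans hK; apply: ler_wpM2l => //; lra.
  have [n1 n2] := (normr_ge0 (d.1.1 - c.1.1), normr_ge0 (d.1.2 - c.1.2)).
  by split; apply: B; rewrite /K; lra.
move=> t /andP[t0 _] h; rewrite proj_lerp; by apply: closure_limit.
Qed.

Lemma first_double (s : seq pt2) (x y : pt2) : x <> y ->
  (forall t : R, 0 <= t <= 1 -> lerp2 x y t \notin s) \/
  exists t : R, [/\ 0 <= t <= 1, lerp2 x y t \in s &
    forall r, 0 <= r < t -> lerp2 x y r \notin s].
Proof.
move=> xy; elim: s => [|q s IH]; first by left.
case: (pselect (exists2 t0 : R, 0 <= t0 <= 1 & lerp2 x y t0 = q)) => [[t0 t01 e0]|n]; last first.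
  have nq (t : R) : 0 <= t <= 1 -> lerp2 x y t == q = false.
    by move=> t1; apply/negP => /eqP e; apply: n; exists t.
  case: IH => [h|[t [t1 ht hm]]]; [left|right].
    by move=> t t1; rewrite inE nq //= h.
  exists t; split=> //; first by rewrite inE ht orbT.
  by move=> r r1; rewrite inE nq ?hm //; lra.
right; case: IH => [h|[t [t1 ht hm]]].
  exists t0; split=> //; first by rewrite inE e0 eqxx.
  move=> r r1; rewrite inE negb_or h ?andbT; last by lra.
  by apply/eqP; rewrite -e0 => /(lerp2_inj xy); lra.
case: (ltP t0 t) => lt.
  exists t0; split=> //; first by rewrite inE e0 eqxx.
  move=> r r1; rewrite inE negb_or hm ?andbT; last by lra.
  by apply/eqP; rewrite -e0 => /(lerp2_inj xy); lra.
exists t; split=> //; first by rewrite inE ht orbT.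
move=> r r1; rewrite inE negb_or hm ?andbT //.
by apply/eqP; rewrite -e0 => /(lerp2_inj xy); lra.
Qed.

Lemma seg_first_double P c d : regular P -> c <> d -> seg c d `<=` kimg P ->
  ~ double_pt P (proj c) -> ~ double_pt P (proj d) ->
  (forall t, 0 <= t <= 1 -> ~ double_pt P (proj (lerp c d t))) \/
  exists t, [/\ 0 < t < 1, double_pt P (proj (lerp c d t)) &
    forall r, 0 <= r < t -> ~ double_pt P (proj (lerp c d r))].
Proof.
move=> rP cd sk nc nd; have [_ _ [s hs] _] := rP.
case: (first_double s (reg_edge rP cd sk)) => [h|[t [t1 ht hm]]]; [left|right].
  by move=> t t1 /hs; rewrite proj_lerp; apply/negP/h.
have dt : double_pt P (proj (lerp c d t)) by apply/hs; rewrite proj_lerp.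
exists t; split=> //.
  case: (eqVneq t 0) => t0; first by case: nc; move: dt; rewrite t0 lerp0.
  case: (eqVneq t 1) => t2; first by case: nd; move: dt; rewrite t2 lerp1.
  by case/andP: t1 => t3 t4; rewrite !lt_neqAle t4 t3 t2 eq_sym t0.
by move=> r r1 /hs; rewrite proj_lerp; apply/negP/hm.
Qed.

(** * First crossings met by a walk along the knot from the boundary of a region *)

Section Hits.
Variables (P : seq pt3) (q0 : pt2).
Hypothesis rP : regular P.
Local Notation A := (region_of P q0).
Local Notation dbl p := (double_pt P (proj p)).

Fixpoint nondeg c (l : seq pt3) {struct l} : Prop :=
  if l is b :: l' then c <> b /\ nondeg b l' else True.

Lemma nondeg_cat c l1 l2 : nondeg c (l1 ++ l2) -> nondeg (last c l1) l2.
Proof. by elim: l1 c => //= b l1 IH c [_ /IH]. Qed.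

(** The crossing at which the walk stops is still in the closure of the region, which identifies it
    when the region has a single crossing. *)
Lemma first_hit c l : path3 c l `<=` kimg P -> nondeg c l ->
  (forall z, z \in c :: l -> ~ dbl z) -> closure A (proj c) ->
  (forall p, path3 c l p -> ~ dbl p) \/
  exists l1 b l2 t, [/\ l = l1 ++ b :: l2, 0 < t < 1, dbl (lerp (last c l1) b t),
    closure A (proj (lerp (last c l1) b t)) &
    (forall p, path3 c l1 p -> ~ dbl p) /\
    forall r, 0 <= r < t -> ~ dbl (lerp (last c l1) b r)].
Proof.
elim: l c => [|b l IH] c hk nc hv cA.
  by left=> p ->; apply: hv; rewrite inE.
have nvc : ~ dbl c by apply: hv; rewrite inE eqxx.
have nvb : ~ dbl b by apply: hv; rewrite !inE eqxx orbT.
have sk : seg c b `<=` kimg P by move=> p h; apply: hk; left.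
case: (seg_first_double rP nc.1 sk nvc nvb) => [h|[t [t1 dt ht]]]; last first.
  right; exists [::], b, l, t; split=> //=.
    by apply: (walk_seg (T := t) rP sk); rewrite ?lexx ?andbT //; lra.
  by split=> // p ->.
have cb : closure A (proj b).
  rewrite -(lerp1 c b); apply: (walk_seg (T := 1) rP sk) => //; last by rewrite ler01 lexx.
    by rewrite ler01 lexx.
  by move=> t t1; apply: h; lra.
have hseg p : seg c b p -> ~ dbl p by move=> [t [t1 ->]]; apply: h.
have hk' : path3 b l `<=` kimg P by move=> p hp; apply: hk; right.
have hv' z : z \in b :: l -> ~ dbl z by move=> zl; apply: hv; rewrite inE zl orbT.
have [hh|[l1 [b' [l2 [t [-> t1 dt ct [h1 h2]]]]]]] := IH b hk' nc.2 hv' cb.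
  by left=> p [/hseg|/hh].
right; exists (b :: l1), b', l2, t; split=> //.
by split=> // p [/hseg|/h1].
Qed.

(** The walk runs backwards along the list, so each edge is parametrised from its end and [t]
    becomes [1 - t]. *)
Lemma last_hit c l : path3 c l `<=` kimg P -> nondeg c l ->
  (forall z, z \in c :: l -> ~ dbl z) -> closure A (proj (last c l)) ->
  ((forall p, path3 c l p -> ~ dbl p) /\ closure A (proj c)) \/
  exists l1 b l2 t, [/\ l = l1 ++ b :: l2, 0 < t < 1, dbl (lerp (last c l1) b t),
    closure A (proj (lerp (last c l1) b t)) &
    (forall p, path3 b l2 p -> ~ dbl p) /\
    forall r, t < r <= 1 -> ~ dbl (lerp (last c l1) b r)].
Proof.
elim: l c => [|b l IH] c hk nc hv cA.
  by left; split=> // p ->; apply: hv; rewrite inE.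
have nvc : ~ dbl c by apply: hv; rewrite inE eqxx.
have nvb : ~ dbl b by apply: hv; rewrite !inE eqxx orbT.
have sk : seg b c `<=` kimg P by move=> p; rewrite segC => h; apply: hk; left.
have hk' : path3 b l `<=` kimg P by move=> p hp; apply: hk; right.
have hv' z : z \in b :: l -> ~ dbl z by move=> zl; apply: hv; rewrite inE zl orbT.
have [[hh cb]|[l1 [b' [l2 [t [-> t1 dt ct [h1 h2]]]]]]] := IH b hk' nc.2 hv' cA.
- case: (seg_first_double rP (nesym nc.1) sk nvb nvc) => [h|[t [t1 dt ht]]].
    left; split.
      have hseg p : seg c b p -> ~ dbl p by rewrite segC => -[t [t1 ->]]; apply: h.
      by move=> p [/hseg|/hh].
    rewrite -(lerp1 b c); apply: (walk_seg (T := 1) rP sk) => //; last by rewrite ler01 lexx.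
      by rewrite ler01 lexx.
    by move=> t t1; apply: h; lra.
  right; exists [::], b, l, (1 - t); rewrite /= lerpC subKr; split=> //.
  + by lra.
  + by apply: (walk_seg (T := t) rP sk); rewrite ?lexx ?andbT //; lra.
  by split=> // r r1; rewrite lerpC; apply: ht; lra.
by right; exists (b :: l1), b', l2, t.
Qed.

(** Without a first hit, real induction in the open complement would carry the segment up to [z],
    which lies on the projection. *)
Lemma region_exit (y z : pt2) : A y -> pimg P z ->
  exists t : R, [/\ 0 < t <= 1, pimg P (lerp2 y z t) & closure A (lerp2 y z t)].
Proof.
move=> Ay Pz; have [l0 l1 lL lR] := lerp2_affine R.
have pE : pimg P = gpath (@lerp2 R) (proj (head (0, 0, 0) P)) (rcons (map (@proj R) (behead P)) (proj (head (0, 0, 0) P))).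
  by rewrite pimgE; have := reg_knot rP; case: (P) => // -[].
case: (pselect (exists2 t : R, 0 <= t <= 1 & pimg P (lerp2 y z t) /\
    forall r, 0 <= r < t -> ~ pimg P (lerp2 y z r))) => [[t t1 [pt ht]]|n].
  have t0 : 0 < t.
    rewrite lt_neqAle eq_sym; case/andP: t1 => -> _; rewrite andbT; apply/eqP => t0.
    by move: pt; rewrite t0 l0; apply: (region_sub Ay).
  exists t; split=> //; first by lra.
  by apply: (region_visible Ay) => r r1; rewrite lL; apply: ht; nra.
exfalso; suff h : forall t : R, 0 <= t <= 1 -> forall r, 0 <= r <= t -> ~ pimg P (lerp2 y z r).
  by apply: (h 1 _ 1); rewrite ?l1 ?lexx ?ler01.
apply: real_ind => //.
- move=> r r0; have -> : r = 0 by lra.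
  by rewrite l0; apply: (region_sub Ay).
- move=> t t1 h; have nt : ~ pimg P (lerp2 y z t) by apply: h; lra.
  rewrite pE in nt; have [e e0 he] := path2_far nt.
  pose K := `|z.1 - y.1| + `|z.2 - y.2| + 1.
  have K0 : 0 < K by rewrite ltr_wpDl // addr_ge0.
  exists (e / K); first exact: divr_gt0.
  move=> s /andP[ts se] r /andP[r0 rs]; case: (leP r t) => rt; first by apply: h; lra.
  rewrite pE; apply: he.
  have hK : (r - t) * K < e by rewrite -ltr_pdivlMr //; lra.
  have B (x y' : R) : `|y' - x| <= K -> `|x + r * (y' - x) - (x + t * (y' - x))| < e.
    move=> hh; have -> : x + r * (y' - x) - (x + t * (y' - x)) = (r - t) * (y' - x) by ring.
    rewrite normrM ger0_norm; last by lra.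
    by apply: le_lt_trans hK; apply: ler_wpM2l => //; lra.
  have [n1 n2] := (normr_ge0 (z.1 - y.1), normr_ge0 (z.2 - y.2)).
  by split; apply: B; rewrite /K; lra.
move=> t t1 h r /andP[r0 rt].
have hb s : 0 <= s < t -> ~ pimg P (lerp2 y z s).
  move=> s1; apply: (h ((s + t) / 2)); lra.
case: (ltP r t) => rt'; first by apply: hb; rewrite r0.
have -> : r = t by lra.
by move=> pt; apply: n; exists t; [lra | split].
Qed.

(** A single boundary point could be the crossing itself, so two are produced: the first hits on the
    way to two vertices, seen from a point off the line through them. *)
Lemma region_two_exits : ~ pimg P q0 -> exists p1 p2, [/\ kimg P p1, kimg P p2,
  proj p1 <> proj p2, closure A (proj p1) & closure A (proj p2)].
Proof.
move=> nq; have Aq : A q0 by apply: connected_component_refl.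
have kP := reg_knot rP.
have [v0 [v1 [s EP]]] : exists v0 v1 s, P = v0 :: v1 :: s.
  by case: kP => n3 _ _; case: (P) n3 => [|v0 [|v1 s]] // _; exists v0, v1, s.
have /knot_polygon_cons[_ v01 _ _] : knot_polygon (v0 :: v1 :: s) by rewrite -EP.
have k0 : seg v0 v1 `<=` kimg P by rewrite EP kimg_cons2 => p; left.
have pv := reg_edge rP v01 k0.
have [i0 i1] : pimg P (proj v0) /\ pimg P (proj v1).
  by split; [exists v0 => //; apply: k0; apply: segL | exists v1 => //; apply: k0; apply: segR].
pose C (x : pt2) := ((proj v1).1 - (proj v0).1) * (x.2 - (proj v0).2) -
  ((proj v1).2 - (proj v0).2) * (x.1 - (proj v0).1).
(* If [q0] lies on that line, a small step along the normal leaves the line but not the region. *)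
have [a Aa Ca] : exists2 a : pt2, A a & C a != 0.
  case: (eqVneq (C q0) 0) => C0; last by exists q0.
  have pE : pimg P = gpath (@lerp2 R) (proj v0) (rcons (map (@proj R) (v1 :: s)) (proj v0)).
    by rewrite pimgE EP.
  have nq' := nq; rewrite pE in nq'; have [e e0 he] := path2_far nq'.
  pose n1 := - ((proj v1).2 - (proj v0).2); pose n2 := (proj v1).1 - (proj v0).1.
  pose K := `|n1| + `|n2| + 1.
  have K0 : 0 < K by rewrite ltr_wpDl // addr_ge0.
  have [d d0 dK] : exists2 d : R, 0 < d & d * K = e.
    by exists (e / K); [rewrite divr_gt0 | rewrite divfK // gt_eqF].
  exists (q0.1 + d * n1, q0.2 + d * n2).
    apply: (region_seg Aq) => t /andP[t0 t1].
    rewrite /setC /= pE; apply: he.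
    have B (x n : R) : `|n| <= K - 1 -> `|x + t * (x + d * n - x) - x| < e.
      move=> h; have -> : x + t * (x + d * n - x) - x = t * (d * n) by ring.
      rewrite !normrM (ger0_norm t0) (gtr0_norm d0) -dK.
      have h1 : d * `|n| < d * K by rewrite ltr_pM2l //; lra.
      apply: le_lt_trans h1; apply: ler_piMl => //; apply: mulr_ge0 => //; exact: ltW.
    have [m1 m2] := (normr_ge0 n1, normr_ge0 n2).
    by split; apply: B; rewrite /K; lra.
  have -> : C (q0.1 + d * n1, q0.2 + d * n2) = C q0 + d * (n1 ^+ 2 + n2 ^+ 2).
    by rewrite /C /n1 /n2 /=; ring.
  rewrite C0 add0r mulf_neq0 ?gt_eqF //.
  rewrite lt_neqAle addr_ge0 ?sqr_ge0 // andbT eq_sym paddr_eq0 ?sqr_ge0 // !sqrf_eq0.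
  apply/negP => /andP[/eqP h1 /eqP h2]; apply: pv.
  by apply: pt2_eq; rewrite /n1 /n2 in h1 h2; lra.
have [t0 [t01 [p0 kp0 e0] c0]] := region_exit Aa i0.
have [t1 [t11 [p1 kp1 e1] c1]] := region_exit Aa i1.
exists p0, p1; rewrite e0 e1; split=> //.
rewrite /lerp2 /= => -[h1 h2]; move/eqP: Ca; apply; rewrite /C /=.
move: h1 h2; move: v0.1.1 v0.1.2 v1.1.1 v1.1.2 a.1 a.2 => x0 y0 x1 y1 a1 a2 h1 h2.
have g1 : t0 * (x0 - a1) = t1 * (x1 - a1) by lra.
have g2 : t0 * (y0 - a2) = t1 * (y1 - a2) by lra.
have tn : t0 * t1 != 0 by rewrite mulf_neq0 // gt_eqF //; lra.
apply: (mulfI tn); rewrite mulr0.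
have -> : t0 * t1 * ((x1 - x0) * (a2 - y0) - (y1 - y0) * (a1 - x0)) =
  (t0 * (x0 - a1)) * (t1 * (y1 - a2)) - (t0 * (y0 - a2)) * (t1 * (x1 - a1)) by ring.
by rewrite g1 g2; ring.
Qed.

End Hits.
End Walk.

(** * A region with one crossing is a kink *)

Section RegionKink.
Variable R : realType.
Local Notation pt3 := (pt3 R).
Local Notation pt2 := (pt2 R).
Implicit Types (a b c d p : pt3) (P Q : seq pt3) (u v w : pt3 * pt3) (L : seq (pt3 * pt3)).
Local Notation path3 := (gpath (@lerp R)).

Lemma spath_nondeg b (l : seq pt3) : spath b l -> nondeg b l.
Proof. by elim: l b => //= c l IH b [bc _ /IH]. Qed.

Lemma knot_nondeg a (s : seq pt3) : knot_polygon (a :: s) -> nondeg a (rcons s a).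
Proof.
case: s => [[]//|b s] /knot_polygon_cons[_ ab sb _] /=; split=> //.
exact: spath_nondeg.
Qed.

Lemma map_cat_inv (T U : Type) (f : T -> U) l s1 s2 : map f l = s1 ++ s2 ->
  exists l1 l2, [/\ l = l1 ++ l2, map f l1 = s1 & map f l2 = s2].
Proof.
move=> e; exists (take (size s1) l), (drop (size s1) l); rewrite cat_take_drop.
by split=> //; rewrite ?map_take ?map_drop e ?take_size_cat ?drop_size_cat.
Qed.

(** At most one crossing is on the boundary, so one of two boundary points with different
    projections is no crossing and can be made the base point. *)
Lemma region_start L q0 : good L -> ~ pimg (unzip1 L) q0 ->
  (forall q q', double_pt (unzip1 L) q -> double_pt (unzip1 L) q' ->
     closure (region_of (unzip1 L) q0) q -> closure (region_of (unzip1 L) q0) q' -> q = q') ->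
  exists u L', jequiv L (u :: L') /\ closure (region_of (unzip1 L) q0) (proj u.1).
Proof.
move=> gL nq uq; have [hL rP rQ] := gL.
have [p1 [p2 [k1 k2 n12 c1 c2]]] := region_two_exits rP nq.
have [p [kp cp nd]] : exists p, [/\ kimg (unzip1 L) p,
    closure (region_of (unzip1 L) q0) (proj p) & ~ double_pt (unzip1 L) (proj p)].
  case: (pselect (double_pt (unzip1 L) (proj p1))) => d1; last by exists p1.
  case: (pselect (double_pt (unzip1 L) (proj p2))) => d2; last by exists p2.
  by case: n12; apply: uq.
have [u cu eu] := (kimg1P _ _).1 kp; rewrite -eu in nd cp.
by have [L' jL'] := revertex gL cu nd; exists u, L'.
Qed.

Lemma jequiv_double L L' q : jequiv L L' ->
  double_pt (unzip1 L') q <-> double_pt (unzip1 L) q.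
Proof. by move=> [_ e _ _]; rewrite /double_pt /preim (kimg_unzip e).1. Qed.

(** A walk from a boundary point could only stop at a crossing of the region; as there is none, it
    goes once around the whole knot without a crossing. *)
Lemma no_double L q0 : good L -> ~ pimg (unzip1 L) q0 ->
  (forall q, double_pt (unzip1 L) q -> ~ closure (region_of (unzip1 L) q0) q) ->
  forall q, ~ double_pt (unzip1 L) q.
Proof.
move=> gL nq nd q dq.
have [|u [L' [jL cu]]] := region_start gL nq; first by move=> q1 q2 /nd h _ /h.
have D r := jequiv_double r jL.
have [[hL' rP' _] eC _ _] := jL.
have kE : kimg (unzip1 (u :: L')) = kimg (unzip1 L) := (kimg_unzip eC).1.
rewrite -(region_of_kimg q0 kE) in cu.
have kE' : kimg (unzip1 (u :: L')) = path3 u.1 (rcons (unzip1 L') u.1) by rewrite kimgE.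
have ndg := knot_nondeg (reg_knot rP').
have vt z : z \in u.1 :: rcons (unzip1 L') u.1 -> ~ double_pt (unzip1 (u :: L')) (proj z).
  rewrite inE mem_rcons inE => zl; apply: (reg_vertex rP').
  by case/or3P: zl => h; rewrite inE ?h ?orbT.
have hk : path3 u.1 (rcons (unzip1 L') u.1) `<=` kimg (unzip1 (u :: L')) by rewrite kE'.
case: (first_hit rP' hk ndg vt cu) => [h|[l1 [b [l2 [t [_ _ dt ct _]]]]]].
  have := dq; rewrite -D => -[p1 [p2 [_ e]]].
  have [kp ep] : preim (unzip1 (u :: L')) q p1 by rewrite e; left.
  by apply: (h p1); [rewrite -kE' | rewrite D ep].
by apply: (nd _ ((D _).1 dt)); rewrite -(region_of_kimg q0 kE).
Qed.

Lemma edge_inner P Q a b s t : regular P -> Q = a :: b :: s -> knot_polygon Q ->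
  kimg Q = kimg P -> (forall z, z \in Q -> ~ double_pt P (proj z)) ->
  0 < t < 1 -> double_pt P (proj (lerp a b t)) ->
  ~ path3 b (rcons s a) (lerp a b t).
Proof.
move=> rP EQ kQ kE hv t01 dt hp; rewrite EQ in kQ hv.
have [_ ab _ hh] := (knot_polygon_cons _ _ _).1 kQ.
case: (hh (lerp a b t)) => //; first by exists t; split=> //; lra.
  by move=> e; apply: (hv a); rewrite ?inE ?eqxx // -e.
by move=> e; apply: (hv b); rewrite ?inE ?eqxx ?orbT // -e.
Qed.

Lemma jequiv_split2 L1 u v L2 (r t : R) : good (L1 ++ u :: v :: L2) -> 0 < r -> r < t -> t < 1 ->
  ~ double_pt (unzip1 (L1 ++ u :: v :: L2)) (proj (jlerp u v r).1) ->
  ~ double_pt (unzip1 (L1 ++ u :: v :: L2)) (proj (jlerp u v t).1) ->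
  jequiv (L1 ++ u :: v :: L2) (L1 ++ u :: jlerp u v r :: jlerp u v t :: v :: L2).
Proof.
move=> g r0 rt t1 nr nt.
have j1 : jequiv (L1 ++ u :: v :: L2) (L1 ++ u :: jlerp u v t :: v :: L2).
  by apply: jequiv_split => //; lra.
have t0 : 0 < t by lra.
have [_ _ fL _] := jlerp_affine R.
have E : jlerp u v r = jlerp u (jlerp u v t) (r / t) by rewrite fL divfK // gt_eqF.
apply: (jequiv_trans j1); rewrite {1}E; apply: jequiv_split; first by case: j1.
  by rewrite divr_gt0 //= ltr_pdivrMr // mul1r.
by rewrite -E (jequiv_double _ j1).
Qed.

Lemma on_edge (c b : pt3) (q : pt2) (t : R) : proj (lerp c b t) = q ->
  forall s, proj (lerp c b s) = (q.1 + (s - t) * ((proj b).1 - (proj c).1),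
    q.2 + (s - t) * ((proj b).2 - (proj c).2)).
Proof. by move=> <- s; apply: pt2_eq => /=; ring. Qed.

Lemma ltr_box (t e : R) : 0 < e -> t - e < t + e.
Proof. lra. Qed.

Lemma box_norm (e A B Z Z' K ep : R) : 0 < e -> 0 <= A -> 0 <= B -> 0 <= Z -> 0 <= Z' ->
  A + B <= 1 -> Z + Z' + 1 <= K -> e * K <= ep -> A * (e * Z) + B * (e * Z') < ep.
Proof.
move=> e0 A0 B0 Z0 Z'0 AB ZK eK.
have h1 : A * Z + B * Z' <= Z + Z' by nra.
have h2 : e * (A * Z + B * Z') < e * K by rewrite ltr_pM2l //; lra.
have -> : A * (e * Z) + B * (e * Z') = e * (A * Z + B * Z') by ring.
lra.
Qed.

Lemma sum4_le (a b c d : R) : 0 <= a -> 0 <= b -> 0 <= c -> 0 <= d ->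
  c + a + 1 <= a + b + c + d + 1 /\ d + b + 1 <= a + b + c + d + 1.
Proof. by move=> *; split; lra. Qed.

Lemma box_unit (t e s : R) : 0 < t - e -> t + e < 1 -> t - e <= s <= t + e -> 0 <= s <= 1.
Proof. by move=> *; lra. Qed.

Lemma small_radius (t1 t2 ep K : R) : 0 < t1 < 1 -> 0 < t2 < 1 -> 0 < ep -> 0 < K ->
  exists e : R, [/\ 0 < e, 0 < t1 - e /\ t1 + e < 1, 0 < t2 - e /\ t2 + e < 1 & e * K <= ep].
Proof.
move=> t1b t2b ep0 K0.
pose mm := Num.min (Num.min t1 (1 - t1)) (Num.min t2 (1 - t2)).
have mm0 : 0 < mm by rewrite !lt_min; lra.
have [m1 [m2 [m3 m4]]] : mm <= t1 /\ mm <= 1 - t1 /\ mm <= t2 /\ mm <= 1 - t2.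
  by rewrite /mm !ge_min !lexx !orbT.
exists (Num.min (mm / 2) (ep / K)).
have g : Num.min (mm / 2) (ep / K) <= mm / 2 by rewrite ge_min lexx.
have g' : Num.min (mm / 2) (ep / K) <= ep / K by rewrite ge_min lexx orbT.
split; first by rewrite lt_min !divr_gt0.
- by split; lra.
- by split; lra.
by rewrite -ler_pdivlMr.
Qed.

(** For small [e] the parallelogram with half diagonals [e * D2] and [e * D1] around [q] lies in a
    box meeting the projection in these two edges only, and transversality leaves [q] as their one
    common point there. *)
Lemma crossing_box P c1 b1 c2 b2 (q : pt2) (t1 t2 ep : R) : regular P ->
  seg c1 b1 `<=` kimg P -> seg c2 b2 `<=` kimg P -> c1 <> b1 -> c2 <> b2 ->
  0 < t1 < 1 -> 0 < t2 < 1 -> proj (lerp c1 b1 t1) = q -> proj (lerp c2 b2 t2) = q ->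
  edet (proj c2) (proj b2) (proj c1) (proj b1) <> 0 -> 0 < ep ->
  (forall p, kimg P p -> near2 ep q (proj p) -> seg c1 b1 p \/ seg c2 b2 p) ->
  let D1 : pt2 := ((proj b1).1 - (proj c1).1, (proj b1).2 - (proj c1).2) in
  let D2 : pt2 := ((proj b2).1 - (proj c2).1, (proj b2).2 - (proj c2).2) in
  exists e : R, [/\ 0 < e, 0 < t1 - e /\ t1 + e < 1, 0 < t2 - e /\ t2 + e < 1,
    forall al be : R, `|al| + `|be| <= 1 ->
      near2 ep q (q.1 + al * (e * D2.1) + be * (e * D1.1), q.2 + al * (e * D2.2) + be * (e * D1.2)) &
    (forall s, t1 - e <= s <= t1 + e -> double_pt P (proj (lerp c1 b1 s)) -> s = t1) /\
    (forall s, t2 - e <= s <= t2 + e -> double_pt P (proj (lerp c2 b2 s)) -> s = t2)].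
Proof.
move=> rP S1 S2 n1 n2 t1b t2b e1 e2 det ep0 loc D1 D2.
have on1 := on_edge e1; have on2 := on_edge e2.
have det' : D2.1 * D1.2 - D2.2 * D1.1 != 0 by apply/eqP.
have cinj := coord_inj (q := q) det'.
pose K := `|D1.1| + `|D1.2| + `|D2.1| + `|D2.2| + 1.
have K0 : 0 < K by rewrite ltr_wpDl // !addr_ge0.
have [e [e0 ee1 ee2 eK]] := small_radius t1b t2b ep0 K0.
have en : e != 0 by rewrite gt_eqF.
have nearq (al be : R) : `|al| + `|be| <= 1 ->
  near2 ep q (q.1 + al * (e * D2.1) + be * (e * D1.1), q.2 + al * (e * D2.2) + be * (e * D1.2)).
  move=> h.
  have B (x z z' : R) : `|z| + `|z'| + 1 <= K -> `|x + al * (e * z) + be * (e * z') - x| < ep.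
    move=> hz; have -> : x + al * (e * z) + be * (e * z') - x = al * (e * z) + be * (e * z') by ring.
    apply: le_lt_trans (ler_normD _ _) _; rewrite !normrM (gtr0_norm e0).
    exact: box_norm e0 _ _ _ _ h hz eK.
  have [k1 k2] := sum4_le (normr_ge0 D1.1) (normr_ge0 D1.2) (normr_ge0 D2.1) (normr_ge0 D2.2).
  by split; apply: B.
have other r p : double_pt P r -> exists p', [/\ kimg P p', proj p' = r & p' <> p].
  move=> [x1 [x2 [n12 ex]]].
  have [kx1 ex1] : preim P r x1 by rewrite ex; left.
  have [kx2 ex2] : preim P r x2 by rewrite ex; right.
  case: (pselect (x1 = p)) => h; last by exists x1.
  by exists x2; split=> // h'; apply: n12; rewrite h h'.
have scale (t s : R) : t - e <= s <= t + e -> `|(s - t) / e| <= 1 /\ (s - t) / e * e = s - t.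
  rewrite -ler_distl => h; rewrite divfK //; split=> //.
  by rewrite normrM normfV (gtr0_norm e0) ler_pdivrMr // mul1r.
exists e; split=> //; split=> s hs ds.
  have s1 := box_unit ee1.1 ee1.2 hs.
  (* The second point over a double point must be on the other edge, and comparing coordinates along
     [D1] and [D2] puts both over [q]. *)
  have [p' [kp' ep' np']] := other _ (lerp c1 b1 s) ds.
  have i3 : seg c1 b1 (lerp c1 b1 s) by exists s.
  have [sc1 sc2] := scale _ _ hs.
  have np : near2 ep q (proj p').
    rewrite ep' on1; have := nearq 0 ((s - t1) / e).
    by rewrite !mulrA sc2 !mul0r !addr0 normr0 add0r; apply.
  case: (loc p' kp' np) => [h|[s' [s1' h]]]; first by case: np'; apply: (reg_seg_inj rP n1 S1).
  have := ep'; rewrite h on1 on2 => E'.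
  have [_ /esym/eqP] : s' - t2 = 0 /\ 0 = s - t1 by apply: cinj; rewrite !mul0r !addr0.
  by rewrite subr_eq0 => /eqP.
have s1 := box_unit ee2.1 ee2.2 hs.
have [p' [kp' ep' np']] := other _ (lerp c2 b2 s) ds.
have i3 : seg c2 b2 (lerp c2 b2 s) by exists s.
have [sc1 sc2] := scale _ _ hs.
have np : near2 ep q (proj p').
  rewrite ep' on2; have := nearq ((s - t2) / e) 0.
  by rewrite !mulrA sc2 !mul0r !addr0 normr0 addr0; apply.
case: (loc p' kp' np) => [[s' [s1' h]]|h]; last by case: np'; apply: (reg_seg_inj rP n2 S2).
have := ep'; rewrite h on1 on2 => E'.
have [/esym/eqP + _] : 0 = s - t2 /\ s' - t1 = 0 by apply: cinj; rewrite !mul0r !addr0.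
by rewrite subr_eq0 => /eqP.
Qed.

Lemma box_ends P c b (t e : R) : 0 < e -> 0 < t - e -> t + e < 1 ->
  (forall s, t - e <= s <= t + e -> double_pt P (proj (lerp c b s)) -> s = t) ->
  ~ double_pt P (proj (lerp c b (t - e))) /\ ~ double_pt P (proj (lerp c b (t + e))).
Proof.
move=> e0 h1 h2 iso; split=> /iso h.
  by have : t - e = t by [apply: h; lra]; lra.
by have : t + e = t by [apply: h; lra]; lra.
Qed.

Lemma ray_end_up (t e r be : R) : 0 < e -> t + e < 1 -> 0 <= r -> `|be| <= 1 ->
  t + e + r * (1 - (t + e)) - t = be * e -> r = 0.
Proof.
move=> e0 te r0; rewrite ler_norml => /andP[_ b1] h.
have : r * (1 - (t + e)) <= 0 by nra.
by rewrite pmulr_lle0 ?subr_gt0 // => r1; apply/eqP; rewrite eq_le r1.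
Qed.

Lemma ray_end_down (t e r al : R) : 0 < e -> 0 < t - e -> r <= 1 -> `|al| <= 1 ->
  r * (t - e) - t = al * e -> r = 1.
Proof.
move=> e0 te r1; rewrite ler_norml => /andP[a1 _] h.
have : 0 <= (r - 1) * (t - e) by nra.
by rewrite pmulr_lge0 // subr_ge0 => r2; apply/eqP; rewrite eq_le r1.
Qed.

Lemma on_middle (t e r : R) : 0 < e -> 0 <= r <= 1 -> t - e <= t - e + r * (2 * e) <= t + e.
Proof. by move=> e0 /andP[r0 r1]; nra. Qed.

Lemma lt_prefix (t e r : R) : 0 < e -> 0 < t - e -> 0 <= r <= 1 -> 0 <= r * (t - e) < t.
Proof. by move=> e0 te /andP[r0 r1]; nra. Qed.

Lemma gt_suffix (t e r : R) : 0 < e -> t + e < 1 -> 0 <= r <= 1 ->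
  t < t + e + r * (1 - (t + e)) <= 1.
Proof. by move=> e0 te /andP[r0 r1]; nra. Qed.

(* The knot runs u0 -l1- c1 - b1 -m- c2 - b2 -l3- u0; the first double point
   after u0 and the last one before u0 are both q. *)
Lemma kink_assembly u0 Ls q l1 b1 m b2 l3 (t1 t2 : R) :
  let L := u0 :: Ls in let P := unzip1 L in
  let c1 := last u0.1 l1 in let c2 := last b1 m in
  good L -> rcons (unzip1 Ls) u0.1 = l1 ++ b1 :: m ++ b2 :: l3 ->
  0 < t1 < 1 -> 0 < t2 < 1 -> double_pt P q ->
  proj (lerp c1 b1 t1) = q -> proj (lerp c2 b2 t2) = q ->
  (forall p, path3 u0.1 l1 p -> ~ double_pt P (proj p)) ->
  (forall r, 0 <= r < t1 -> ~ double_pt P (proj (lerp c1 b1 r))) ->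
  (forall p, path3 b2 l3 p -> ~ double_pt P (proj p)) ->
  (forall r, t2 < r <= 1 -> ~ double_pt P (proj (lerp c2 b2 r))) ->
  exists L' K, jequiv L L' /\ [/\ unzip1 K = unzip1 L', shad K, regular (unzip2 K),
    knot_equiv (unzip1 L') (unzip2 K) & cross_rel [set q] K].
Proof.
move=> L P c1 c2 gL E t1b t2b dq e1 e2 h1 h1' h2 h2'.
have [hL rP rQ] := gL.
have vtxd z : z \in P -> ~ double_pt P (proj z) by apply: (reg_vertex rP).
(* The decomposition of the first vertex list is lifted to the list of pairs. *)
have [J1 [J' [EJ EJ1]]] : exists J1 J', [/\ rcons Ls u0 = J1 ++ J', map fst J1 = l1 &
    map fst J' = b1 :: m ++ b2 :: l3].
  by apply: map_cat_inv; rewrite map_rcons.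
case: J' EJ => [|v1 J'] EJ //= [Ev1 EJ'].
have [Jm [J'' [EJ2 EJm EJ3]]] := map_cat_inv EJ'.
case: J'' EJ2 EJ3 => [|v2 J3] EJ2 //= [Ev2 EJ3].
subst J'.
have [J3' EJ3'] : exists J3', v2 :: J3 = rcons J3' u0.
  have : last u0 (v2 :: J3) = u0.
    by have := congr1 (last u0) EJ; rewrite last_rcons last_cat /= last_cat.
  by move=> h; exists (belast v2 J3); rewrite lastI; congr rcons; exact: h.
have ELs : Ls = J1 ++ v1 :: Jm ++ J3'.
  by apply: (@rcons_injl _ u0); rewrite EJ EJ3' rcons_cat /= rcons_cat.
have [J1' [k1 Ek1]] : exists J1' k1, u0 :: J1 = rcons J1' k1 /\ k1.1 = c1.
  exists (belast u0 J1), (last u0 J1); rewrite lastI; split=> //.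
  by rewrite /c1 -EJ1 (last_map fst).
have [Jm' [k2 [Ek2 Ek2c]]] : exists Jm' k2, v1 :: Jm = rcons Jm' k2 /\ k2.1 = c2.
  exists (belast v1 Jm), (last v1 Jm); rewrite lastI; split=> //.
  by rewrite /c2 -EJm -Ev1 (last_map fst).
case: Ek1 => Ek1 Ek1c.
have EL : L = J1' ++ k1 :: v1 :: Jm ++ J3' by rewrite /L ELs -cat_cons Ek1 cat_rcons.
(* [jA] and [jB] rotate one of the two crossing edges to the front, so that [knot_polygon_cons]
   applies to each. *)
have jA : jequiv L (k1 :: v1 :: Jm ++ J3' ++ J1').
  rewrite EL; have := @jequiv_catC _ J1' (k1 :: v1 :: Jm ++ J3'); rewrite -EL /= -catA; exact.
have jB : jequiv L (k2 :: v2 :: J3 ++ J1 ++ Jm').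
  have E0 : L = (J1' ++ k1 :: Jm') ++ k2 :: J3'.
    by rewrite EL -cat_cons Ek2 cat_rcons -catA.
  rewrite E0; have := @jequiv_catC _ (J1' ++ k1 :: Jm') (k2 :: J3'); rewrite -E0 => /(_ gL).
  have -> : (k2 :: J3') ++ J1' ++ k1 :: Jm' = k2 :: v2 :: J3 ++ J1 ++ Jm'.
    by rewrite -[J1' ++ k1 :: Jm']cat_rcons -Ek1 /= -[v2 :: J3 ++ _]cat_cons EJ3' cat_rcons.
  exact.
have PA : unzip1 (k1 :: v1 :: Jm ++ J3' ++ J1') = c1 :: b1 :: m ++ unzip1 (J3' ++ J1').
  by rewrite /= Ek1c Ev1 /unzip1 map_cat EJm.
have PB : unzip1 (k2 :: v2 :: J3 ++ J1 ++ Jm') = c2 :: b2 :: l3 ++ l1 ++ unzip1 Jm'.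
  by rewrite /= Ek2c Ev2 /unzip1 !map_cat EJ3 EJ1.
have closeA : rcons (m ++ unzip1 (J3' ++ J1')) c1 = m ++ b2 :: l3 ++ l1.
  have -> : rcons (m ++ unzip1 (J3' ++ J1')) c1 = m ++ map fst (J3' ++ rcons J1' k1).
    by rewrite /unzip1 rcons_cat !map_cat map_rcons Ek1c rcons_cat.
  by rewrite -Ek1 -cat_rcons -EJ3' map_cat /= Ev2 EJ3 EJ1.
have closeB : rcons (l3 ++ l1 ++ unzip1 Jm') c2 = l3 ++ l1 ++ b1 :: m.
  by rewrite !rcons_cat -Ek2c -map_rcons -Ek2 /= Ev1 EJm.
have last3 : last b2 l3 = u0.1.
  have := congr1 (last u0.1) E; rewrite last_rcons last_cat /= last_cat /= => <-; by [].
have regj L' : jequiv L L' -> [/\ knot_polygon (unzip1 L'), kimg (unzip1 L') = kimg P &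
    forall z, z \in unzip1 L' -> ~ double_pt P (proj z)].
  move=> j; have [[_ r _] eC _ _] := j; split; [exact: reg_knot | exact: (kimg_unzip eC).1 |].
  by move=> z zl; rewrite -(jequiv_double _ j); apply: (reg_vertex r).
have [kA kimA vA] := regj _ jA; have [kB kimB vB] := regj _ jB.
rewrite PA in kA kimA vA; rewrite PB in kB kimB vB.
have d1 : double_pt P (proj (lerp c1 b1 t1)) by rewrite e1.
have d2 : double_pt P (proj (lerp c2 b2 t2)) by rewrite e2.
have nA := edge_inner rP erefl kA kimA vA t1b d1.
have nB := edge_inner rP erefl kB kimB vB t2b d2.
rewrite closeA in nA; rewrite closeB in nB.
have [_ n1 _ hA] := (knot_polygon_cons _ _ _).1 kA; rewrite closeA in hA.
have [_ n2 _ hB] := (knot_polygon_cons _ _ _).1 kB; rewrite closeB in hB.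
have kE p : kimg P p <-> path3 u0.1 l1 p \/ seg c1 b1 p \/ path3 b1 m p \/ seg c2 b2 p \/ path3 b2 l3 p.
  have -> : kimg P = path3 u0.1 (rcons (unzip1 Ls) u0.1) by rewrite kimgE.
  by rewrite E gpath_cat // [path3 (last _ _) _]/= gpath_cat.
have S1 : seg c1 b1 `<=` kimg P by move=> p h; apply/kE; right; left.
have S2 : seg c2 b2 `<=` kimg P by move=> p h; apply/kE; do 3 right; left.
have i1 : seg c1 b1 (lerp c1 b1 t1) by exists t1; split=> //; lra.
have i2 : seg c2 b2 (lerp c2 b2 t2) by exists t2; split=> //; lra.
set p1 := lerp c1 b1 t1 in e1 d1 nA i1; set p2 := lerp c2 b2 t2 in e2 d2 nB i2.
have np1 : ~ path3 b1 m p1 by move=> h; apply: nA; rewrite gpath_cat //; left.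
have lastc1 : last b2 (l3 ++ l1) = c1 by rewrite last_cat last3.
(* The first edge belongs to the rest of the polygon as seen from the second, and [p2] is not on
   that rest. *)
have p12 : p1 <> p2.
  move=> e; apply: nB; rewrite -e catA gpath_cat // lastc1; right; left; exact: i1.
have np2 : ~ path3 b1 m p2 by move=> h; apply: nB; rewrite catA gpath_cat // lastc1; right; right.
have [P1 P2] := (S1 _ i1, S2 _ i2).
have pre := preim2 rP P1 P2 p12 (etrans e1 (esym e2)).
have det : edet (proj c2) (proj b2) (proj c1) (proj b1) <> 0.
  apply: (reg_transversal (P := P) (s := t2) (t := t1)) => //; last by rewrite e1 e2.
  by move=> x x1 x2; apply: hB => //; rewrite catA gpath_cat // lastc1; right; left.
(* q has a neighbourhood meeting the projection only in the two crossing edges *)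
have far1 : ~ gpath (@lerp2 R) (proj u0.1) (map (@proj R) l1) q.
  by rewrite -(gpath_map (f := @lerp R)) // => -[p hp ep]; apply: (h1 p hp); rewrite ep.
have far3 : ~ gpath (@lerp2 R) (proj b2) (map (@proj R) l3) q.
  by rewrite -(gpath_map (f := @lerp R)) // => -[p hp ep]; apply: (h2 p hp); rewrite ep.
have farm : ~ gpath (@lerp2 R) (proj b1) (map (@proj R) m) q.
  rewrite -(gpath_map (f := @lerp R)) // => -[p hp ep].
  have : preim P (proj p1) p by split; [apply/kE; right; right; left | rewrite e1].
  by rewrite pre => -[pe|pe]; rewrite pe in hp.
have [f1 f10 hf1] := path2_far far1; have [f3 f30 hf3] := path2_far far3.
have [fm fm0 hfm] := path2_far farm.
pose ep := Num.min f1 (Num.min f3 fm).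
have ep0 : 0 < ep by rewrite !lt_min f10 f30 fm0.
have farP (a : pt3) l (f : R) : ep <= f ->
    (forall y, near2 f q y -> ~ gpath (@lerp2 R) (proj a) (map (@proj R) l) y) ->
    forall p, near2 ep q (proj p) -> ~ path3 a l p.
  move=> le hf p np hp; apply: (hf (proj p)); first exact: near2W le np.
  by rewrite -(gpath_map (f := @lerp R)) //; exists p.
have g1 : ep <= f1 by rewrite /ep ge_min lexx.
have g3 : ep <= f3 by rewrite /ep !ge_min lexx orbT.
have gm : ep <= fm by rewrite /ep !ge_min lexx !orbT.
have loc1 := farP _ _ _ g1 hf1; have loc3 := farP _ _ _ g3 hf3; have locm := farP _ _ _ gm hfm.
have loc p : kimg P p -> near2 ep q (proj p) -> seg c1 b1 p \/ seg c2 b2 p.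
  move=> /kE[|[|[|[|]]]] hp np; [|by left| |by right|].
  - by case: (loc1 p np).
  - by case: (locm p np).
  - by case: (loc3 p np).
pose D1 : pt2 := ((proj b1).1 - (proj c1).1, (proj b1).2 - (proj c1).2).
pose D2 : pt2 := ((proj b2).1 - (proj c2).1, (proj b2).2 - (proj c2).2).
have on1 := on_edge e1; have on2 := on_edge e2; rewrite -/D1 in on1; rewrite -/D2 in on2.
have [e [e0 [a1 a3] [a4 a6] nearq [iso1 iso2]]] := crossing_box rP S1 S2 n1 n2 t1b t2b e1 e2 det ep0 loc.
rewrite -/D1 -/D2 in nearq.
have det' : D2.1 * D1.2 - D2.2 * D1.1 != 0 by apply/eqP.
have cinj := coord_inj (q := q) det'.
have [nWm nX] := box_ends e0 a1 a3 iso1; have [nY nW1] := box_ends e0 a4 a6 iso2.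
have lt1 : t1 - e < t1 + e by apply: ltr_box.
have lt2 : t2 - e < t2 + e by apply: ltr_box.
(* The four cuts at parameter distance [e] from [q]: [Y], [W1], [Wm], [X] take the places of [y],
   [w1], [wm], [x] in [kink_flip]. *)
pose X := jlerp k1 v1 (t1 + e); pose Wm := jlerp k1 v1 (t1 - e).
pose Y := jlerp k2 v2 (t2 - e); pose W1 := jlerp k2 v2 (t2 + e).
have X1 : X.1 = lerp c1 b1 (t1 + e) by rewrite /X /= Ek1c Ev1.
have Wm1 : Wm.1 = lerp c1 b1 (t1 - e) by rewrite /Wm /= Ek1c Ev1.
have Y1 : Y.1 = lerp c2 b2 (t2 - e) by rewrite /Y /= Ek2c Ev2.
have W11 : W1.1 = lerp c2 b2 (t2 + e) by rewrite /W1 /= Ek2c Ev2.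
have j1 : jequiv L (J1' ++ k1 :: Wm :: X :: v1 :: Jm ++ J3').
  rewrite {1}EL; apply: jequiv_split2; rewrite -?EL //.
    by rewrite -/Wm Wm1.
  by rewrite -/X X1.
have E1 : J1' ++ k1 :: Wm :: X :: v1 :: Jm ++ J3' = (J1' ++ k1 :: Wm :: X :: Jm') ++ k2 :: J3'.
  by rewrite -catA /= -[v1 :: Jm ++ _]cat_cons Ek2 cat_rcons.
have j2 : jequiv L (k2 :: v2 :: J3 ++ J1 ++ Wm :: X :: Jm').
  have gj : good (J1' ++ k1 :: Wm :: X :: v1 :: Jm ++ J3') by case: j1.
  apply: (jequiv_trans j1); rewrite E1 in gj *.
  have -> : k2 :: v2 :: J3 ++ J1 ++ Wm :: X :: Jm' = (k2 :: J3') ++ (J1' ++ k1 :: Wm :: X :: Jm').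
    by rewrite -[J1' ++ k1 :: _]cat_rcons -Ek1 /= -[v2 :: J3 ++ _]cat_cons EJ3' cat_rcons.
  exact: jequiv_catC.
have gj2 : good (k2 :: v2 :: J3 ++ J1 ++ Wm :: X :: Jm') by case: j2.
have j3 : jequiv L (k2 :: Y :: W1 :: v2 :: J3 ++ J1 ++ Wm :: X :: Jm').
  apply: (jequiv_trans j2); apply: (@jequiv_split2 [::]) => //.
    by rewrite /cat (jequiv_double _ j2) -/Y Y1.
  by rewrite /cat (jequiv_double _ j2) -/W1 W11.
have gj3 : good (k2 :: Y :: W1 :: v2 :: J3 ++ J1 ++ Wm :: X :: Jm') by case: j3.
(* Based at [Y], the list first runs through [u0]: the arc with [q] as its only crossing is the
   loop, and [v1 :: Jm] is the rest of the knot. *)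
have j4 : jequiv L (Y :: W1 :: (v2 :: J3 ++ J1) ++ Wm :: X :: v1 :: Jm).
  apply: (jequiv_trans j3).
  have -> : Y :: W1 :: (v2 :: J3 ++ J1) ++ Wm :: X :: v1 :: Jm =
      (Y :: W1 :: v2 :: J3 ++ J1 ++ Wm :: X :: Jm') ++ [:: k2].
    by rewrite Ek2 -cats1 /= -!catA.
  exact: (@jequiv_catC _ [:: k2]).
exists (Y :: W1 :: (v2 :: J3 ++ J1) ++ Wm :: X :: v1 :: Jm).
have [[_ r4 _] eC4 _ _] := j4.
have E4 : unzip1 (Y :: W1 :: (v2 :: J3 ++ J1) ++ Wm :: X :: v1 :: Jm) =
    Y.1 :: W1.1 :: (b2 :: l3 ++ l1) ++ Wm.1 :: X.1 :: b1 :: m.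
  by rewrite /unzip1 /= !map_cat /= Ev1 Ev2 EJ1 EJ3 EJm.
rewrite E4 in r4.
have D4 r : double_pt (Y.1 :: W1.1 :: (b2 :: l3 ++ l1) ++ Wm.1 :: X.1 :: b1 :: m) r <-> double_pt P r.
  by rewrite -E4; apply: jequiv_double.
have [||||||||K' [EK hK rK kK XK]] := @kink_flip R Y.1 W1.1 Wm.1 X.1 (b2 :: l3 ++ l1) (b1 :: m) q
   (e * D2.1, e * D2.2) (e * D1.1, e * D1.2) r4; last by exists K'; split=> //; rewrite E4.
- by [].
- by rewrite Y1 on2; apply: pt2_eq => /=; ring.
- by rewrite W11 on2; apply: pt2_eq => /=; ring.
- by rewrite Wm1 on1; apply: pt2_eq => /=; ring.
- by rewrite X1 on1; apply: pt2_eq => /=; ring.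
- have -> : (e * D2.1, e * D2.2).1 * (e * D1.1, e * D1.2).2 - (e * D2.1, e * D2.2).2 * (e * D1.1, e * D1.2).1 =
    e * e * (D2.1 * D1.2 - D2.2 * D1.1) by cbn [fst snd]; ring.
  by rewrite !mulf_neq0 // gt_eqF.
(* Inside the parallelogram the rest of the knot can only be on a crossing edge beyond a cut, which
   leaves the cuts [X] and [Y] themselves. *)
- move=> p al be hp hab; cbn [fst snd] => pp.
  have np : near2 ep q (proj p) by rewrite pp; apply: nearq.
  have [b1' a1'] : `|be| <= 1 /\ `|al| <= 1.
    by split; apply: le_trans hab; rewrite ?lerDl ?lerDr.
  rewrite !mulrA in pp.
  have {hp} : seg X.1 b1 p \/ path3 b1 m p \/ seg c2 Y.1 p.
    by move: hp; rewrite gpath_rcons // => -[[h|h]|h]; [left | right; left | right; right].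
  case=> [|[hp|]]; last 1 first.
  + rewrite Y1 => -[r [/andP[r0 r1] pr]]; right.
    have [_ _ fL _] := lerp_affine R; rewrite fL in pr.
    move: pp; rewrite pr on2 => E'.
    have [ha _] : r * (t2 - e) - t2 = al * e /\ 0 = be * e by apply: cinj; rewrite !mul0r !addr0.
    by rewrite (ray_end_down e0 a4 r1 a1' ha) mul1r.
  + rewrite X1 => -[r [/andP[r0 r1] pr]]; left.
    have [_ _ _ fR] := lerp_affine R; rewrite fR in pr.
    move: pp; rewrite pr on1 => E'.
    have [_ hb] : 0 = al * e /\ (t1 + e + r * (1 - (t1 + e))) - t1 = be * e.
      by apply: cinj; rewrite !mul0r !addr0.
    by rewrite (ray_end_up e0 a3 r0 b1' hb) mul0r addr0.
  by case: (locm p np).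
(* Along the loop, the pieces between cuts contain no double point but [q] by the choice of [e], and
   the remainder none by the choice of the first and last crossing. *)
move=> p hp; rewrite D4 => dp.
have [_ _ fL fR] := lerp_affine R.
have {hp} : seg Y.1 W1.1 p \/ seg W1.1 b2 p \/ path3 b2 l3 p \/ path3 u0.1 l1 p \/
    seg c1 Wm.1 p \/ seg Wm.1 X.1 p.
  have E5 : W1.1 :: (b2 :: l3 ++ l1) ++ [:: Wm.1; X.1] = [:: W1.1; b2] ++ l3 ++ l1 ++ [:: Wm.1; X.1].
    by rewrite /= catA.
  move: hp; rewrite E5 gpath_cat // [last _ [:: _; _]]/= gpath_cat // last3 gpath_cat //.
  case=> [[h|[h|->]]|[h|[h|[h|[h|->]]]]].
  - by left.
  - by right; left.
  - by right; left; apply: segR.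
  - by do 2 right; left.
  - by do 3 right; left.
  - by do 4 right; left.
  - by do 5 right.
  - by do 5 right; apply: segR.
case=> [|[|[|[|[|]]]]].
- rewrite Y1 W11 => -[r [r1 pr]].
  have pr' : p = lerp c2 b2 (t2 - e + r * (2 * e)) by rewrite pr; apply: pt3_eq => /=; ring.
  by rewrite pr' in dp *; rewrite (iso2 _ (on_middle _ e0 r1) dp).
- rewrite W11 => -[r [r1 pr]]; rewrite fR in pr.
  by case: (h2' _ (gt_suffix e0 a6 r1)); rewrite -pr.
- by move=> hp; case: (h2 p hp).
- by move=> hp; case: (h1 p hp).
- rewrite Wm1 => -[r [r1 pr]]; rewrite fL in pr.
  by case: (h1' _ (lt_prefix e0 a1 r1)); rewrite -pr.
rewrite Wm1 X1 => -[r [r1 pr]].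
have pr' : p = lerp c1 b1 (t1 - e + r * (2 * e)) by rewrite pr; apply: pt3_eq => /=; ring.
by rewrite pr' in dp *; rewrite (iso1 _ (on_middle _ e0 r1) dp).
Qed.

(** Both walks from the base point stop at a crossing in the closure of the region, hence at [qq];
    the arc through the base point between the two stops is a loop over [qq]. *)
Lemma region_kink L q0 qq : good L -> ~ pimg (unzip1 L) q0 ->
  double_pt (unzip1 L) qq -> closure (region_of (unzip1 L) q0) qq ->
  (forall q, double_pt (unzip1 L) q -> closure (region_of (unzip1 L) q0) q -> q = qq) ->
  exists L' K, jequiv L L' /\ [/\ unzip1 K = unzip1 L', shad K, regular (unzip2 K),
    knot_equiv (unzip1 L') (unzip2 K) & cross_rel [set qq] K].
Proof.
move=> gL nq dqq cqq uq.
have [|u0 [Ls [jL cu]]] := region_start gL nq.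
  by move=> q1 q2 d1 d2 c1 c2; rewrite (uq _ d1 c1) (uq _ d2 c2).
have D r := jequiv_double r jL.
have [gL1 eC _ _] := jL; have [hL1 rP _] := gL1.
have kE : kimg (unzip1 (u0 :: Ls)) = kimg (unzip1 L) := (kimg_unzip eC).1.
set P := unzip1 (u0 :: Ls) in rP D kE.
have rE := region_of_kimg q0 kE.
have {}uq q : double_pt P q -> closure (region_of P q0) q -> q = qq.
  by rewrite D rE; apply: uq.
rewrite -rE in cu; rewrite -D in dqq.
have kP' : kimg P = path3 u0.1 (rcons (unzip1 Ls) u0.1) by rewrite kimgE.
have vtxd z : z \in P -> ~ double_pt P (proj z) by apply: (reg_vertex rP).
have ndg := knot_nondeg (reg_knot rP).
have vt z : z \in u0.1 :: rcons (unzip1 Ls) u0.1 -> ~ double_pt P (proj z).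
  by rewrite inE mem_rcons inE => /or3P h; apply: vtxd; case: h => h; rewrite inE ?h ?orbT.
have hk1 : path3 u0.1 (rcons (unzip1 Ls) u0.1) `<=` kimg P by rewrite kP'.
have pre2 q p : double_pt P q -> exists p', [/\ kimg P p', proj p' = q & p' <> p].
  move=> [x1 [x2 [n12 e]]].
  have [k1 e1] : preim P q x1 by rewrite e; left.
  have [k2 e2] : preim P q x2 by rewrite e; right.
  case: (pselect (x1 = p)) => h; last by exists x1.
  by exists x2; split=> // h2; apply: n12; rewrite h h2.
case: (first_hit rP hk1 ndg vt cu) => [h|[l1 [b1 [l2 [t1 [E1 t1b dt1 ct1 [h1 h1']]]]]]].
  have [x1 [k1 e1 _]] := pre2 _ (0, 0, 0) dqq; exfalso.
  by apply: (h x1); [rewrite -kP' | rewrite e1].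
set c1 := last u0.1 l1 in dt1 ct1 h1'.
have q1 := uq _ dt1 ct1.
have S1 : seg c1 b1 `<=` kimg P by rewrite kP' E1 gpath_cat // => p hp; right; left.
have n1 : c1 <> b1 by move: ndg; rewrite E1 => /nondeg_cat[].
have [p' [kp' ep' np']] := pre2 _ (lerp c1 b1 t1) dt1.
have hk2 : path3 b1 l2 `<=` kimg P by rewrite kP' E1 gpath_cat // => p hp; right; right.
(* The second point over [qq] lies beyond the first hit, so the backward walk meets a crossing as
   well. *)
have p'2 : path3 b1 l2 p'.
  move: kp'; rewrite kP' E1 gpath_cat // => -[/h1|[hp|//]]; first by rewrite ep'.
  case: np'; apply: (reg_seg_inj rP n1 S1) => //.
  by exists t1; split=> //; lra.
have ndg2 : nondeg b1 l2 by move: ndg; rewrite E1 => /nondeg_cat[].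
have vt2 z : z \in b1 :: l2 -> ~ double_pt P (proj z).
  by move=> zl; apply: vt; rewrite E1 inE mem_cat zl !orbT.
have last2 : last b1 l2 = u0.1.
  by have := congr1 (last u0.1) E1; rewrite last_rcons last_cat.
case: (last_hit (q0 := q0) rP hk2 ndg2 vt2) => [|[h _]|]; first by rewrite last2.
  by case: (h _ p'2); rewrite ep'.
move=> [m [b2 [l3 [t2 [E2 t2b dt2 ct2 [h2 h2']]]]]].
set c2 := last b1 m in dt2 ct2 h2'.
have q2 := uq _ dt2 ct2.
have S2 : seg c2 b2 `<=` kimg P.
  by move=> p hp; apply: hk2; rewrite E2 gpath_cat //; right; left.
have n2 : c2 <> b2 by move: ndg2; rewrite E2 => /nondeg_cat[].
have E : rcons (unzip1 Ls) u0.1 = l1 ++ b1 :: m ++ b2 :: l3 by rewrite E1 E2.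
have [L' [K [jL' HK]]] := kink_assembly gL1 E t1b t2b dqq q1 q2 h1 h1' h2 h2'.
by exists L', K; split=> //; apply: jequiv_trans jL jL'.
Qed.

End RegionKink.

(** * Triangles *)

Section Triangle.
Variable R : realType.
Local Notation pt3 := (pt3 R).
Implicit Types (a b c d p : pt3) (P Q : seq pt3).
Local Notation path3 := (gpath (@lerp R)).

Definition bary a b c (x y z : R) : pt3 :=
  (x * a.1.1 + y * b.1.1 + z * c.1.1, x * a.1.2 + y * b.1.2 + z * c.1.2, x * a.2 + y * b.2 + z * c.2).

(** Twice the signed area of the projected triangle. *)
Definition flat_det a b c : R := edet (proj a) (proj b) (proj a) (proj c).

Lemma bary_inj a b c x y z x' y' z' : flat_det a b c != 0 ->
  x + y + z = 1 -> x' + y' + z' = 1 -> proj (bary a b c x y z) = proj (bary a b c x' y' z') ->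
  [/\ x = x', y = y' & z = z'].
Proof.
rewrite /flat_det /edet /bary /proj /= => det s s' [e1 e2].
move: a.1.1 a.1.2 b.1.1 b.1.2 c.1.1 c.1.2 det e1 e2 => a1 a2 b1 b2 c1 c2 det e1 e2.
have xe : x = 1 - y - z by lra.
have xe' : x' = 1 - y' - z' by lra.
rewrite {}xe {}xe' in e1 e2 *.
have f1 : (y - y') * (b1 - a1) + (z - z') * (c1 - a1) = 0 by lra.
have f2 : (y - y') * (b2 - a2) + (z - z') * (c2 - a2) = 0 by lra.
set D := (_ - _ : R) in det.
have g1 : (y - y') * D = 0.
  have -> : (y - y') * D = ((y - y') * (b1 - a1) + (z - z') * (c1 - a1)) * (c2 - a2) -
    ((y - y') * (b2 - a2) + (z - z') * (c2 - a2)) * (c1 - a1) by rewrite /D; ring.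
  by rewrite f1 f2; ring.
have g2 : (z - z') * D = 0.
  have -> : (z - z') * D = ((y - y') * (b2 - a2) + (z - z') * (c2 - a2)) * (b1 - a1) -
    ((y - y') * (b1 - a1) + (z - z') * (c1 - a1)) * (b2 - a2) by rewrite /D; ring.
  by rewrite f1 f2; ring.
move/eqP: g1; rewrite mulf_eq0 (negbTE det) orbF subr_eq0 => /eqP ye.
move/eqP: g2; rewrite mulf_eq0 (negbTE det) orbF subr_eq0 => /eqP ze.
by split=> //; rewrite ye ze.
Qed.

Lemma seg_bary a b c p : [/\ seg a b p -> exists t : R, p = bary a b c (1 - t) t 0,
  seg b c p -> exists t : R, p = bary a b c 0 (1 - t) t &
  seg c a p -> exists t : R, p = bary a b c t 0 (1 - t)].
Proof.
by split=> -[t [_ ->]]; exists t; apply: pt3_eq => /=; ring.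
Qed.

(** In barycentric coordinates the projection is injective; the barycentre is off the boundary,
    where one weight vanishes. *)
Lemma flat_triangle a b c : flat_det a b c != 0 ->
  [/\ regular [:: a; b; c], forall q, ~ double_pt [:: a; b; c] q &
   exists q, ~ pimg [:: a; b; c] q].
Proof.
move=> det; have I := bary_inj det.
have sb p : [/\ _, _ & _] := seg_bary a b c p.
have kE p : kimg [:: a; b; c] p -> exists x y z, [/\ p = bary a b c x y z, x + y + z = 1 & x * y * z = 0].
  have [h1 h2 h3] := sb p.
  rewrite kimg_cons2 /= => -[/h1|[/h2|[/h3|->]]].
  - by case=> t ->; exists (1 - t), t, 0; split=> //; ring.
  - by case=> t ->; exists 0, (1 - t), t; split=> //; ring.
  - by case=> t ->; exists t, 0, (1 - t); split=> //; ring.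
  by exists 1, 0, 0; split; [apply: pt3_eq => /=; ring | ring | ring].
have J p p' : kimg [:: a; b; c] p -> kimg [:: a; b; c] p' -> proj p = proj p' -> p = p'.
  move=> /kE[x [y [z [-> s1 _]]]] /kE[x' [y' [z' [-> s1' _]]]] e.
  by have [-> -> ->] := I _ _ _ _ _ _ s1 s1' e.
have nd q : ~ double_pt [:: a; b; c] q.
  move=> [p [p' [n e]]]; apply: n.
  have [k1 e1] : preim [:: a; b; c] q p by rewrite e; left.
  have [k2 e2] : preim [:: a; b; c] q p' by rewrite e; right.
  by apply: J => //; rewrite e1 e2.
have ea : a = bary a b c 1 0 0 by apply: pt3_eq => /=; ring.
have eb : b = bary a b c 0 1 0 by apply: pt3_eq => /=; ring.
have ec : c = bary a b c 0 0 1 by apply: pt3_eq => /=; ring.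
have I' x y z x' y' z' : x + y + z = 1 -> x' + y' + z' = 1 ->
    bary a b c x y z = bary a b c x' y' z' -> [/\ x = x', y = y' & z = z'].
  by move=> s1 s1' e; apply: I; rewrite ?e.
have ab : a <> b.
  by rewrite [X in X <> _]ea [X in _ <> X]eb => /I'[]; rewrite ?addr0 ?add0r // => /eqP; rewrite oner_eq0.
have bc : b <> c.
  by rewrite [X in X <> _]eb [X in _ <> X]ec => /I'[]; rewrite ?addr0 ?add0r // => _ /eqP; rewrite oner_eq0.
have ca : c <> a.
  by rewrite [X in X <> _]ec [X in _ <> X]ea => /I'[]; rewrite ?addr0 ?add0r // => _ _ /eqP; rewrite oner_eq0.
have kP : knot_polygon [:: a; b; c].
  apply/knot_polygon_cons; split=> //=.
    split=> //.
    move=> p hp; have [_ /(_ hp) [t ->] h3] := sb p; rewrite [X in _ -> _ = X]ec.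
    case=> [/h3 [t' e]|].
      have [||h1 h2 h4] := I' _ _ _ _ _ _ _ _ e; [ring|ring|].
      by rewrite -h1 subr0 in h4; rewrite h4 subrr.
    rewrite [X in _ = X -> _]ea => e.
    have [||h1 _ _] := I' _ _ _ _ _ _ _ _ e; [ring|ring|].
    by move/eqP: h1; rewrite eq_sym oner_eq0.
  move=> p hp; have [/(_ hp) [t e1] h2 h3] := sb p.
  case=> [/h2 [t' e]|[/h3 [t' e]|->]]; last by left.
    right; rewrite e1 in e; have [||h h' h''] := I' _ _ _ _ _ _ _ _ e; [ring|ring|].
    by rewrite e1 [RHS]eb h' -h'' subr0 subrr.
  left; rewrite e1 in e; have [||h h' h''] := I' _ _ _ _ _ _ _ _ e; [ring|ring|].
  by rewrite e1 h' subr0 [RHS]ea.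
split=> //.
  split=> //.
  - by move=> q p1 p2 p3 [k1 e1] [k2 e2] _; apply: Or31; apply: J => //; rewrite e1 e2.
  - by exists [::] => q; split=> // /nd.
exists (proj (bary a b c (1/3) (1/3) (1/3))) => -[p /kE[x [y [z [-> s1 z0]]]]] e.
have [] : [/\ x = 1/3, y = 1/3 & z = 1/3] by apply: I => //; lra.
by move=> h1 h2 h3; move: z0; rewrite h1 h2 h3; lra.
Qed.

Lemma vertex_off_edge a b c : knot_polygon [:: a; b; c] -> ~ seg a b c.
Proof.
move=> k h; have [_ ab /= [bc _ [ca _ _]] hh] := (knot_polygon_cons _ _ _).1 k.
by case: (hh c h) => [|/nesym//|/esym//]; left; apply: segR.
Qed.

(** [a], [b], [c] lie in the vertical plane [f = 0] and [c'] does not. Values of [f], together with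
    simplicity, show that the two swept triangles meet the fixed edges in common vertices only. *)
Lemma triangle_move a b c c' (k0 k1 k2 : R) :
  let f := fun p : pt3 => k0 + k1 * p.1.1 + k2 * p.1.2 in
  knot_polygon [:: a; b; c] -> f a = 0 -> f b = 0 -> f c = 0 -> f c' != 0 ->
  knot_equiv [:: a; b; c] [:: a; b; c'].
Proof.
move=> f k fa fb fc fc'.
have fl x y t : f (lerp x y t) = f x + t * (f y - f x) by rewrite /f /=; ring.
have k' := knot_polygon_rot 1 k; have e0 := equiv_rot 1 k; rewrite /= in k' e0.
have nb : c' <> b by move=> e; move: fc'; rewrite e fb eqxx.
have nc : c' <> c by move=> e; move: fc'; rewrite e fc eqxx.
have [_ bc /= [ca hca _] hbc] := (knot_polygon_cons _ _ _).1 k'.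
have [_ ab /= [_ habc _] hab] := (knot_polygon_cons _ _ _).1 k.
have f0 p : path3 c [:: a; b] p -> f p = 0.
  by case=> [[t [_ ->]]|[[t [_ ->]]|->]]; rewrite ?fl ?fa ?fb ?fc; ring.
have [||k1' e1] := delta_insert (c := c') k' nb nc.
- move=> p [t [t1 pt]] [s [s1 ps]].
  have : t * f c' = (1 - s) * f c' by have := congr1 f pt; rewrite ps !fl fb fc; lra.
  move/(mulIf fc') => ts.
  case: (eqVneq t 1) => t2; first by rewrite pt t2 lerp1.
  case: bc; have t3 : 1 - t != 0 by rewrite subr_eq0 eq_sym.
  have se : s = 1 - t by lra.
  have F (g : pt3 -> R) : (forall x y r, g (lerp x y r) = g x + r * (g y - g x)) -> g b = g c.
    move=> gl; have := congr1 g pt; rewrite ps !gl se => h.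
    by apply: (mulfI t3); lra.
  by apply: pt3_eq; [apply: (F (fun p => p.1.1)) | apply: (F (fun p => p.1.2)) | apply: (F snd)].
- move=> p [x [y [z [x0 y0 z0 s1 pe]]]] hp.
  have fp := f0 _ hp.
  have : z * f c' = f p.
    have -> : f p = x * f b + y * f c + z * f c' + (1 - (x + y + z)) * k0 by rewrite pe /f /=; ring.
    by rewrite fb fc s1; ring.
  rewrite fp => /eqP; rewrite mulf_eq0 (negbTE fc') orbF => /eqP z00.
  apply: hbc => //; exists y; split; first by lra.
  have xe : x = 1 - y by lra.
  by rewrite pe z00 xe; apply: pt3_eq => /=; ring.
have k2' := knot_polygon_rot 1 k1'; have e2 := equiv_rot 1 k1'; rewrite /= in k2' e2.
have noff : ~ seg c a b by apply: vertex_off_edge; have := knot_polygon_rot 1 k'.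
have [||k3 e3] := delta_remove _ k2'; first by [].
  move=> p [x [y [z [x0 y0 z0 s1 pe]]]] hp.
  have fp : f p = x * f c'.
    have -> : f p = x * f c' + y * f a + z * f c + (1 - (x + y + z)) * k0 by rewrite pe /f /=; ring.
    by rewrite fa fc s1; ring.
  case: hp => [hab'|[[t [t1 pt]]|->]]; last by left.
    have fp0 : f p = 0 by case: hab' => t [_ ->]; rewrite fl fa fb; ring.
    move: fp; rewrite fp0 => /esym/eqP; rewrite mulf_eq0 (negbTE fc') orbF => /eqP x00.
    have hca' : seg c a p.
      exists y; split; first by lra.
      have ze : z = 1 - y by lra.
      by rewrite pe x00 ze; apply: pt3_eq => /=; ring.
    right; case: (hab p hab') => // [|pb]; first by right; left.
    by case: noff; rewrite -pb.
  have tx : t = x.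
    by apply: (mulIf fc'); rewrite -fp pt fl fb; ring.
  case: (eqVneq x 1) => x1; first by left; rewrite pt tx x1 lerp1.
  case: noff; have xn : 1 - x != 0 by rewrite subr_eq0 eq_sym.
  have xp : 0 < 1 - x by rewrite lt_neqAle eq_sym xn; lra.
  have ye : (1 - x) * (y / (1 - x)) = y by rewrite mulrC divfK.
  exists (y / (1 - x)); split.
    apply/andP; split; first by apply: divr_ge0 => //; exact: ltW.
    by rewrite ler_pdivrMr // mul1r; lra.
  move: ye; set r := y / (1 - x) => ye.
  have F (g : pt3 -> R) : (forall x y r, g (lerp x y r) = g x + r * (g y - g x)) ->
      g p = x * g c' + y * g a + z * g c -> g b = g (lerp c a r).
    move=> gl; rewrite pt tx !gl => h; apply: (mulfI xn).
    have -> : (1 - x) * (g c + r * (g a - g c)) = (1 - x) * g c + (1 - x) * r * (g a - g c) by ring.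
    have ze : z = 1 - x - y by lra.
    by rewrite ye; rewrite ze in h; lra.
  by apply: pt3_eq; [apply: (F (fun p => p.1.1)) | apply: (F (fun p => p.1.2)) | apply: (F snd)];
    rewrite ?pe.
have [k4 e4] := (knot_polygon_rot 1 k3, equiv_rot 1 k3); rewrite /= in e4.
apply: rst_trans e0 _; apply: rst_trans e1 _; apply: rst_trans e2 _.
exact: rst_trans e3 e4.
Qed.

(** A triangle in a vertical plane has no regular projection; it is tilted by moving [c]
    horizontally along the normal of a projected edge. *)
Lemma triangle_flatten T : knot_polygon T -> size T = 3%N -> exists a b c,
  flat_det a b c != 0 /\ knot_equiv T [:: a; b; c].
Proof.
case: T => [|a [|b [|c [|]]]] // k _.
wlog : a b c k / proj a <> proj b.
  move=> W; case: (pselect (proj a = proj b)) => [ab|nab]; last exact: W.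
  have k1 := knot_polygon_rot 1 k; have e1 := equiv_rot 1 k; rewrite /= in k1 e1.
  case: (pselect (proj b = proj c)) => [bc|nbc]; last first.
    by have [x [y [z [d e]]]] := W _ _ _ k1 nbc; exists x, y, z; split=> //; apply: rst_trans e1 e.
  (* all three vertices on one vertical line: one of them is between the others *)
  exfalso; have k2 := knot_polygon_rot 1 k1; rewrite /= in k2.
  have V (u v w : pt3) : proj u = proj v -> proj v = proj w -> knot_polygon [:: u; v; w] ->
      ~ (u.2 <= w.2 <= v.2) /\ ~ (v.2 <= w.2 <= u.2).
    suff S (u' v' w' : pt3) : proj u' = proj v' -> proj v' = proj w' -> u'.2 <= w'.2 <= v'.2 -> seg u' v' w'.
      move=> uv vw /vertex_off_edge h; split=> l; apply: h; first exact: S.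
      by rewrite segC; apply: S; rewrite // uv.
    move=> uv vw /andP[l1 l2]; case: (eqVneq (v'.2 - u'.2) 0) => d.
      have -> : w' = u' by apply: proj_height; [rewrite uv vw | lra].
      exact: segL.
    have d0 : 0 < v'.2 - u'.2 by rewrite lt_neqAle eq_sym d; lra.
    exists ((w'.2 - u'.2) / (v'.2 - u'.2)); split.
      apply/andP; split; first by apply: divr_ge0; lra.
      by rewrite ler_pdivrMr // mul1r; lra.
    case: uv vw => p1 p2 [p3 p4]; apply: pt3_eq => /=.
    + by rewrite p1 subrr mulr0 addr0 p3.
    + by rewrite p2 subrr mulr0 addr0 p4.
    by rewrite divfK //; ring.
  have [v1 v2] := V _ _ _ ab bc k; have [v3 v4] := V _ _ _ bc (esym (etrans ab bc)) k1.
  have [v5 v6] := V _ _ _ (esym (etrans ab bc)) ab k2.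
  case: (leP a.2 b.2) => l1; case: (leP b.2 c.2) => l2; case: (leP a.2 c.2) => l3.
  - by apply: v6; rewrite l1 l2.
  - by apply: v6; rewrite l1 l2.
  - by apply: v1; rewrite l3 ltW.
  - by apply: v4; rewrite (ltW l3) l1.
  - by apply: v3; rewrite (ltW l1) l3.
  - by apply: v2; rewrite (ltW l3) l2.
  - by apply: v5; rewrite (ltW l2) (ltW l1).
  by apply: v5; rewrite (ltW l2) (ltW l1).
move=> nab; case: (eqVneq (flat_det a b c) 0) => d; last first.
  by exists a, b, c; split=> //; apply: rst_refl.
pose n1 := - (b.1.2 - a.1.2); pose n2 := b.1.1 - a.1.1.
pose c' : pt3 := (c.1.1 + n1, c.1.2 + n2, c.2).
have nn : n1 ^+ 2 + n2 ^+ 2 != 0.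
  rewrite paddr_eq0 ?sqr_ge0 // !sqrf_eq0; apply/negP => /andP[/eqP h1 /eqP h2]; apply: nab.
  by rewrite /proj; apply: pt2_eq => /=; rewrite /n1 /n2 in h1 h2; lra.
have dc' : flat_det a b c' = n1 ^+ 2 + n2 ^+ 2.
  have -> : flat_det a b c' = flat_det a b c + (n1 ^+ 2 + n2 ^+ 2).
    by rewrite /flat_det /edet /c' /n1 /n2 /=; ring.
  by rewrite d add0r.
exists a, b, c'; rewrite dc'; split=> //.
pose k0 := - (n1 * a.1.1 + n2 * a.1.2).
have fE p : k0 + n1 * p.1.1 + n2 * p.1.2 = flat_det a b p.
  by rewrite /flat_det /edet /k0 /n1 /n2 /=; ring.
apply: (triangle_move (k0 := k0) (k1 := n1) (k2 := n2) k); rewrite fE ?dc' //.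
- by rewrite /flat_det /edet; ring.
by rewrite /flat_det /edet; ring.
Qed.

End Triangle.

(** * Removing light regions *)

Section Reduction.
Variable R : realType.
Local Notation pt3 := (pt3 R).
Local Notation pt2 := (pt2 R).
Local Notation o3 := ((0, 0, 0) : pt3).
Implicit Types (p : pt3) (P D Q K : seq pt3) (A : set pt2) (L : seq (pt3 * pt3)).

Lemma kimg_proj_pimg P p : kimg P p -> pimg P (proj p).
Proof. by move=> k; exists p. Qed.

Lemma double_pimg P q : double_pt P q -> pimg P q.
Proof.
move=> [p [p' [_ e]]]; have [k <-] : preim P q p by rewrite e; left.
exact: kimg_proj_pimg.
Qed.

(** A region avoids the projection, so no point of the projection is interior to it. *)
Lemma frontier_closure P A q : region P A -> pimg P q -> frontier A q <-> closure A q.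
Proof.
move=> [q0 nq ->] Pq; split=> [[]//|c]; split=> //.
by move=> /interior_subset /connected_component_sub /(_ Pq).
Qed.

Lemma zip_good P C Q : regular P -> crossing_change P C Q ->
  [/\ good (zip P Q), unzip1 (zip P Q) = P, unzip2 (zip P Q) = Q & cross_rel C (zip P Q)].
Proof.
move=> rP cc; have [rQ sz vt _] := cc.
have u1 : unzip1 (zip P Q) = P by rewrite unzip1_zip // sz.
have u2 : unzip2 (zip P Q) = Q by rewrite unzip2_zip // sz.
have hL : shad (zip P Q).
  move=> u /(nthP (o3, o3))[i]; rewrite size_zip sz minnn => i1 <-.
  by rewrite nth_zip //= -!vtx_small ?sz // vt.
split=> //; first by split; rewrite ?u1 ?u2.
by have := (crossing_change_rel C hL); rewrite u1 u2 => /(_ rP)[/(_ cc)[]].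
Qed.

Lemma cross_rel_ext (C C' : set pt2) L : regular (unzip1 L) ->
  (forall q, double_pt (unzip1 L) q -> C q <-> C' q) -> cross_rel C L -> cross_rel C' L.
Proof.
move=> rP h X u v cu cv e l; have [x1 x2] := X u v cu cv e l.
have dq : double_pt (unzip1 L) (proj u.1).
  apply: (reg_double rP) e => [||n]; [by apply/kimg1P; exists u | by apply/kimg1P; exists v |].
  by rewrite n ltxx in l.
by have [h1 h2] := h _ dq; split=> [/h2/x1//|n]; apply: x2 => /h1.
Qed.

(** Without crossings every crossing change is vacuous, so the same [Q] results from a change at [A]
    alone. *)
Lemma crossingless_Reg D A C Q K : regular D -> knot_equiv D K -> region D A ->
  (forall q, ~ double_pt D q) -> crossing_change D C Q -> is_unknot Q -> Reg_value K 0.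
Proof.
move=> rD eD rA nd [rQ sz vt _] uQ; exists D, A; split=> //.
  split; first by constructor; [by [] | constructor].
    by move=> B [<-|].
  exists Q; split=> //; split=> // q /nd [].
by exists [::]; split=> // q; split=> // -[/nd].
Qed.

(** Changing nothing gives a polygon equivalent to [D], so [K] is unknotted; a triangle with
    non-degenerate projection is then a diagram with a region and no crossing. *)
Lemma unknot_Reg D Q K : regular D -> knot_equiv D K ->
  crossing_change D (rcc_set [::]) Q -> is_unknot Q -> Reg_value K 0.
Proof.
move=> rD eD cc [T [kT sT eT]].
have [[hL rP rQ] u1 u2 X] := zip_good rD cc.
have eDQ : knot_equiv D Q.
  have := height_isotopy hL rP; rewrite u1 u2; apply.
  by move=> u v cu cv e l; have [_ h] := X u v cu cv e l; split=> [[]|_]; apply: h.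
have [a [b [c [det eT']]]] := triangle_flatten kT sT.
have [rT nd [q nq]] := flat_triangle det.
have eK : knot_equiv [:: a; b; c] K.
  apply: rst_trans _ eD; apply: rst_sym; apply: rst_trans eDQ _.
  exact: rst_trans eT eT'.
have cT : crossing_change [:: a; b; c] set0 [:: a; b; c] by split=> // r /nd.
have uT : is_unknot [:: a; b; c].
  exists [:: a; b; c]; split; [exact: reg_knot | by [] | exact: rst_refl].
apply: (crossingless_Reg (A := connected_component (~` pimg [:: a; b; c]) q) rT eK _ nd cT uT).
by exists q.
Qed.

Lemma In_cat (T : Type) (x : T) s1 s2 : List.In x (s1 ++ s2) <-> List.In x s1 \/ List.In x s2.
Proof. by elim: s1 => [|y s1 IH] /=; [split=> [|[]//]; right | rewrite IH; tauto]. Qed.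

Lemma NoDup_cat_remove (T : Type) (x : T) s1 s2 : List.NoDup (s1 ++ x :: s2) ->
  List.NoDup (s1 ++ s2).
Proof.
elim: s1 => [|y s1 IH] h; inversion h; subst => //=.
constructor; last exact: IH.
by move=> /In_cat h1; apply: H1; apply/In_cat; case: h1 => h1; [left | right; right].
Qed.

(** Pairing regions with their numbers keeps the two lists aligned when one region is taken out. *)
Lemma region_weightP D rs n : region_weight D rs n <->
  exists l : seq (set pt2 * nat), [/\ map fst l = rs,
    forall x, List.In x l -> ncross D x.1 x.2 & n = sumn (map snd l)].
Proof.
split=> [[cs [sz h ->]]|[l [<- h ->]]].
  exists (zip rs cs); split; [by rewrite -/(unzip1 _) unzip1_zip ?sz | |
    by rewrite -/(unzip2 _) unzip2_zip ?sz].
  elim: rs cs sz h => [|A rs IH] [|c cs] //= [sz] h x [<-|hx].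
    exact: (h 0%N).
  by apply: (IH cs) => // i i1; apply: (h i.+1).
exists (map snd l); split=> //; first by rewrite !size_map.
elim: l h => [|x l IH] h [|i] //=; rewrite ?size_map => i1; first by apply: h; left.
by apply: IH; rewrite ?size_map // => y yl; apply: h; right.
Qed.

(** The source of the bound: without a region of weight at most 1, a total weight of at most 3
    leaves room for one region only. *)
Lemma light_or_heavy (l : seq (set pt2 * nat)) :
  (exists l1 x l2, l = l1 ++ x :: l2 /\ (x.2 <= 1)%N) \/ (2 * size l <= sumn (map snd l))%N.
Proof.
elim: l => [|x l IH]; first by right.
case: (leqP x.2 1) => hx; first by left; exists [::], x, l.
case: IH => [[l1 [y [l2 [-> hy]]]]|h]; first by left; exists (x :: l1), y, l2.
by right; rewrite /=; lia.
Qed.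

(** [D'] is [D], subdivided, with the kink at the crossing of [A] flipped. Taking [A] out of the
    list alters the parity of the changes at this crossing only, so the other regions lead from [D']
    to the old result, subdivided. Regions and crossing counts depend on the projection alone. *)
Lemma flip_region r1 r2 A D Q K : regular D -> knot_equiv D K -> ncross D A 1 ->
  unknotting_regions D (r1 ++ A :: r2) ->
  exists D', [/\ regular D', knot_equiv D' K, unknotting_regions D' (r1 ++ r2) &
    forall B n, ncross D B n -> ncross D' B n].
Proof.
move=> rD eD [s [us ss hs]] [nd hr [Q' [cc uQ]]] {Q}.
have [gL u1 u2 X] := zip_good rD cc; set L := zip D Q' in gL u1 u2 X.
have rA : region D A by apply: hr; apply/In_cat; right; left.
have [q0 nq eA] := rA.
case: s us ss hs => [|qq [|]] // _ _ hs.
have hq q : double_pt D q -> frontier A q <-> q = qq.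
  move=> dq; split=> [f|->].
    by have /hs : double_pt D q /\ frontier A q by []; rewrite inE => /eqP.
  by have [] := (hs qq).1 (mem_head _ _).
have [dqq fqq] := (hs qq).1 (mem_head _ _).
have eA' : A = region_of (unzip1 L) q0 by rewrite u1.
have fc q : double_pt D q -> frontier A q <-> closure A q.
  by move=> dq; apply: frontier_closure rA _; apply: double_pimg.
have := @region_kink R L q0 qq gL; rewrite -eA' u1 => /(_ nq dqq ((fc _ dqq).1 fqq)).
case=> [q dq /(fc _ dq) /(hq _ dq) //|L' [M [jL [eM hM rM kM XM]]]].
have [gL' eC k1 k2] := jL; have [hL' rP' rQ'] := gL'.
rewrite u1 in k1; rewrite u2 in k2.
have X' : cross_rel (rcc_set (r1 ++ A :: r2)) L' by rewrite /cross_rel eC.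
have rM1 : regular (unzip1 M) by rewrite eM.
(* [M] flips [qq] and [L'] performs all the changes, both starting from one polygon; comparing the
   results gives the changes still missing. *)
have [hJ XJ] := cross_rel_comp hM hL' eM rM1 XM X'.
set J := zip _ _ in hJ XJ.
have szML : size (unzip2 M) = size (unzip2 L').
  by have := congr1 size eM; rewrite !size_map.
have J1 : unzip1 J = unzip2 M by rewrite unzip1_zip // szML.
have J2 : unzip2 J = unzip2 L' by rewrite unzip2_zip // szML.
have kE : kimg (unzip1 L') = kimg D by rewrite (kimg_unzip eC).1 u1.
have DD q : double_pt (unzip2 M) q <-> double_pt D q.
  rewrite (unzip_double q hM (reg_knot rM1) (reg_knot rM)) eM.
  by rewrite /double_pt /preim kE.
have pE : pimg (unzip2 M) = pimg D.
  rewrite /pimg -kE -eM -jimg1 -jimg2 !image_comp; apply/seteqP; split=> q [u cu <-].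
    by exists u => //=; apply: (shad_jcl hM cu).
  by exists u => //=; rewrite (shad_jcl hM cu).
have rE B : region (unzip2 M) B <-> region D B by rewrite /region pE.
exists (unzip2 M); split=> //.
- by apply: rst_trans _ eD; apply: rst_sym; apply: rst_trans k1 kM.
- split.
  + exact: NoDup_cat_remove nd.
  + move=> B hB; apply/rE; apply: hr; apply/In_cat; move/In_cat: hB.
    by case=> h; [left | right; right].
  exists (unzip2 L'); split; last first.
    have [T [kT sT eT]] := uQ; exists T; split=> //.
    by apply: rst_trans eT; apply: rst_sym.
  rewrite -J1 -J2; apply/crossing_change_rel => //; first by rewrite J1.
  split; first by rewrite J2.
  apply: cross_rel_ext XJ; first by rewrite J1.
  move=> q; rewrite J1 DD => dq /=.
  have fq := hq q dq.
  (* At [qq] the entry [A] adds one to the count, at any other double point nothing. *)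
  rewrite /rcc_set /= !filter_cat /= !size_cat.
  case: (pselect (frontier A q)) => f.
    rewrite (asboolT f) /= addnS /=.
    have e : q = qq by apply/fq.
    case: (odd _) => /=; split=> // h; first by move=> [/(_ e)].
    by case: h; split.
  rewrite (asboolF f) /=.
  have e : q <> qq by move/fq.
  case: (odd _) => /=; split=> // h; first by move=> [_ /(_ isT)/e].
  by case: h; split.
move=> B n [s [us sn h]]; exists s; split=> // q; rewrite h.
by split=> -[dq f]; split=> //; apply/DD.
Qed.

(** Induction on the number of regions. The diagram has to vary, since each step replaces it by one
    with a crossing changed. *)
Lemma MRI_small_Reg k : forall rs D K n, size rs = k -> regular D -> knot_equiv D K ->
  unknotting_regions D rs -> region_weight D rs n -> (n <= 3)%N ->
  exists2 n', (n' <= n)%N & Reg_value K n'.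
Proof.
elim: k => [|k IH] rs D K n.
  move=> /size0nil -> rD eD [_ _ [Q [cc uQ]]] _ _; exists 0%N => //.
  exact: unknot_Reg cc uQ.
move=> sr rD eD uk /region_weightP[l [el hl en]] n3.
case: (light_or_heavy l) => [[l1 [x [l2 [ex x1]]]]|h]; last first.
  have sl : size l = k.+1 by rewrite -sr -el size_map.
  (* Two or more heavy regions would weigh at least 4, so a single region is left, and it witnesses
     [Reg]. *)
  case: k {IH} sr sl => [|k] sr sl; last by move: h; rewrite sl -en; lia.
  case: l sl {h} el hl en => [|[A c] [|]] //= _ er hl en.
  exists n => //; exists D, A; split=> //; first by rewrite er.
  by rewrite en addn0; apply: (hl (A, c)); left.
have hx : ncross D x.1 x.2 by apply: hl; rewrite ex; apply/In_cat; right; left.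
have er : rs = map fst l1 ++ x.1 :: map fst l2 by rewrite -el ex map_cat.
case: x ex x1 hx er => A c /= ex c1 hA er.
have [ND hr [Q [cc uQ]]] := uk.
have rA : region D A by apply: hr; rewrite er; apply/In_cat; right; left.
case: c c1 ex hA => [|[|]] // _ ex hA.
  (* By [no_double], a region without crossings on its boundary forces a diagram without
     crossings. *)
  exists 0%N => //; apply: (crossingless_Reg rD eD rA _ cc uQ).
  have [gL u1 u2 X] := zip_good rD cc.
  have [q0 nq eA] := rA.
  have := @no_double R (zip D Q) q0 gL; rewrite u1 => /(_ nq); apply => q dq cq.
  have [s [_ /size0nil -> hs]] := hA.
  have : q \in [::] by apply/hs; split=> //; apply/(frontier_closure rA (double_pimg dq)); rewrite eA.
  by rewrite in_nil.
rewrite er in uk; have [D' [rD' eD' uk' hn]] := flip_region Q rD eD hA uk.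
have sz : size (map fst l1 ++ map fst l2) = k.
  by move: sr; rewrite er !size_cat /=; lia.
have en' : n = (sumn (map snd (l1 ++ l2))).+1.
  by rewrite en ex !map_cat !sumn_cat /=; lia.
have W : region_weight D' (map fst l1 ++ map fst l2) n.-1.
  apply/region_weightP; exists (l1 ++ l2); split; [by rewrite map_cat | | by rewrite en'].
  move=> y hy; apply: hn; apply: hl; rewrite ex; apply/In_cat.
  by move/In_cat: hy => [h|h]; [left | right; right].
have [|n' ln hn'] := IH _ _ _ _ sz rD' eD' uk' W; first by lia.
by exists n' => //; lia.
Qed.

Lemma MRI_value_small K m : MRI_value K m -> (m <= 3)%N ->
  exists2 n, (n <= m)%N & Reg_value K n.
Proof. by move=> [D [rs [rD eD uk W]]]; apply: MRI_small_Reg W. Qed.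

End Reduction.

(** * From values to minima in the natural numbers with infinity *)

Lemma min_ext_Some (V : nat -> Prop) m : min_ext V = Some m ->
  V m /\ forall n, V n -> (m <= n)%N.
Proof.
rewrite /min_ext; case: pselect => // H [<-]; case: ex_minnP => k /asboolP hk hmin.
by split=> // n /asboolT; apply: hmin.
Qed.

Lemma min_ext_None (V : nat -> Prop) : min_ext V = None -> forall n, ~ V n.
Proof. by rewrite /min_ext; case: pselect => // H _ n hn; apply: H; exists n. Qed.

Theorem theorem5 (K : seq (pt3 Rdefinitions.R)) :
  knot_polygon K ->
  ext_lt (MRI K) (Reg K) ->
  ext_le (Some 4%N) (MRI K) /\ ext_le (Some 5%N) (Reg K).
Proof.
move=> _; rewrite /MRI /Reg.
case EM : (min_ext (MRI_value K)) => [m|] //; case ER : (min_ext (Reg_value K)) => [r|] /=.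
  have [hm _] := min_ext_Some EM; have [hr rmin] := min_ext_Some ER.
  move=> mr; have m4 : (4 <= m)%N.
    rewrite leqNgt; apply/negP => m4; have [n nm /rmin rn] := MRI_value_small hm m4.
    by lia.
  by split=> //; lia.
(* [Reg K] is infinite here, so the value of [Reg] that a small [MRI] would yield is absurd. *)
have [hm _] := min_ext_Some EM => _; split=> //.
rewrite leqNgt; apply/negP => m4; have [n _] := MRI_value_small hm m4.
exact: (min_ext_None ER).
Qed.
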